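(* Let $m\ge 1$ and let $\lambda_1,\dots,\lambda_m\in\mathbb R$ with $\sum_i\lambda_i=0$. Let $D\subset\mathbb C$ be a compact domain and let $W:\mathbb C\to\mathbb R$ be a continuous potential function. For each $N\ge 1$ let $(z_1,\dots,z_N)\in D^N$ be distributed according to the eigenvalue distribution of the generalized normal matrix model with parameters $m,\lambda,D,W$ (defined in the context). For $N\ge k\ge 1$ let $\mu_N^{(k)}$ be the $k$-point correlation measure, i.e. the joint law of $(z_1,\dots,z_k)$ on $D^k$ (the marginal obtained by integrating out $z_{k+1},\dots,z_N$ over $D^{N-k}$). Then for every fixed $k\ge 1$, as $N\to\infty$, $\mu_N^{(k)}$ converges weakly to $\sigma^{\otimes k}$, where $\sigma$ is the equilibrium measure on $D$ corresponding to the potential function $W$. In particular the limit does not depend on $m$ and $\lambda$.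
   Context: Compact domain: the closure of a nonempty bounded connected open subset of $\mathbb C$. Generalized normal matrices: $\mathcal N_m(\lambda,D)$ is the set of $A\in \mathrm{Mat}_{mN}(\mathbb C)$, with $N\times N$ blocks $A_{ij}$ ($1\le i,j\le m$), such that $A_{ij}=0$ unless $j-i\equiv 1 \pmod m$; the spectrum of $A_{12}A_{23}\cdots A_{m1}$ is contained in $D$; and $[A,A^\dagger]=\mathrm{diag}(\lambda_1I_N,\dots,\lambda_mI_N)$. The model is the probability measure on $\mathcal N_m(\lambda,D)$ proportional to $\exp(-N\,\mathrm{tr}\,W(A_{12}A_{23}\cdots A_{m1}))\,dM$, with $dM$ the measure induced by the Euclidean metric, and $z_1,\dots,z_N$ are the eigenvalues of $A_{12}A_{23}\cdots A_{m1}$. Eigenvalue distribution: choose real numbers $\alpha_1,\dots,\alpha_m$ with $\lambda_i=\alpha_i-\alpha_{i-1}$ (indices mod $m$), put $Q(x)=\prod_{i=1}^m(x+\alpha_i)$ and $\alpha=\min_i\alpha_i$; $Q$ is a strictly increasing bijection $[-\alpha,\infty)\to[0,\infty)$. For $x_j\in[-\alpha,\infty)$, $\theta_j\in[0,2\pi)$ put $z_j=\sqrt{Q(x_j)}\,e^{i\theta_j}$. The eigenvalue distribution is the image under $(x_j,\theta_j)_j\mapsto(z_j)_j$ of the probability measure on $\{(x_j,\theta_j)_{j=1}^N: z_j\in D \text{ for all } j\}$ which is a constant multiple of $$\exp\Big(-N\sum_{j}W(z_j)\Big)\prod_{j}\sqrt{Q'(x_j)}\prod_{i<j}|z_i-z_j|^2\,dx_1\cdots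 dx_N\,d\theta_1\cdots d\theta_N .$$ Equilibrium measure: for a Borel probability measure $\mu$ on $D$ without point masses put $I_\mu=\int_D W\,d\mu+\int_D\int_D\log|z-w|^{-1}\,d\mu(z)\,d\mu(w)$. The equilibrium measure $\sigma$ is the (existing and unique) such measure minimizing $I_\mu$. *)

(* Defs.v *)
From HB Require Import structures.
From mathcomp Require Import all_boot all_order all_algebra.
From mathcomp Require Import all_classical all_reals all_analysis.
Import Order.TTheory GRing.Theory Num.Theory.
Import numFieldNormedType.Exports.

Set Implicit Arguments.
Unset Strict Implicit.
Unset Printing Implicit Defensive.

Local Open Scope classical_set_scope.
Local Open Scope ring_scope.

(* The complex plane is [R * R], with the product (= Euclidean) topology and
   the product (= Borel) sigma-algebra; points of C^N are [N.-tuple (R * R)].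
   Only the modulus of a difference and polar coordinates are needed. *)
Section ComplexPlane.
Context {R : realType}.
Implicit Types z : R * R.

Definition cabs z : R := Num.sqrt (z.1 ^+ 2 + z.2 ^+ 2).

Definition polar (r t : R) : R * R := (r * cos t, r * sin t).

Definition compact_domain (D : set (R * R)) : Prop :=
  exists U : set (R * R),
    [/\ U !=set0, bounded_set U, connected U, open U & D = closure U].

End ComplexPlane.

Definition cube {T : Type} (D : set T) (n : nat) : set (n.-tuple T) :=
  [set z | forall i, D (tnth z i)].
Arguments cube {T} D n.

(* A copy of [mu \x nu] on which the sigma-finite structure is canonical. *)
Section SigmaFiniteProduct.
Context d1 d2 (T1 : measurableType d1) (T2 : measurableType d2) (R : realType).
Variables (mu : {sigma_finite_measure set T1 -> \bar R})
          (nu : {sigma_finite_measure set T2 -> \bar R}).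
Local Open Scope ereal_scope.

Definition sprod : set (T1 * T2) -> \bar R := mu \x nu.

HB.instance Definition _ := Measure.on sprod.

Let sprod_sigma_finite : sigma_finite setT sprod.
Proof.
have /sigma_finiteP[F [TF ndF Foo]] := sigma_finiteT mu.
have /sigma_finiteP[G [TG ndG Goo]] := sigma_finiteT nu.
exists (fun n => F n `*` G n).
  rewrite -setXTT TF TG; apply/seteqP; split => -[x y] /=.
    move=> [[n _ Fnx] [k _ Gky]]; exists (maxn n k) => //; split.
    - by move: x Fnx; exact/subsetPset/ndF/leq_maxl.
    - by move: y Gky; exact/subsetPset/ndG/leq_maxr.
  by move=> [n _ []/= ? ?]; split; exists n.
move=> k; have [? ?] := Foo k; have [? ?] := Goo k.
split; first exact: measurableX.
by rewrite /sprod product_measure1E// lte_mul_pinfty// ge0_fin_numE.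
Qed.

HB.instance Definition _ :=
  Measure_isSigmaFinite.Build _ _ _ sprod sprod_sigma_finite.

End SigmaFiniteProduct.

Section ProductMeasure.
Context d (T : measurableType d) (R : realType).
Local Open Scope ereal_scope.

Definition tcons n (p : T * n.-tuple T) : n.+1.-tuple T := [tuple of p.1 :: p.2].

Lemma measurable_tcons n : measurable_fun setT (@tcons n).
Proof. exact: measurable_cons measurable_fst measurable_snd. Qed.

Section step.
Variables (mu : {sigma_finite_measure set T -> \bar R}) (n : nat).
Variable nu : {sigma_finite_measure set (n.-tuple T) -> \bar R}.

Definition pow_succ : set (n.+1.-tuple T) -> \bar R :=
  pushforward (sprod mu nu) (@tcons n).

Let pow_succ0 : pow_succ set0 = 0.
Proof. by rewrite /pow_succ /pushforward preimage_set0 (measure0 (sprod mu nu)). Qed.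

Let pow_succ_ge0 A : 0 <= pow_succ A.
Proof. exact: (measure_ge0 (sprod mu nu)). Qed.

Let pow_succ_sigma_additive : semi_sigma_additive pow_succ.
Proof.
move=> F mF tF mUF; rewrite /pow_succ /pushforward preimage_bigcup.
have mpre A : measurable A -> measurable (@tcons n @^-1` A).
  by move=> mA; rewrite -[X in measurable X]setTI; exact: measurable_tcons.
apply: (@measure_semi_sigma_additive _ _ _ (sprod mu nu)).
- by move=> i; exact: mpre.
- apply/trivIsetP => /= i j _ _ ij; rewrite -preimage_setI.
  by move/trivIsetP : tF => /(_ _ _ _ _ ij) ->//; rewrite preimage_set0.
- by rewrite -preimage_bigcup; exact: mpre.
Qed.

HB.instance Definition _ := isMeasure.Build _ _ _ pow_succ
  pow_succ0 pow_succ_ge0 pow_succ_sigma_additive.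

Let pow_succ_sigma_finite : sigma_finite setT pow_succ.
Proof.
have [F F1 F2] := sigma_finiteT (sprod mu nu).
pose u (t : n.+1.-tuple T) : T * n.-tuple T := (thead t, [tuple of behead t]).
have uK : cancel u (@tcons n).
  by move=> t; rewrite /tcons /u /= [RHS]tuple_eta; apply/val_inj.
have tK : cancel (@tcons n) u.
  by case=> a b; rewrite /u /tcons theadE; congr pair; apply/val_inj.
have mu_ : measurable_fun setT u.
  apply/measurable_fun_pairP; split.
    exact: measurable_tnth.
  exact: measurable_behead.
exists (fun i => u @^-1` F i).
  by rewrite -preimage_bigcup -F1.
move=> i; have [mF Fi] := F2 i; split.
  by rewrite -[X in measurable X]setTI; exact: mu_.
rewrite /pow_succ /pushforward.
suff -> : @tcons n @^-1` (u @^-1` F i) = F i by [].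
by apply/seteqP; split => p /=; rewrite tK.
Qed.

HB.instance Definition _ :=
  Measure_isSigmaFinite.Build _ _ _ pow_succ pow_succ_sigma_finite.
End step.

(* The [n]-fold product measure: the tuple sigma-algebra is in the library,
   but only binary products of measures are. *)
Fixpoint measure_pow (mu : {sigma_finite_measure set T -> \bar R}) (n : nat) :
    {sigma_finite_measure set (n.-tuple T) -> \bar R} :=
  if n is m.+1 then pow_succ mu (measure_pow mu m) else dirac [tuple].

Lemma measure_powE (mu : {sigma_finite_measure set T -> \bar R}) n
    (A : 'I_n -> set T) : (forall i, measurable (A i)) ->
  measure_pow mu n [set t | forall i, A i (tnth t i)] = \prod_(i < n) mu (A i).
Proof.
elim: n A => [|n IH] A mA /=.
  by rewrite big_ord0 diracE mem_set//= => -[].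
rewrite big_ord_recl -IH; last by move=> i; exact: mA.
rewrite -product_measure1E //; last first.
  rewrite (_ : mkset _ = \bigcap_(i in [set: 'I_n])
      (fun t => tnth t i) @^-1` A (lift ord0 i)).
    apply: fin_bigcap_measurable => //= i _.
    by rewrite -[X in measurable X]setTI; exact: measurable_tnth.
  by apply/seteqP; split => t /= h i; [move=> _; exact: h | exact: h].
rewrite /pow_succ /pushforward /sprod; congr (product_measure1 _ _ _).
apply/seteqP; split => -[a t] /=.
  move=> h; split; first by have := h ord0.
  by move=> i; have := h (lift ord0 i); rewrite tnthS.
move=> [ha ht] i; case: (unliftP ord0 i) => [j|] ->; rewrite ?tnthS//.
Qed.

End ProductMeasure.

Section EigenvalueDistribution.
Context {R : realType}.
Variables (m : nat) (lambda : 'I_m -> R) (D : set (R * R)) (W : R * R -> R).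

Definition Qpoly (alpha : 'I_m -> R) : {poly R} :=
  \prod_(i < m) ('X + (alpha i)%:P).

Definition eigenvalue_of (alpha : 'I_m -> R) (p : R * R) : R * R :=
  polar (Num.sqrt (Qpoly alpha).[p.1]) p.2.

Definition eigenvalues (alpha : 'I_m -> R) N (t : N.-tuple (R * R)) :
    N.-tuple (R * R) :=
  map_tuple (eigenvalue_of alpha) t.

(* The parameters [(x_j, theta_j)]; [inf (range alpha)] is the minimum of the
   [alpha i], as [m > 0] throughout. *)
Definition parameters (alpha : 'I_m -> R) N : set (N.-tuple (R * R)) :=
  [set t | forall j, [/\ - inf (range alpha) <= (tnth t j).1,
                         0 <= (tnth t j).2 < 2 * pi
                       & D (eigenvalue_of alpha (tnth t j))]].

Definition density (alpha : 'I_m -> R) N (t : N.-tuple (R * R)) : R :=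
  let z := tnth (eigenvalues alpha t) in
  expR (- (N%:R * \sum_(j < N) W (z j)))
  * \prod_(j < N) Num.sqrt (Qpoly alpha)^`().[(tnth t j).1]
  * \prod_(i < N) \prod_(j < N | (i < j)%N) cabs (z i - z j) ^+ 2.

Definition parameter_weight (alpha : 'I_m -> R) N (A : set (N.-tuple (R * R))) :
    \bar R :=
  (\int[measure_pow (sprod lebesgue_measure lebesgue_measure) N]_(t in
      @parameters alpha N `&` A) (density alpha t)%:E)%E.

(* [ord_pred] is the cyclic predecessor. *)
Definition is_eigenvalue_distribution N
    (nu : probability (N.-tuple (R * R)) R) : Prop :=
  exists alpha : 'I_m -> R,
    (forall i, lambda i = alpha i - alpha (ord_pred i)) /\
    exists c : R, forall A, measurable A ->
      nu A = (c%:E * pushforward (@parameter_weight alpha N)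
                                 (@eigenvalues alpha N) A)%E.

End EigenvalueDistribution.

Section EquilibriumMeasure.
Context {R : realType}.
Variables (D : set (R * R)) (W : R * R -> R).
Local Open Scope ereal_scope.

(* A Borel probability measure on [D] is represented by a Borel probability
   measure on the plane giving mass 1 to [D]. *)
Definition nonatomic_on (mu : probability (R * R)%type R) : Prop :=
  mu D = 1 /\ forall z, mu [set z] = 0.

(* On the diagonal the integrand is [ln 0^-1 = 0] instead of [+oo]; this is
   irrelevant since [mu] has no point masses. *)
Definition energy (mu : probability (R * R)%type R) : \bar R :=
  \int[mu]_(z in D) (W z)%:E
  + \int[mu]_(z in D) \int[mu]_(w in D) (ln (cabs (z - w))^-1)%:E.

Definition is_equilibrium_measure (sigma : probability (R * R)%type R) : Prop :=
  nonatomic_on sigma /\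
  forall mu : probability (R * R)%type R,
    nonatomic_on mu -> energy sigma <= energy mu.

End EquilibriumMeasure.

Section Correlation.
Context d (T : measurableType d) (R : realType) (k n : nat).

Definition initial (z : (k + n).-tuple T) : k.-tuple T :=
  [tuple tnth z (lshift n i) | i < k].

Lemma measurable_initial : measurable_fun setT initial.
Proof.
apply/measurable_fun_tnthP => i.
rewrite (_ : _ \o _ = @tnth _ T ^~ (lshift n i)); first exact: measurable_tnth.
by apply/funext => z /=; rewrite tnth_mktuple.
Qed.

HB.instance Definition _ :=
  isMeasurableFun.Build _ _ _ _ initial measurable_initial.

(* The [k]-point correlation measure for [N = k + n] particles. *)
Definition correlation (mu : probability ((k + n).-tuple T) R) :
    probability (k.-tuple T) R :=
  distribution mu initial.

End Correlation.

(* Weak convergence on [D^k]. For [D] compact every continuous [f] on [D^k] is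
   bounded, so these are all the usual test functions. Tuples carry no topology;
   [D^k] is therefore seen in the product [prod_(i < k) (R * R)]. *)
Definition weakly_cvg_on {R : realType} (D : set (R * R)) (k : nat)
    (mu_ : nat -> {measure set (k.-tuple (R * R)) -> \bar R})
    (mu : {measure set (k.-tuple (R * R)) -> \bar R}) : Prop :=
  forall f : {ptws 'I_k -> (R * R)%type} -> R,
    {within [set z : {ptws 'I_k -> (R * R)%type} | forall i, D (z i)],
      continuous f} ->
    (\int[mu_ n]_(z in cube D k) (f (tnth z))%:E)%E @[n --> \oo] -->
    (\int[mu]_(z in cube D k) (f (tnth z))%:E)%E.

(* Main.v *)
Require Import Defs.
From HB Require Import structures.
From mathcomp Require Import all_boot all_order all_algebra.
From mathcomp Require Import all_classical all_reals all_analysis measurable_realfun.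
From mathcomp Require Import perm ring lra.
Import Order.TTheory GRing.Theory Num.Theory.
Import numFieldNormedType.Exports.

Local Open Scope classical_set_scope.
Local Open Scope ring_scope.

Set Implicit Arguments.
Unset Strict Implicit.
Unset Printing Implicit Defensive.

(** The eigenvalues form a two-dimensional Coulomb gas. In the coordinates
    [(x_j, theta_j)] the factors [sqrt (Q' (x_j))] only enter the law
    [eigenmeasure] of a single eigenvalue without interaction; up to a constant,
    the rest of the density is [exp (- hamiltonian)]
    ([eigenvalue_distribution_gibbs]). The hamiltonian is of order [N^2], whereas
    the powers of the reference measure contribute factors that are exponential
    in [N]. For large [N] the points therefore nearly minimize the energy,
    whatever the reference measure, and [m] and [lambda] disappear in the limit.
    What matters is that the reference measure is finite, does not depend on [N]
    ([cyclic_difference], [eigenmeasure_shift]), and is rich enough to dominate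
    measures of finite energy near every point of the domain
    ([eigenmeasure_spread]).

    Nearly minimizing measures are close to [sigma] because the energy is
    uniformly convex. The logarithmic kernel, plus the logarithm of a bound on the
    diameter, is a positive superposition of Gaussian kernels by the integral of
    Frullani ([integral_frullani], [logker_gaussgap]), and a Gaussian kernel is a
    Gram kernel ([integral_gaussM]). Hence the logarithmic energy dominates a
    Hilbert distance between Gaussian smoothings ([mutual_coercive]), which
    detects Lipschitz test functions ([mutual_close]). Comparing [sigma] with its
    midpoint with another measure gives the stability estimate
    ([posenergy_midpoint], [energy_stability]).

    A sum of point masses has infinite logarithmic energy, so each point of a
    configuration is smeared over a small neighbourhood within the domain by a
    measure that satisfies a Frostman estimate and is dominated by
    [eigenmeasure]. Such measures exist because the domain is the closure of a
    connected open set: all small circles around a point of the domain meet the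
    open set, and in it most rays from the origin cross them
    ([circles_meet], [rays_cross]), so that the law of the distance to the point
    dominates Lebesgue measure ([distance_null]) and can be reweighted to it.
    Smearing nearly preserves the energy of a configuration, since a bounded
    energy leaves room for few close pairs only ([near_pairs],
    [spread_configuration]).

    Smearing serves twice. Applied to one configuration of low energy, it yields a
    dominated measure of nearly minimal energy, with which the inequality of
    Jensen bounds the partition function from below ([mean_boltzmann],
    [partition_lower]); configurations of larger energy are then exponentially
    rare ([gibbs_concentration]). Applied to the remaining configurations, it
    shows that their averages of test functions are those of [sigma], up to a
    small error ([gibbs_empirical]). By exchangeability a product of test
    functions at [k] different points can be replaced, one factor after the other,
    by such averages ([gibbs_invol], [exchangeable_product]), and sums of products
    of test functions approximate all continuous functions on the cube
    ([product_approximation], [weak_limit]). *)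

(** * Densities and powers of measures *)

Lemma measurable_EFin_comp d (T : measurableType d) (R : realType)
    (D : set T) (g : T -> R) :
  measurable_fun D g -> measurable_fun D (fun x => (g x)%:E).
Proof. by move=> mg; apply/measurable_EFinP. Qed.

Section Density.
Context d (T : measurableType d) (R : realType).
Variables (mu : {measure set T -> \bar R}) (g : T -> R).
Hypotheses (mg : measurable_fun [set: T] g) (g0 : forall x, 0 <= g x).
Local Open Scope ereal_scope.

Definition with_density & measurable_fun [set: T] g & (forall x, (0 <= g x)%R) :
    set T -> \bar R :=
  fun A => \int[mu]_(t in A) (g t)%:E.

Local Notation nu := (with_density mg g0).

Let nu0 : nu set0 = 0. Proof. by rewrite /with_density integral_set0. Qed.

Let nu_ge0 A : 0 <= nu A.
Proof. by apply: integral_ge0 => x _; rewrite lee_fin. Qed.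

Let nu_sigma_additive : semi_sigma_additive nu.
Proof.
apply: semi_sigma_additive_nng_induced; first exact/measurable_EFinP.
by move=> x; rewrite lee_fin.
Qed.

HB.instance Definition _ := isMeasure.Build _ _ _ nu nu0 nu_ge0
  nu_sigma_additive.

Import HBNNSimple.

Lemma integral_with_density (f : T -> \bar R) :
  (forall x, 0 <= f x) -> measurable_fun [set: T] f ->
  \int[nu]_x f x = \int[mu]_x (f x * (g x)%:E).
Proof.
move=> f0 mf; pose h := nnsfun_approx measurableT mf.
have mgE : measurable_fun [set: T] (EFin \o g) by exact/measurable_EFinP.
have -> : \int[nu]_x f x = limn (fun n => \int[nu]_x (h n x)%:E).
  rewrite -monotone_convergence//.
  - by apply: eq_integral => x _; apply/esym/cvg_lim => //; exact: cvg_nnsfun_approx.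
  - by move=> n; exact/measurable_EFinP.
  - by move=> n x _; rewrite lee_fin.
  - by move=> x _ a b ab; rewrite lee_fin; exact/lefP/nd_nnsfun_approx.
have -> : \int[mu]_x (f x * (g x)%:E) =
    limn (fun n => \int[mu]_x ((h n x)%:E * (g x)%:E)).
  rewrite -monotone_convergence//.
  - apply: eq_integral => x _; apply/esym/cvg_lim => //.
    by apply: cvgeZr => //; exact: cvg_nnsfun_approx.
  - by move=> n; apply: emeasurable_funM => //; exact/measurable_EFinP.
  - by move=> n x _; rewrite mule_ge0// lee_fin.
  - move=> x _ a b ab; rewrite lee_wpmul2r ?lee_fin//.
    exact/lefP/nd_nnsfun_approx.
suff E n : \int[mu]_x ((h n x)%:E * (g x)%:E) = \int[nu]_x (h n x)%:E.
  by congr (limn _); apply/funext => n; rewrite E.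
transitivity (\int[nu]_x
   (\sum_(y \in range (h n)) (y * \1_(h n @^-1` [set y]) x)%:E)); last first.
  by apply: eq_integral => t _; rewrite /= fimfunE -fsumEFin.
have indich r : measurable_fun [set: T]
    (fun x => (r * \1_(h n @^-1` [set r]) x)%:E).
  by apply: (measurable_comp measurableT) => //; exact: measurable_funM.
rewrite ge0_integral_fsum//; last by move=> m y Ey; exact: nnfun_muleindic_ge0.
transitivity (\int[mu]_x (\sum_(y \in range (h n))
    (y * \1_(h n @^-1` [set y]) x)%:E * (g x)%:E)).
  apply: eq_integral => x _.
  rewrite -ge0_mule_fsuml => [|y]; last exact: nnfun_muleindic_ge0.
  by rewrite fsumEFin // -(fimfunE _ x).
rewrite ge0_integral_fsum//; last 2 first.
  - by move=> y; apply: emeasurable_funM.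
  - move=> m y Ey; apply: mule_ge0; last by rewrite lee_fin.
    exact: nnfun_muleindic_ge0.
apply: eq_fsbigr => r rhn.
under [RHS]eq_integral do rewrite EFinM.
rewrite integralZl_indic_nnsfun => //.
under eq_integral do rewrite EFinM -muleA.
rewrite ge0_integralZl//.
- under eq_integral do rewrite muleC.
  rewrite (eq_integral ((EFin \o g) \_ (h n @^-1` [set r]))); last first.
    by move=> x xE; rewrite epatch_indic.
  by rewrite -integral_mkcondr integral_indic// setTI setIT.
- by apply: emeasurable_funM => //; exact/measurable_EFinP.
- by move=> t _; rewrite mule_ge0 ?lee_fin.
- by move: rhn; rewrite inE => -[t _ <-]; rewrite lee_fin.
Qed.

End Density.

Section ProductPower.
Context d (T : measurableType d) (R : realType).
Local Open Scope ereal_scope.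
Implicit Type mu : {sigma_finite_measure set T -> \bar R}.

Lemma integral_pow0 mu (f : 0.-tuple T -> \bar R) : (forall t, 0 <= f t) ->
  measurable_fun [set: 0.-tuple T] f ->
  \int[measure_pow mu 0]_t f t = f [tuple].
Proof. by move=> f0 mf; rewrite integral_dirac// diracT mul1e. Qed.

Lemma integral_powS mu n (f : n.+1.-tuple T -> \bar R) : (forall t, 0 <= f t) ->
  measurable_fun [set: n.+1.-tuple T] f ->
  \int[measure_pow mu n.+1]_t f t =
  \int[mu]_a \int[measure_pow mu n]_t f (tcons (a, t)).
Proof.
move=> f0 mf; rewrite /= /pow_succ.
rewrite (@ge0_integral_pushforward _ _ _ _ _ (@tcons _ T n)
  (@measurable_tcons _ T n) (sprod mu (measure_pow mu n)))//.
rewrite preimage_setT /sprod fubini_tonelli1//; last by move=> p; exact: f0.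
exact: measurableT_comp (@measurable_tcons _ T n).
Qed.

Lemma measurable_cube_gen n (A : 'I_n -> set T) :
  (forall i, measurable (A i)) ->
  measurable [set t : n.-tuple T | forall i, A i (tnth t i)].
Proof.
move=> mA; rewrite (_ : mkset _ = \bigcap_(i in [set: 'I_n])
    (fun t => tnth t i) @^-1` A i).
  apply: fin_bigcap_measurable => //= i _.
  by rewrite -[X in measurable X]setTI; exact: measurable_tnth.
by apply/seteqP; split => t /= h i; [move=> _; exact: h | exact: h].
Qed.

(** Boxes form a pi-system generating the product sigma-algebra. *)
Lemma box_measure_unique n (m1 m2 : {measure set (n.-tuple T) -> \bar R}) :
  m1 setT < +oo ->
  (forall A : 'I_n -> set T, (forall i, measurable (A i)) ->
    m1 [set t | forall i, A i (tnth t i)] =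
    m2 [set t | forall i, A i (tnth t i)]) ->
  forall X, measurable X -> m1 X = m2 X.
Proof.
move=> m1oo m12 X mX.
pose G : set (set (n.-tuple T)) := [set B | exists2 A : 'I_n -> set T,
  (forall i, measurable (A i)) & B = [set t | forall i, A i (tnth t i)]].
have GT : G setT.
  exists (fun=> setT); first by [].
  by apply/seteqP; split.
apply: (measure_unique G (fun=> setT)) => //.
- apply/seteqP; split; last first.
    apply: smallest_sub; first exact: sigma_algebra_measurable.
    by move=> _ [A mA ->]; exact: measurable_cube_gen.
  apply: smallest_sub; first exact: smallest_sigma_algebra.
  move=> B/=; rewrite -bigcup_seq => -[i _ [C mC <-]].
  apply: sub_sigma_algebra; rewrite setTI.
  exists (fun j => if j == i then C else setT) => /=.
    by move=> j; case: ifP.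
  apply/seteqP; split => t /=.
    by move=> Ct j; case: ifPn => // /eqP ->.
  by move=> /(_ i); rewrite eqxx.
- move=> _ _ [A mA ->] [B mB ->].
  exists (fun i => A i `&` B i); first by move=> i; exact: measurableI.
  apply/seteqP; split => t /=; first by move=> [h1 h2] i; split.
  by move=> h; split=> i; have [] := h i.
- by apply/seteqP; split => // x _; exists 0%N.
- by move=> _ [A mA ->]; exact: m12.
Qed.

End ProductPower.

Lemma integral_swap d1 d2 (T1 : measurableType d1) (T2 : measurableType d2)
    (R : realType) (m1 : {sigma_finite_measure set T1 -> \bar R})
    (m2 : {sigma_finite_measure set T2 -> \bar R}) (f : T1 -> T2 -> \bar R) :
  (forall x y, (0 <= f x y)%E) ->
  measurable_fun [set: T1 * T2] (fun p => f p.1 p.2) ->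
  (\int[m1]_x \int[m2]_y f x y = \int[m2]_y \int[m1]_x f x y)%E.
Proof.
move=> f0 mf; apply: (@fubini_tonelli _ _ T1 T2 R m1 m2 (fun p => f p.1 p.2)) => //.
Qed.

Lemma integral_cst1 d (T : measurableType d) (R : realType)
    (m : {measure set T -> \bar R}) (c : \bar R) :
  m setT = 1%E -> (\int[m]__ c = c)%E.
Proof. by move=> m1; rewrite integral_cst// m1 mule1. Qed.

Section ProductPowerTheory.
Context d (T : measurableType d) (R : realType).
Local Open Scope ereal_scope.

Lemma measurable_tcons2 n (a : T) :
  measurable_fun [set: n.-tuple T] (fun t => tcons (a, t)).
Proof.
by apply: measurableT_comp; [exact: measurable_tcons|exact: measurable_pair1].
Qed.

Lemma measurable_pow_inner (mu : {sigma_finite_measure set T -> \bar R}) n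
    (f : n.+1.-tuple T -> \bar R) : (forall t, 0 <= f t) ->
  measurable_fun [set: n.+1.-tuple T] f ->
  measurable_fun [set: T] (fun a => \int[measure_pow mu n]_t f (tcons (a, t))).
Proof.
move=> f0 mf; apply: (@measurable_fun_fubini_tonelli_F _ _ T _ R (measure_pow mu n)
  (fun p : T * n.-tuple T => f (tcons p))) => //.
exact: measurableT_comp (@measurable_tcons _ T n).
Qed.

Lemma integral_pow_density (mu nu : {sigma_finite_measure set T -> \bar R})
    (g : T -> R) (mg : measurable_fun [set: T] g) (g0 : forall x, (0 <= g x)%R) :
  (forall A, measurable A -> nu A = with_density mu mg g0 A) ->
  forall n (f : n.-tuple T -> \bar R), (forall t, 0 <= f t) ->
  measurable_fun [set: n.-tuple T] f ->
  \int[measure_pow nu n]_t f t =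
  \int[measure_pow mu n]_t (f t * (\prod_(i < n) g (tnth t i))%:E).
Proof.
move=> nuE; have nuI f : (forall x, 0 <= f x) -> measurable_fun setT f ->
    \int[nu]_x f x = \int[mu]_x (f x * (g x)%:E).
  move=> f0 mf; rewrite (eq_measure_integral (with_density mu mg g0)).
    exact: integral_with_density.
  by move=> A mA _; exact: nuE.
have mprod n : measurable_fun [set: n.-tuple T]
    (fun t => \prod_(i < n) g (tnth t i))%R.
  apply: measurable_prod => i _; apply: measurableT_comp => //.
  exact: measurable_tnth.
have p0 n (t : n.-tuple T) : (0 <= \prod_(i < n) g (tnth t i))%R.
  by apply: prodr_ge0.
elim=> [|n IH] f f0 mf.
  rewrite !integral_pow0 ?big_ord0 ?mule1//.
  - by move=> t; rewrite big_ord0 mule1.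
  - by under eq_fun do rewrite big_ord0 mule1.
have mfg k (h : k.-tuple T -> \bar R) : measurable_fun setT h ->
    measurable_fun setT (fun t => h t * (\prod_(i < k) g (tnth t i))%:E).
  move=> mh; apply: emeasurable_funM => //.
  by apply: measurable_EFin_comp; exact: mprod.
rewrite [RHS]integral_powS//; last 2 first.
- by move=> t; rewrite mule_ge0 ?lee_fin.
- exact: mfg.
rewrite integral_powS// nuI//; last 2 first.
- by move=> x; apply: integral_ge0.
- exact: measurable_pow_inner.
apply: eq_integral => a _; rewrite IH//; last first.
  exact: measurableT_comp (measurable_tcons2 a).
rewrite -ge0_integralZr//; first last.
- by rewrite lee_fin.
- by move=> t _; rewrite mule_ge0 ?lee_fin.
- by apply: (mfg n (fun t => f (tcons (a, t)))); exact: measurableT_comp (measurable_tcons2 a).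
apply: eq_integral => t _; rewrite -muleA -EFinM; congr (_ * _%:E).
rewrite big_ord_recl mulrC; congr (_ * _)%R.
  by apply: eq_bigr => i _; rewrite tnthS.
Qed.

Lemma le_integral_pow (mu nu : {sigma_finite_measure set T -> \bar R}) (M : R) :
  (0 <= M)%R -> (forall A, measurable A -> nu A <= M%:E * mu A) ->
  forall n (f : n.-tuple T -> \bar R), (forall t, 0 <= f t) ->
  measurable_fun [set: n.-tuple T] f ->
  \int[measure_pow nu n]_t f t <= (M ^+ n)%:E * \int[measure_pow mu n]_t f t.
Proof.
move=> M0 numu.
have nuI f : (forall x, 0 <= f x) -> measurable_fun setT f ->
    \int[nu]_x f x <= M%:E * \int[mu]_x f x.
  move=> f0 mf.
  apply: (@le_trans _ _ (\int[mscale (NngNum M0) mu]_x f x)).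
    exact: ge0_le_measure_integral.
  by rewrite ge0_integral_mscale.
elim=> [|n IH] f f0 mf; first by rewrite expr0 mul1e !integral_pow0.
rewrite !integral_powS//.
apply: (@le_trans _ _ (\int[nu]_a ((M ^+ n)%:E *
    \int[measure_pow mu n]_t f (tcons (a, t))))).
  apply: ge0_le_integral => //.
  - by move=> a _; apply: integral_ge0.
  - exact: measurable_pow_inner.
  - apply: emeasurable_funM => //; exact: measurable_pow_inner.
  - move=> a _; apply: IH => //.
    exact: measurableT_comp (measurable_tcons2 a).
rewrite ge0_integralZl//; last 3 first.
- exact: measurable_pow_inner.
- by move=> a _; apply: integral_ge0.
- by rewrite lee_fin exprn_ge0.
rewrite exprSr EFinM -muleA lee_wpmul2l ?lee_fin ?exprn_ge0//.
apply: nuI; first by move=> a; exact: integral_ge0.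
exact: measurable_pow_inner.
Qed.

Lemma measure_pow_setT (mu : {sigma_finite_measure set T -> \bar R}) n :
  measure_pow mu n setT = mu setT ^+ n.
Proof.
transitivity (measure_pow mu n
    [set t | forall i : 'I_n, (fun=> [set: T]) i (tnth t i)]).
  by congr (measure_pow _ _ _); apply/seteqP; split.
rewrite (@measure_powE _ _ _ mu n (fun=> setT))//.
by rewrite big_const_ord iter_mule ?mule1.
Qed.

Lemma measure_pow_prob1 (P : probability T R) n : measure_pow P n setT = 1.
Proof.
rewrite measure_pow_setT; transitivity ((1 : \bar R) ^+ n).
  by congr (_ ^+ n); exact: probability_setT.
by rewrite -EFin_expe expr1n.
Qed.

Lemma integral_pow_tnth (P : probability T R) n (i : 'I_n) (f : T -> \bar R) :
  (forall t, 0 <= f t) -> measurable_fun [set: T] f ->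
  \int[measure_pow P n]_t f (tnth t i) = \int[P]_x f x.
Proof.
move=> f0 mf.
have mfi k (j : 'I_k) :
    measurable_fun [set: k.-tuple T] (fun t => f (tnth t j)).
  by apply: measurableT_comp => //; exact: measurable_tnth.
elim: n i => [[]//|n IH] i; rewrite integral_powS//.
case: (unliftP ord0 i) => [j|] ->.
  under eq_integral do under eq_integral do rewrite tnthS.
  under eq_integral do rewrite (IH j).
  exact/integral_cst1/probability_setT.
apply: eq_integral => a _; exact: (integral_cst1 (f a) (measure_pow_prob1 P n)).
Qed.

Lemma integral_pow_tnth2 (P : probability T R) n (i j : 'I_n)
    (f : T -> T -> \bar R) : i != j ->
  (forall x y, 0 <= f x y) -> measurable_fun [set: T * T] (fun p => f p.1 p.2) ->
  \int[measure_pow P n]_t f (tnth t i) (tnth t j) = \int[P]_x \int[P]_y f x y.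
Proof.
move=> ij f0 mf.
have mf1 x : measurable_fun setT (f x).
  exact: (measurableT_comp mf (measurable_pair1 x)).
have mf2 y : measurable_fun setT (f ^~ y).
  exact: (measurableT_comp mf (measurable_pair2 y)).
have mfi k (i1 j1 : 'I_k) :
    measurable_fun [set: k.-tuple T] (fun t => f (tnth t i1) (tnth t j1)).
  have mt : measurable_fun [set: k.-tuple T] (fun t => (tnth t i1, tnth t j1)).
    by apply/measurable_fun_pairP; split; exact: measurable_tnth.
  exact: (measurableT_comp mf mt).
elim: n i j ij => [[]//|n IH] i j; rewrite integral_powS//.
case: (unliftP ord0 i) => [i'|] ->; case: (unliftP ord0 j) => [j'|] -> ij;
  last by rewrite eqxx in ij.
- under eq_integral do under eq_integral do rewrite !tnthS.
  under eq_integral do rewrite IH//.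
  exact/integral_cst1/probability_setT.
- under eq_integral do under eq_integral do rewrite tnthS /=.
  transitivity (\int[P]_a \int[P]_x f x a).
    apply: eq_integral => a _; exact: (integral_pow_tnth P i' (f := f ^~ a)).
  exact: (esym (integral_swap P P f0 mf)).
- under eq_integral do under eq_integral do rewrite tnthS /=.
  apply: eq_integral => a _; exact: (integral_pow_tnth P j' (f := f a)).
Qed.

(** A power of a measure and its image under a permutation of the coordinates
    agree on boxes. *)
Lemma integral_pow_invol (mu : {finite_measure set T -> \bar R}) n
    (s : 'I_n -> 'I_n) (f : n.-tuple T -> \bar R) : involutive s ->
  (forall t, 0 <= f t) -> measurable_fun [set: n.-tuple T] f ->
  \int[measure_pow mu n]_t f [tuple tnth t (s i) | i < n] =
  \int[measure_pow mu n]_t f t.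
Proof.
move=> sK f0 mf; pose h (t : n.-tuple T) := [tuple tnth t (s i) | i < n].
have mh : measurable_fun setT h.
  apply/measurable_fun_tnthP => i.
  rewrite (_ : _ \o _ = @tnth _ T ^~ (s i)); first exact: measurable_tnth.
  by apply/funext => t /=; rewrite tnth_mktuple.
have -> : \int[measure_pow mu n]_t f t =
    \int[pushforward (measure_pow mu n) h]_t f t.
  apply: eq_measure_integral => A mA _.
  apply: box_measure_unique => //.
    rewrite [ltLHS](_ : _ = mu setT ^+ n); last exact: measure_pow_setT.
    by rewrite ltey_eq fin_numX// fin_num_measure.
  move=> B mB; rewrite [LHS]measure_powE// /= /pushforward.
  rewrite (_ : _ @^-1` _ =
      [set t | forall i, (fun i => B (s i)) i (tnth t i)]).
    rewrite [RHS](@measure_powE _ _ _ mu n (fun i => B (s i))); last first.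
      by move=> i; exact: mB.
    by rewrite (reindex_inj (inv_inj sK)).
  apply/seteqP; split => t /= tB i.
    by have := tB (s i); rewrite tnth_mktuple sK.
  by rewrite tnth_mktuple; have := tB (s i); rewrite sK.
by rewrite ge0_integral_pushforward// preimage_setT.
Qed.

End ProductPowerTheory.

Lemma integral_pow_pushforward d1 d2 (T1 : measurableType d1)
    (T2 : measurableType d2) (R : realType)
    (mu : {sigma_finite_measure set T1 -> \bar R})
    (nu : {sigma_finite_measure set T2 -> \bar R}) (h : T1 -> T2) :
  measurable_fun [set: T1] h ->
  (forall A, measurable A -> nu A = mu (h @^-1` A)) ->
  forall n (f : n.-tuple T2 -> \bar R), (forall t, (0 <= f t)%E) ->
  measurable_fun [set: n.-tuple T2] f ->
  (\int[measure_pow nu n]_t f t =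
   \int[measure_pow mu n]_t f (map_tuple h t))%E.
Proof.
move=> mh nuE.
have mmap n : measurable_fun [set: n.-tuple T1] (map_tuple h).
  apply/measurable_fun_tnthP => i.
  rewrite (_ : _ \o _ = h \o (@tnth _ T1 ^~ i)).
    by apply: measurableT_comp => //; exact: measurable_tnth.
  by apply/funext => t /=; rewrite tnth_map.
elim=> [|n IH] f f0 mf.
  rewrite !integral_pow0//; last exact: (measurableT_comp mf (mmap _)).
  by congr (f _); apply/val_inj.
rewrite !integral_powS//; last exact: (measurableT_comp mf (mmap _)).
rewrite (eq_measure_integral (pushforward mu h)); last by move=> A mA _; exact: nuE.
rewrite ge0_integral_pushforward//; last 2 first.
- exact: measurable_pow_inner.
- by move=> a _; exact: integral_ge0.
rewrite preimage_setT; apply: eq_integral => a _ /=.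
rewrite IH//; last exact: (measurableT_comp mf (measurable_tcons2 (h a))).
by apply: eq_integral => t _; congr (f _); apply/val_inj.
Qed.

(** * The modulus *)

Section Modulus.
Context {R : realType}.
Implicit Types z w u : R * R.

Lemma cabs_ge0 z : 0 <= cabs z. Proof. exact: sqrtr_ge0. Qed.

Lemma cabs_sqr z : cabs z ^+ 2 = z.1 ^+ 2 + z.2 ^+ 2.
Proof. by rewrite sqr_sqrtr// addr_ge0 ?sqr_ge0. Qed.

Lemma cabs_eq0 z : (cabs z == 0) = (z == 0).
Proof.
have -> : (cabs z == 0) = (cabs z ^+ 2 == 0) by rewrite expf_eq0.
by rewrite cabs_sqr paddr_eq0 ?sqr_ge0// !expf_eq0; case: z.
Qed.

Lemma cabs0 : cabs (0 : R * R) = 0.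
Proof. by apply/eqP; rewrite cabs_eq0. Qed.

Lemma cabsN z : cabs (- z) = cabs z.
Proof. by rewrite /cabs /= !sqrrN. Qed.

Lemma cabsB z w : cabs (z - w) = cabs (w - z).
Proof. by rewrite -cabsN opprB. Qed.

Lemma le_cabs_fst z : `|z.1| <= cabs z.
Proof.
rewrite -ler_sqr ?nnegrE ?cabs_ge0// cabs_sqr -normrX ger0_norm ?sqr_ge0//.
by rewrite lerDl sqr_ge0.
Qed.

Lemma le_cabs_snd z : `|z.2| <= cabs z.
Proof.
rewrite -ler_sqr ?nnegrE ?cabs_ge0// cabs_sqr -normrX ger0_norm ?sqr_ge0//.
by rewrite lerDr sqr_ge0.
Qed.

Lemma cabs_le_sum z : cabs z <= `|z.1| + `|z.2|.
Proof.
rewrite -ler_sqr ?nnegrE ?cabs_ge0// ?addr_ge0//.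
rewrite cabs_sqr sqrrD !real_normK ?num_real//.
have := normr_ge0 z.1; have := normr_ge0 z.2; nra.
Qed.

Lemma cabsD z w : cabs (z + w) <= cabs z + cabs w.
Proof.
rewrite -ler_sqr ?nnegrE ?addr_ge0 ?cabs_ge0// sqrrD !cabs_sqr /=.
suff: z.1 * w.1 + z.2 * w.2 <= cabs z * cabs w by lra.
have [h|h] := leP (z.1 * w.1 + z.2 * w.2) 0.
  by rewrite (le_trans h)// mulr_ge0 ?cabs_ge0.
rewrite -ler_sqr ?nnegrE ?mulr_ge0 ?cabs_ge0 ?(ltW h)// exprMn !cabs_sqr.
have := sqr_ge0 (z.1 * w.2 - z.2 * w.1); nra.
Qed.

Lemma cabs_triangle u z w : cabs (z - w) <= cabs (z - u) + cabs (u - w).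
Proof. by rewrite (le_trans _ (cabsD _ _))// addrA subrK. Qed.

Lemma cabs_dist z w : `|cabs z - cabs w| <= cabs (z - w).
Proof.
rewrite ler_norml; have := cabs_triangle z w 0; have := cabs_triangle w z 0.
by rewrite !subr0 (cabsB w z); lra.
Qed.

Lemma ball_cabs z e w : cabs (z - w) < e -> ball z e w.
Proof.
move=> h; split; rewrite /ball /=; apply: le_lt_trans h.
  exact: (le_cabs_fst (z - w)).
exact: (le_cabs_snd (z - w)).
Qed.

Lemma cabs_ball z e w : ball z (e / 2) w -> cabs (z - w) < e.
Proof.
move=> [/= h1 h2]; apply: le_lt_trans (cabs_le_sum _) _.
move: h1 h2; rewrite /ball /= => h1 h2; lra.
Qed.

Lemma nbhs_cabsP z (A : set (R * R)) :
  nbhs z A <-> exists2 e, 0 < e & forall w, cabs (z - w) < e -> A w.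
Proof.
split=> [/nbhs_ballP[e /= e0 zeA]|[e e0 zeA]].
  by exists e => // w zw; apply: zeA; exact: ball_cabs.
apply/nbhs_ballP; exists (e / 2); first by rewrite /= divr_gt0.
by move=> w zw; apply: zeA; exact: cabs_ball.
Qed.

Lemma continuous_cabs : continuous (fun z => cabs z).
Proof.
move=> z; apply/cvgrPdist_lt => e e0.
apply/nbhs_cabsP; exists e => // w; exact: le_lt_trans (cabs_dist _ _).
Qed.

Lemma open_measurable2 (U : set (R * R)) : open U -> measurable U.
Proof.
move=> oU.
pose box (q : rat * rat * (rat * rat)) : set (R * R) :=
  `]ratr q.1.1, ratr q.1.2[ `*` `]ratr q.2.1, ratr q.2.2[.
pose F q := if `[< box q `<=` U >] then box q else set0.
suff -> : U = \bigcup_q F q.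
  apply: countable_bigcupT_measurable; first exact: countableP.
  move=> q; rewrite /F; case: ifP => // _; exact: measurableX.
apply/seteqP; split; last first.
  by move=> z [q _]; rewrite /F; case: ifP => // /asboolP; apply.
move=> z Uz; have : nbhs z U by exact: open_nbhs_nbhs.
move=> /nbhs_ballP[e /= e0 zeU].
have lt1 (x : R) : x - e < x by rewrite ltrBlDr ltrDl.
have lt2 (x : R) : x < x + e by rewrite ltrDl.
have [a] := rat_in_itvoo (lt1 z.1); rewrite in_itv/= => /andP[a1 a2].
have [b] := rat_in_itvoo (lt2 z.1); rewrite in_itv/= => /andP[b1 b2].
have [c] := rat_in_itvoo (lt1 z.2); rewrite in_itv/= => /andP[c1 c2].
have [d] := rat_in_itvoo (lt2 z.2); rewrite in_itv/= => /andP[d1 d2].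
exists ((a, b), (c, d)) => //; rewrite /F asboolT.
  by split; rewrite /= in_itv/= ?a2 ?b1 ?c2 ?d1.
move=> w [/=]; rewrite !in_itv/= => /andP[h1 h2] /andP[h3 h4].
by apply: zeU; split; rewrite /ball /= ltr_norml; apply/andP; split; lra.
Qed.

Lemma closed_measurable2 (U : set (R * R)) : closed U -> measurable U.
Proof.
move=> cU; rewrite -(setCK U); apply: measurableC.
by apply: open_measurable2; exact: closed_openC.
Qed.

Lemma continuous_measurable2 (f : R * R -> R) : continuous f ->
  measurable_fun [set: R * R] f.
Proof.
move=> cf; apply: (measurability _ (RGenOpens.measurableE R)).
move=> _ [_ [a [b ->] <-]]; rewrite setTI; apply: open_measurable2.
by apply: open_comp => [x _|]; [exact: cf|exact: interval_open].
Qed.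

Lemma measurable_cabs : measurable_fun [set: R * R] (fun z => cabs z).
Proof. by apply: continuous_measurable2; exact: continuous_cabs. Qed.

Lemma measurable_subC : measurable_fun [set: (R * R) * (R * R)]
  (fun p => p.1 - p.2).
Proof.
have m11 : measurable_fun [set: (R * R) * (R * R)] (fun p => p.1.1).
  exact: (measurableT_comp measurable_fst measurable_fst).
have m12 : measurable_fun [set: (R * R) * (R * R)] (fun p => p.1.2).
  exact: (measurableT_comp measurable_snd measurable_fst).
have m21 : measurable_fun [set: (R * R) * (R * R)] (fun p => p.2.1).
  exact: (measurableT_comp measurable_fst measurable_snd).
have m22 : measurable_fun [set: (R * R) * (R * R)] (fun p => p.2.2).
  exact: (measurableT_comp measurable_snd measurable_snd).
by apply/measurable_fun_pairP; split; apply: measurable_funB.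
Qed.

Lemma measurable_cabsB : measurable_fun [set: (R * R) * (R * R)]
  (fun p => cabs (p.1 - p.2)).
Proof. exact: (measurableT_comp measurable_cabs measurable_subC). Qed.

Lemma measurable_cball w r : measurable [set z : R * R | cabs (z - w) <= r].
Proof.
apply: closed_measurable2.
rewrite (_ : mkset _ = (fun z => cabs (z - w)) @^-1` [set x | x <= r])//.
apply: closed_comp; last exact: closed_le.
move=> z _; apply: (@continuous_comp _ _ _ (fun z => z - w)).
  exact: (@cvgB _ _ _ _ _ _ _ _ _ cvg_id (cvg_cst _)).
exact: continuous_cabs.
Qed.

End Modulus.

(** * Gaussian kernels and the integral of Frullani *)

Section GaussianKernel.
Context {R : realType}.
Implicit Types (z w u : R * R) (s t : R).

Local Notation leb := (@lebesgue_measure R).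
Local Notation leb2 := (sprod leb leb).

Definition gauss s z w : R := expR (- (s * cabs (z - w) ^+ 2)).

Lemma gauss_ge0 s z w : 0 <= gauss s z w. Proof. exact: expR_ge0. Qed.

Lemma gauss_le1 s z w : 0 <= s -> gauss s z w <= 1.
Proof. by move=> s0; rewrite -expR0 ler_expR oppr_le0 mulr_ge0 ?sqr_ge0. Qed.

Lemma gaussC s z w : gauss s z w = gauss s w z.
Proof. by rewrite /gauss cabsB. Qed.

Lemma measurable_gauss3 : measurable_fun [set: R * ((R * R) * (R * R))]
  (fun p => gauss p.1 p.2.1 p.2.2).
Proof.
apply: measurableT_comp => //; apply: measurableT_comp => //.
apply: measurable_funM => //; apply: measurable_funX.
exact: (measurableT_comp measurable_cabsB measurable_snd).
Qed.

Lemma measurable_gauss s : measurable_fun [set: (R * R) * (R * R)]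
  (fun p => gauss s p.1 p.2).
Proof. exact: (measurableT_comp measurable_gauss3 (measurable_pair1 s)). Qed.

Lemma measurable_gaussl s w : measurable_fun [set: R * R] (gauss s ^~ w).
Proof. exact: (measurableT_comp (measurable_gauss s) (measurable_pair2 w)). Qed.

Lemma measurable_gaussr s z : measurable_fun [set: R * R] (gauss s z).
Proof. exact: (measurableT_comp (measurable_gauss s) (measurable_pair1 z)). Qed.

Lemma integral_gauss1 t (a : R) : 0 < t ->
  (\int[leb]_x (expR (- (t * (a - x) ^+ 2)))%:E = (Num.sqrt (pi / t))%:E)%E.
Proof.
move=> t0; pose sg := Num.sqrt (2 * t)^-1.
have t20 : 0 < (2 * t)^-1 by rewrite invr_gt0 mulr_gt0.
have sg0 : sg != 0 by rewrite gt_eqF// sqrtr_gt0.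
have sgE : sg ^+ 2 = (2 * t)^-1 by rewrite sqr_sqrtr// ltW.
have pE : sg ^+ 2 * pi *+ 2 = pi / t.
  by rewrite sgE -mulr_natr invfM; field; rewrite gt_eqF.
have c0 : 0 < Num.sqrt (pi / t) by rewrite sqrtr_gt0 divr_gt0 ?pi_gt0.
rewrite -[RHS]mule1 -(integral_normal_pdf a sg) -ge0_integralZl//; last 2 first.
- by apply: measurable_EFin_comp; exact: measurable_normal_pdf.
- by move=> x _; rewrite lee_fin normal_pdf_ge0.
apply: eq_integral => x _; rewrite -EFinM; congr (_%:E).
rewrite (normal_pdfE a sg0)/= /normal_peak pE [RHS]mulrA divff ?gt_eqF// mul1r.
by congr expR; rewrite sgE -mulr_natr; field; rewrite gt_eqF.
Qed.

Lemma integral_gauss t z : 0 < t ->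
  (\int[leb2]_u (gauss t z u)%:E = (pi / t)%:E)%E.
Proof.
move=> t0; rewrite /sprod fubini_tonelli1/=; last 2 first.
- by apply: measurable_EFin_comp; exact: measurable_gaussr.
- by move=> u; rewrite lee_fin gauss_ge0.
have p0 : 0 <= pi / t by rewrite divr_ge0 ?pi_ge0 ?ltW.
transitivity (\int[leb]_x ((expR (- (t * (z.1 - x) ^+ 2)))%:E *
    (Num.sqrt (pi / t))%:E))%E.
  apply: eq_integral => x _; rewrite /fubini_F/=.
  rewrite -(integral_gauss1 z.2 t0) -ge0_integralZl//; last first.
  - apply: measurable_EFin_comp; apply: measurableT_comp => //.
    apply: measurableT_comp => //; apply: measurable_funM => //.
    by apply: measurable_funX; exact: measurable_funB.
  apply: eq_integral => y _; rewrite -EFinM -expRD /gauss cabs_sqr/=.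
  by congr ((expR _)%:E); ring.
rewrite ge0_integralZr//; last first.
  apply: measurable_EFin_comp; apply: measurableT_comp => //.
  apply: measurableT_comp => //; apply: measurable_funM => //.
  by apply: measurable_funX; exact: measurable_funB.
by rewrite integral_gauss1// -EFinM -expr2 sqr_sqrtr.
Qed.

(** Completing the square in [u] around the midpoint of [z] and [w]; the Gaussian
    kernel is thus a Gram kernel. *)
Lemma integral_gaussM s z w : 0 < s ->
  (\int[leb2]_u (gauss (2 * s) z u * gauss (2 * s) w u)%:E =
   (pi / (4 * s) * gauss s z w)%:E)%E.
Proof.
move=> s0; pose m : R * R := ((z.1 + w.1) / 2, (z.2 + w.2) / 2).
have s40 : 0 < 4 * s by rewrite mulr_gt0.
transitivity (\int[leb2]_u ((gauss s z w)%:E * (gauss (4 * s) m u)%:E))%E.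
  apply: eq_integral => u _; rewrite -EFinM /gauss -!expRD; congr ((expR _)%:E).
  by rewrite !cabs_sqr/=; field.
rewrite ge0_integralZl//; last 3 first.
- by apply: measurable_EFin_comp; exact: measurable_gaussr.
- by move=> u _; rewrite lee_fin gauss_ge0.
- by rewrite lee_fin gauss_ge0.
by rewrite integral_gauss// -EFinM mulrC.
Qed.

End GaussianKernel.

Lemma integral_swap_in d1 d2 (T1 : measurableType d1) (T2 : measurableType d2)
    (R : realType) (m1 : {sigma_finite_measure set T1 -> \bar R})
    (m2 : {sigma_finite_measure set T2 -> \bar R}) (D1 : set T1) (D2 : set T2)
    (f : T1 -> T2 -> \bar R) :
  measurable D1 -> measurable D2 -> (forall x y, (0 <= f x y)%E) ->
  measurable_fun [set: T1 * T2] (fun p => f p.1 p.2) ->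
  (\int[m1]_(x in D1) \int[m2]_(y in D2) f x y =
   \int[m2]_(y in D2) \int[m1]_(x in D1) f x y)%E.
Proof.
move=> mD1 mD2 f0 mf.
have mf1 x : measurable_fun setT (f x).
  exact: (measurableT_comp mf (measurable_pair1 x)).
have mf2 y : measurable_fun setT (f ^~ y).
  exact: (measurableT_comp mf (measurable_pair2 y)).
pose g x y := (f x y * (\1_D1 x * \1_D2 y)%:E)%E.
have ind0 T (D : set T) (x : T) : (0 <= (\1_D x : R)) by [].
transitivity (\int[m1]_x \int[m2]_y g x y)%E; last first.
  rewrite integral_swap; last 2 first.
  - by move=> x y; rewrite mule_ge0// lee_fin mulr_ge0.
  - apply: emeasurable_funM => //; apply: measurable_EFin_comp.
    apply: measurable_funM.
      exact: (measurableT_comp (measurable_indic _) measurable_fst).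
    exact: (measurableT_comp (measurable_indic _) measurable_snd).
  rewrite [RHS]integral_mkcond; apply: eq_integral => y _.
  rewrite patchE /g indicE; case: ifPn => yD2; last first.
    by apply: integral0_eq => x _; rewrite mulr0 mule0.
  rewrite [RHS]integral_mkcond; apply: eq_integral => x _.
  by rewrite patchE indicE mulr1; case: ifPn; rewrite ?mule1// mule0.
rewrite [LHS]integral_mkcond; apply: eq_integral => x _.
rewrite patchE /g indicE; case: ifPn => xD2; last first.
  by rewrite integral0_eq// => y _; rewrite mul0r mule0.
rewrite [LHS]integral_mkcond; apply: eq_integral => y _.
by rewrite patchE indicE mul1r; case: ifPn; rewrite ?mule1// mule0.
Qed.

Section Frullani.
Context {R : realType}.
Local Notation leb := (@lebesgue_measure R).

Lemma integral_expR_itv (s a b : R) : 0 < s -> a <= b ->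
  (\int[leb]_(x in `[a, b]) (expR (- (s * x)))%:E =
   ((expR (- (s * a)) - expR (- (s * b))) / s)%:E)%E.
Proof.
move=> s0; rewrite le_eqVlt => /predU1P[->|ab].
  by rewrite subrr mul0r set_itv1 integral_set1.
have dF (x : R) : is_derive x 1 (fun y : R => - (expR (- (s * y)) / s)) (expR (- (s * x))).
  apply: is_derive_eq; rewrite /GRing.scale/=; field; rewrite gt_eqF//.
rewrite (@continuous_FTC2 _ _ (fun y => - (expR (- (s * y)) / s)))//.
- by rewrite -EFinB; congr (_%:E); rewrite opprK mulrBl addrC.
- apply: continuous_subspaceT => x.
  apply: continuous_comp; last exact: continuous_expR.
  apply: (@continuousN _ _ _ (fun x => s * x)).
  exact: (@continuousM _ _ (fun=> s) id x (cvg_cst _) cvg_id).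
- split.
  + by move=> x _; have [] := dF x.
  + apply: cvg_at_right_filter; have [+ _] := dF a.
    by move/derivable1_diffP/differentiable_continuous; exact.
  + apply: cvg_at_left_filter; have [+ _] := dF b.
    by move/derivable1_diffP/differentiable_continuous; exact.
- by move=> x _; rewrite derive1E; have [_ ->] := dF x.
Qed.

Lemma integral_invr_itv (a b : R) : 0 < a -> a <= b ->
  (\int[leb]_(x in `[a, b]) (x^-1)%:E = (ln (b / a))%:E)%E.
Proof.
move=> a0; rewrite le_eqVlt => /predU1P[<-|ab].
  by rewrite divff ?gt_eqF// ln1 set_itv1 integral_set1.
have dF (x : R) : a <= x -> is_derive x 1 (@ln R) x^-1.
  by move=> ax; apply: is_derive1_ln; exact: lt_le_trans ax.
rewrite (@continuous_FTC2 _ _ (@ln R))//.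
- by rewrite -EFinB lnM ?posrE ?invr_gt0// ?lnV ?posrE// (lt_trans a0).
- apply: continuous_in_subspaceT => x; rewrite inE/= in_itv/= => /andP[ax _].
  by apply: inv_continuous; rewrite gt_eqF// (lt_le_trans a0).
- split.
  + by move=> x; rewrite in_itv/= => /andP[/ltW ax _]; have [] := dF _ ax.
  + apply: cvg_at_right_filter; exact: continuous_ln.
  + by apply: cvg_at_left_filter; apply: continuous_ln; exact: lt_trans ab.
- by move=> x; rewrite in_itv/= => /andP[/ltW ax _]; rewrite derive1E; have [_ ->] := dF _ ax.
Qed.

Lemma integral_expR_y (x : R) : 0 < x ->
  (\int[leb]_(s in `]0%R, +oo[) (expR (- (s * x)))%:E = (x^-1)%:E)%E.
Proof.
move=> x0.
have mE : measurable_fun [set: R] (fun s => (expR (- (s * x)))%:E).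
  apply: measurable_EFin_comp; apply: measurableT_comp => //.
  by apply: measurableT_comp => //; exact: measurable_funM.
rewrite integral_itv_obnd_cbnd; last exact: measurable_funTS.
have -> : (x^-1)%:E = ((x^-1)%:E * \int[leb]_s (exponential_pdf x s)%:E)%E.
  by rewrite integral_exponential_pdf// mule1.
rewrite -ge0_integralZl//; last 3 first.
- by apply: measurable_EFin_comp; exact: measurable_exponential_pdf.
- by move=> s _; rewrite lee_fin exponential_pdf_ge0// ltW.
- by rewrite lee_fin invr_ge0 ltW.
rewrite [LHS]integral_mkcond; apply: eq_integral => s _.
rewrite /exponential_pdf !patchE; case: ifPn => _; last by rewrite mule0.
by rewrite -EFinM mulrA mulVf ?gt_eqF// mul1r mulNr (mulrC x).
Qed.

(** Both sides are the integral of [exp (- (s * x))] over the [s > 0] and the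
    [x] between [a] and [b]. The logarithm is thus a positive superposition of
    exponentials. *)
Lemma integral_frullani (a b : R) : 0 < a -> a <= b ->
  (\int[leb]_(s in `]0%R, +oo[)
     ((expR (- (s * a)) - expR (- (s * b))) / s)%:E = (ln (b / a))%:E)%E.
Proof.
move=> a0 ab.
transitivity (\int[leb]_(s in `]0%R, +oo[)
    \int[leb]_(x in `[a, b]) (expR (- (s * x)))%:E)%E.
  by apply: eq_integral => s; rewrite inE/= in_itv/= andbT => s0;
    rewrite integral_expR_itv.
rewrite (@integral_swap_in _ _ _ _ _ leb leb _ _ (fun s x : R => (expR (- (s * x)))%:E))//.
- rewrite -integral_invr_itv//; apply: eq_integral => x.
  rewrite inE/= in_itv/= => /andP[ax _].
  by rewrite integral_expR_y// (lt_le_trans a0).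
- apply: measurable_EFin_comp; apply: measurableT_comp => //.
  by apply: measurableT_comp => //; exact: measurable_funM.
Qed.

End Frullani.

(** * The logarithmic kernel as a superposition of Gaussian kernels *)

Lemma measurable_inv (R : realType) : measurable_fun [set: R] (@GRing.inv R).
Proof.
have o0 : open [set x : R | x != 0].
  rewrite (_ : mkset _ = ~` [set 0]); first exact/closed_openC/closed_eq.
  by apply/seteqP; split => x /= /eqP.
rewrite (_ : setT = [set x : R | x != 0] `|` [set 0]); last first.
  by apply/seteqP; split => // x _; have [->|] := eqVneq x 0; [right|left].
apply/measurable_funU => //; first exact: open_measurable.
split; last exact: measurable_fun_set1.
apply: open_continuous_measurable_fun => // x; rewrite inE/= => x0.
exact: inv_continuous.
Qed.

Lemma measurable_funV d (T : measurableType d) (R : realType) (f : T -> R) :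
  measurable_fun [set: T] f -> measurable_fun [set: T] (fun x => (f x)^-1).
Proof. by move=> mf; apply: measurableT_comp => //; exact: measurable_inv. Qed.

Lemma ge0_integral_full d (T : measurableType d) (R : realType)
    (P : {finite_measure set T -> \bar R}) (A : set T) (f : T -> \bar R) :
  measurable A -> P (~` A) = 0%E -> (forall x, (0 <= f x)%E) ->
  measurable_fun [set: T] f -> (\int[P]_x f x = \int[P]_(x in A) f x)%E.
Proof.
move=> mA PA f0 mf; rewrite (@ge0_negligible_integral _ _ _ P setT (~` A) f)//.
  by rewrite setTD setCK.
exact: measurableC.
Qed.

Lemma prob_setC0 d (T : measurableType d) (R : realType) (P : probability T R)
    (A : set T) : measurable A -> P A = 1%E -> P (~` A) = 0%E.
Proof. by move=> mA PA; rewrite probability_setC// PA subee. Qed.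

Lemma prob_setD1 d (T : measurableType d) (R : realType) (P : probability T R)
    (A : set T) (x : T) : measurable A -> measurable [set x] -> P A = 1%E ->
  P [set x] = 0%E -> P (A `\ x) = 1%E.
Proof.
move=> mA mx PA Px; rewrite measureD//; last first.
  exact: le_lt_trans (probability_le1 P mA) (ltry 1).
rewrite [X in (_ - X)%E](_ : _ = 0%E) ?sube0//.
apply/eqP; rewrite eq_le measure_ge0 andbT -Px le_measure ?inE//.
exact: measurableI.
Qed.

Lemma ge0_integral_eq_on d (T : measurableType d) (R : realType)
    (P : probability T R) (A : set T) (f g : T -> \bar R) :
  measurable A -> P A = 1%E ->
  (forall x, (0 <= f x)%E) -> measurable_fun [set: T] f ->
  (forall x, (0 <= g x)%E) -> measurable_fun [set: T] g ->
  (forall x, A x -> f x = g x) -> (\int[P]_x f x = \int[P]_x g x)%E.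
Proof.
move=> mA PA f0 mf g0 mg fg.
rewrite (ge0_integral_full mA (prob_setC0 mA PA) f0 mf).
rewrite (ge0_integral_full mA (prob_setC0 mA PA) g0 mg).
by apply: eq_integral => x; rewrite inE; exact: fg.
Qed.

Lemma measurable_point (R : realType) (z : R * R) : measurable [set z].
Proof.
rewrite (_ : [set z] = [set z.1] `*` [set z.2]); first exact: measurableX.
by apply/seteqP; split => -[a b] /=; [move=> <-|case=> -> ->; case: z].
Qed.

Section LogKernel.
Context {R : realType} (R0 : R).
Implicit Types (z w u : R * R) (s : R) (mu nu : probability (R * R)%type R).

(** The logarithmic kernel, made nonnegative by adding the logarithm of a bound
    on the diameter of the domain. Since [ln 0^-1 = 0], its value on the diagonal
    is [ln R0] for [1 <= R0]. *)
Definition logker z w : R := Num.max 0 (ln R0 + ln (cabs (z - w))^-1).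

Lemma logker_ge0 z w : 0 <= logker z w.
Proof. by rewrite /logker le_max lexx. Qed.

Lemma logkerC z w : logker z w = logker w z.
Proof. by rewrite /logker cabsB. Qed.

Lemma logkerE z w : 0 < R0 -> 0 < cabs (z - w) <= R0 ->
  logker z w = ln (R0 / cabs (z - w)).
Proof.
move=> R00 /andP[r0 rR]; rewrite /logker -lnM ?posrE ?invr_gt0//.
by rewrite max_r// ln_ge0// ler_pdivlMr// mul1r.
Qed.

Lemma measurable_logker : measurable_fun [set: (R * R) * (R * R)]
  (fun p => logker p.1 p.2).
Proof.
apply: measurable_maxr => //; apply: measurable_funD => //.
apply: measurableT_comp => //; apply: measurable_funV => //.
exact: measurable_cabsB.
Qed.

Definition mutual mu nu : \bar R :=
  (\int[mu]_z \int[nu]_w (logker z w)%:E)%E.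

Lemma measurable_mutual_inner nu :
  measurable_fun [set: R * R] (fun z => \int[nu]_w (logker z w)%:E)%E.
Proof.
apply: (@measurable_fun_fubini_tonelli_F _ _ _ _ _ nu
  (fun p => (logker p.1 p.2)%:E)) => [|p]; last by rewrite lee_fin logker_ge0.
by apply: measurable_EFin_comp; exact: measurable_logker.
Qed.

Lemma mutualC mu nu : mutual mu nu = mutual nu mu.
Proof.
rewrite /mutual integral_swap.
- by apply: eq_integral => z _; apply: eq_integral => w _; rewrite logkerC.
- by move=> z w; rewrite lee_fin logker_ge0.
- by apply: measurable_EFin_comp; exact: measurable_logker.
Qed.

Lemma mutual_ge0 mu nu : (0 <= mutual mu nu)%E.
Proof.
apply: integral_ge0 => z _; apply: integral_ge0 => w _.
by rewrite lee_fin logker_ge0.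
Qed.

(** The integrand in the formula of Frullani for the logarithm of
    [(R0 / cabs (z - w)) ^+ 2], set to 0 for [s <= 0] and truncated so as to be
    nonnegative for all points of the plane. *)
Definition gaussgap s z w : R :=
  \1_`]0, +oo[ s * (Num.max 0 (gauss s z w - expR (- (s * R0 ^+ 2))) / s).

Lemma measurable_gaussgap3 : measurable_fun [set: R * ((R * R) * (R * R))]
  (fun p => gaussgap p.1 p.2.1 p.2.2).
Proof.
apply: measurable_funM.
  exact: (measurableT_comp (measurable_indic _) measurable_fst).
apply: measurable_funM; last exact: measurable_funV.
apply: measurable_maxr => //; apply: measurable_funB.
  exact: measurable_gauss3.
apply: measurableT_comp => //; apply: measurableT_comp => //.
exact: measurable_funM.
Qed.

Lemma gaussgap_ge0 s z w : 0 <= gaussgap s z w.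
Proof.
rewrite /gaussgap indicE; case: (boolP (s \in _)); last by rewrite mul0r.
rewrite inE/= in_itv/= andbT => s0; rewrite mul1r divr_ge0 ?(ltW s0)//.
by rewrite le_max lexx.
Qed.

Lemma gaussgapE s z w : 0 < R0 -> 0 < s -> cabs (z - w) <= R0 ->
  gaussgap s z w = (gauss s z w - expR (- (s * R0 ^+ 2))) / s.
Proof.
move=> R00 s0 rR; rewrite /gaussgap indicE mem_set ?mul1r; last first.
  by rewrite /= in_itv/= s0.
rewrite max_r// subr_ge0 ler_expR lerN2.
by rewrite ler_wpM2l ?(ltW s0)// ler_sqr// nnegrE ?cabs_ge0// ltW.
Qed.

Lemma logker_gaussgap z w : 0 < R0 -> 0 < cabs (z - w) <= R0 ->
  ((logker z w)%:E = (2^-1)%:E *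
    \int[lebesgue_measure]_s (gaussgap s z w)%:E)%E.
Proof.
move=> R00 /andP[r0 rR]; rewrite logkerE// ?r0//.
transitivity ((2^-1)%:E * \int[lebesgue_measure]_(s in `]0%R, +oo[)
    ((expR (- (s * cabs (z - w) ^+ 2)) - expR (- (s * R0 ^+ 2))) / s)%:E)%E;
    last first.
  congr (_ * _)%E; rewrite integral_mkcond; apply: eq_integral => s _.
  rewrite patchE; case: ifPn.
    by rewrite inE/= in_itv/= andbT => s0; rewrite gaussgapE.
  by rewrite /gaussgap indicE => /negbTE ->; rewrite mul0r.
rewrite integral_frullani ?exprn_gt0//; last first.
  by rewrite ler_sqr// nnegrE ltW.
rewrite -expr_div_n lnXn ?divr_gt0// -EFinM -[X in _ = (_ * X)%:E]mulr_natl.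
by rewrite mulKf.
Qed.

Section Measures.
Variables (D : set (R * R)) (mu nu : probability (R * R)%type R).
Hypotheses (mD : measurable D) (R00 : 0 < R0).
Hypothesis DR0 : forall z w, D z -> D w -> cabs (z - w) <= R0.
Hypotheses (muD : mu D = 1%E) (nuD : nu D = 1%E).

Definition gapmean s : \bar R :=
  (\int[mu]_z \int[nu]_w (gaussgap s z w)%:E)%E.

Definition gaussmean s : \bar R :=
  (\int[mu]_z \int[nu]_w (gauss s z w)%:E)%E.

Let m3 : measurable_fun [set: R * ((R * R) * (R * R))]
  (fun p => (gaussgap p.1 p.2.1 p.2.2)%:E).
Proof. by apply: measurable_EFin_comp; exact: measurable_gaussgap3. Qed.

Let msz s z : measurable_fun [set: R * R] (fun w => (gaussgap s z w)%:E).
Proof.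
have mt : measurable_fun [set: R * R] (fun w => (s, (z, w))).
  by apply: measurable_fun_pair => //; exact: measurable_fun_pair.
exact: (measurableT_comp m3 mt).
Qed.

Let minner : measurable_fun [set: R * (R * R)]
  (fun p => \int[nu]_w (gaussgap p.1 p.2 w)%:E)%E.
Proof.
apply: (@measurable_fun_fubini_tonelli_F _ _ _ _ _ nu
  (fun q : (R * (R * R)) * (R * R) => (gaussgap q.1.1 q.1.2 q.2)%:E)).
  have mt : measurable_fun [set: (R * (R * R)) * (R * R)]
      (fun q => (q.1.1, (q.1.2, q.2))).
    apply: measurable_fun_pair.
      exact: (measurableT_comp measurable_fst measurable_fst).
    apply: measurable_fun_pair => //.
    exact: (measurableT_comp measurable_snd measurable_fst).
  exact: (measurableT_comp m3 mt).
by move=> q; rewrite lee_fin gaussgap_ge0.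
Qed.

Let inner_ge0 s z : (0 <= \int[nu]_w (gaussgap s z w)%:E)%E.
Proof. by apply: integral_ge0 => w _; rewrite lee_fin gaussgap_ge0. Qed.

Lemma measurable_gapmean : measurable_fun [set: R] gapmean.
Proof.
apply: (@measurable_fun_fubini_tonelli_F _ _ _ _ _ mu
  (fun q : R * (R * R) => (\int[nu]_w (gaussgap q.1 q.2 w)%:E)%E)) => //.
Qed.

Lemma gapmean_ge0 s : (0 <= gapmean s)%E.
Proof. by apply: integral_ge0. Qed.

Lemma mutual_gapmean : (forall z, nu [set z] = 0%E) ->
  (mutual mu nu = (2^-1)%:E * \int[lebesgue_measure]_s gapmean s)%E.
Proof.
move=> nu0.
have h20 : 0 <= 2^-1 :> R by rewrite invr_ge0.
rewrite /gapmean (@integral_swap _ _ _ _ _ lebesgue_measure mu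
  (fun s z => \int[nu]_w (gaussgap s z w)%:E)%E)//.
have msw z : measurable_fun [set: R * (R * R)]
    (fun p => (gaussgap p.1 z p.2)%:E).
  have mt : measurable_fun [set: R * (R * R)] (fun p => (p.1, (z, p.2))).
    by apply: measurable_fun_pair => //; exact: measurable_fun_pair.
  exact: (measurableT_comp m3 mt).
have mgz : measurable_fun [set: R * R] (fun z =>
    \int[lebesgue_measure]_s \int[nu]_w (gaussgap s z w)%:E)%E.
  by apply: (@measurable_fun_fubini_tonelli_G _ _ _ _ _ lebesgue_measure
    (fun p => (\int[nu]_w (gaussgap p.1 p.2 w)%:E)%E)).
have g0 z : (0 <= \int[lebesgue_measure]_s \int[nu]_w (gaussgap s z w)%:E)%E.
  by apply: integral_ge0.
rewrite -ge0_integralZl//.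
apply: (ge0_integral_eq_on mD muD) => //.
- move=> z; apply: integral_ge0 => w _; by rewrite lee_fin logker_ge0.
- exact: measurable_mutual_inner.
- by move=> z; rewrite mule_ge0.
- exact: emeasurable_funM.
move=> z Dz.
rewrite (@integral_swap _ _ _ _ _ lebesgue_measure nu
  (fun s w => (gaussgap s z w)%:E)); last 2 first.
- by move=> s w; rewrite lee_fin gaussgap_ge0.
- exact: msw.
have mw : measurable_fun [set: R * R] (fun w =>
    \int[lebesgue_measure]_s (gaussgap s z w)%:E)%E.
  apply: (@measurable_fun_fubini_tonelli_G _ _ _ _ _ lebesgue_measure
    (fun p => (gaussgap p.1 z p.2)%:E)); first exact: msw.
  by move=> p; rewrite lee_fin gaussgap_ge0.
have w0 w : (0 <= \int[lebesgue_measure]_s (gaussgap s z w)%:E)%E.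
  by apply: integral_ge0 => s _; rewrite lee_fin gaussgap_ge0.
rewrite -ge0_integralZl//.
have mDz : measurable (D `\ z) by apply: measurableD => //; exact: measurable_point.
apply: (@ge0_integral_eq_on _ _ _ nu (D `\ z)) => //.
- by apply: prob_setD1 => //; exact: measurable_point.
- by move=> w; rewrite lee_fin logker_ge0.
- apply: measurable_EFin_comp.
  exact: (measurableT_comp measurable_logker (measurable_pair1 z)).
- by move=> w; rewrite mule_ge0.
- exact: emeasurable_funM.
move=> w [Dw /= wz]; apply: logker_gaussgap => //.
rewrite lt_def cabs_ge0 cabs_eq0 subr_eq0 DR0// andbT andbT.
by apply/eqP => zw; exact: wz.
Qed.

(** The correction that makes the integral of Frullani converge is the same for
    all pairs of probability measures on the domain, so that it cancels in the
    polarization identity. *)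
Lemma gapmeanE s : 0 < s ->
  (gapmean s + (expR (- (s * R0 ^+ 2)) / s)%:E = (s^-1)%:E * gaussmean s)%E.
Proof.
move=> s0; set c := (_ / s)%:E.
have c0 : (0 <= c)%E by rewrite lee_fin divr_ge0 ?expR_ge0 ?ltW.
have s10 : 0 <= s^-1 by rewrite invr_ge0 ltW.
have mgw z : measurable_fun [set: R * R] (fun w => (gauss s z w)%:E).
  by apply: measurable_EFin_comp; exact: measurable_gaussr.
have mgz : measurable_fun [set: R * R] (fun z => \int[nu]_w (gauss s z w)%:E)%E.
  apply: (@measurable_fun_fubini_tonelli_F _ _ _ _ _ nu
    (fun q : (R * R) * (R * R) => (gauss s q.1 q.2)%:E)).
    by apply: measurable_EFin_comp; exact: measurable_gauss.
  by move=> q; rewrite lee_fin gauss_ge0.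
have gz0 z : (0 <= \int[nu]_w (gauss s z w)%:E)%E.
  by apply: integral_ge0 => w _; rewrite lee_fin gauss_ge0.
have mgap : measurable_fun [set: R * R]
    (fun z => \int[nu]_w (gaussgap s z w)%:E)%E.
  exact: (measurableT_comp minner (measurable_pair1 s)).
rewrite /gaussmean -ge0_integralZl//.
rewrite -[X in (_ + X)%E](integral_cst1 c (probability_setT mu)).
rewrite -ge0_integralD//.
apply: (ge0_integral_eq_on mD muD) => //.
- by move=> z; rewrite adde_ge0.
- exact: emeasurable_funD.
- by move=> z; rewrite mule_ge0.
- exact: emeasurable_funM.
move=> z Dz; rewrite -ge0_integralZl//; last first.
  by move=> w _; rewrite lee_fin gauss_ge0.
rewrite -[X in (_ + X)%E](integral_cst1 c (probability_setT nu)).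
rewrite -ge0_integralD//; last by move=> w _; rewrite lee_fin gaussgap_ge0.
apply: (ge0_integral_eq_on mD nuD) => //.
- by move=> w; rewrite adde_ge0// lee_fin gaussgap_ge0.
- exact: emeasurable_funD.
- by move=> w; rewrite mule_ge0// lee_fin gauss_ge0.
- exact: emeasurable_funM.
move=> w Dw; rewrite gaussgapE ?DR0// /c -EFinD -EFinM; congr (_%:E).
by rewrite -mulrDl subrK mulrC.
Qed.

Lemma gaussmean_ge0 s : (0 <= gaussmean s)%E.
Proof.
by apply: integral_ge0 => z _; apply: integral_ge0 => w _; rewrite lee_fin gauss_ge0.
Qed.

End Measures.

(** The Gaussian smoothing of [mu], which is the image of [mu] under the feature
    map of the Gaussian kernel. *)
Definition gausshat mu s u : \bar R := (\int[mu]_z (gauss (2 * s) z u)%:E)%E.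

Lemma gausshat_ge0 mu s u : (0 <= gausshat mu s u)%E.
Proof. by apply: integral_ge0 => z _; rewrite lee_fin gauss_ge0. Qed.

Lemma gausshat_le1 mu s u : 0 <= s -> (gausshat mu s u <= 1)%E.
Proof.
move=> s0; rewrite -[leRHS](integral_cst1 _ (probability_setT mu)).
apply: ge0_le_integral => //.
- by move=> z _; rewrite lee_fin gauss_ge0.
- by apply: measurable_EFin_comp; exact: measurable_gaussl.
- by move=> z _; rewrite lee_fin gauss_le1// mulr_ge0.
Qed.

Lemma measurable_gausshat mu s : measurable_fun [set: R * R] (gausshat mu s).
Proof.
apply: (@measurable_fun_fubini_tonelli_F _ _ _ _ _ mu
  (fun q : (R * R) * (R * R) => (gauss (2 * s) q.2 q.1)%:E)).
  under eq_fun do rewrite gaussC.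
  by apply: measurable_EFin_comp; exact: measurable_gauss.
by move=> q; rewrite lee_fin gauss_ge0.
Qed.

Lemma gaussmean_hat mu nu s : 0 < s ->
  (\int[sprod lebesgue_measure lebesgue_measure]_u
     (gausshat mu s u * gausshat nu s u) =
   (pi / (4 * s))%:E * gaussmean mu nu s)%E.
Proof.
move=> s0.
have p0 : 0 <= pi / (4 * s) by rewrite divr_ge0 ?pi_ge0// mulr_ge0// ltW.
have mg z : measurable_fun [set: R * R] (fun w => (gauss (2 * s) z w)%:E).
  by apply: measurable_EFin_comp; exact: measurable_gaussr.
have mg' z : measurable_fun [set: R * R] (fun w => (gauss (2 * s) w z)%:E).
  by apply: measurable_EFin_comp; exact: measurable_gaussl.
have m2 : measurable_fun [set: (R * R) * (R * R)]
    (fun p => (gauss (2 * s) p.1 p.2)%:E).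
  by apply: measurable_EFin_comp; exact: measurable_gauss.
have m2' : measurable_fun [set: (R * R) * (R * R)]
    (fun p => (gauss (2 * s) p.2 p.1)%:E).
  by under eq_fun do rewrite gaussC.
have mgz : measurable_fun [set: R * R] (fun z => \int[nu]_w (gauss s z w)%:E)%E.
  apply: (@measurable_fun_fubini_tonelli_F _ _ _ _ _ nu
    (fun q : (R * R) * (R * R) => (gauss s q.1 q.2)%:E)).
    by apply: measurable_EFin_comp; exact: measurable_gauss.
  by move=> q; rewrite lee_fin gauss_ge0.
have gz0 z : (0 <= \int[nu]_w (gauss s z w)%:E)%E.
  by apply: integral_ge0 => w _; rewrite lee_fin gauss_ge0.
transitivity (\int[sprod lebesgue_measure lebesgue_measure]_u
    \int[mu]_z ((gauss (2 * s) z u)%:E * gausshat nu s u))%E.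
  apply: eq_integral => u _; rewrite ge0_integralZr//; last exact: gausshat_ge0.
  by move=> z _; rewrite lee_fin gauss_ge0.
rewrite integral_swap; last 2 first.
- by move=> u z; rewrite mule_ge0// ?lee_fin ?gauss_ge0// gausshat_ge0.
- apply: emeasurable_funM => //.
  exact: (measurableT_comp (measurable_gausshat nu s) measurable_fst).
rewrite /gaussmean -ge0_integralZl//; apply: eq_integral => z _.
transitivity (\int[sprod lebesgue_measure lebesgue_measure]_u
    \int[nu]_w ((gauss (2 * s) z u)%:E * (gauss (2 * s) w u)%:E))%E.
  apply: eq_integral => u _; rewrite ge0_integralZl//.
    by move=> w _; rewrite lee_fin gauss_ge0.
  by rewrite lee_fin gauss_ge0.
rewrite integral_swap; last 2 first.
- by move=> u w; rewrite -EFinM lee_fin mulr_ge0// gauss_ge0.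
- apply: emeasurable_funM => //.
  exact: (measurableT_comp (mg z) measurable_fst).
rewrite -ge0_integralZl//; last 2 first.
- by apply: measurable_EFin_comp; exact: measurable_gaussr.
- by move=> w _; rewrite lee_fin gauss_ge0.
apply: eq_integral => w _; rewrite -EFinM -integral_gaussM//.
Qed.

End LogKernel.

(** * Coercivity of the logarithmic energy *)

Lemma ecancel (R : realType) (a b x y : \bar R) (c : R) :
  (0 <= a)%E -> (0 <= b)%E -> (0 <= x)%E -> (0 <= y)%E ->
  (a + c%:E + (b + c%:E) = 2%:E * (x + c%:E) + y)%E ->
  (a + b = 2%:E * x + y)%E.
Proof.
case: a => [a| |]//; case: b => [b| |]//; case: x => [x| |]//;
  case: y => [y| |]// _ _ _ _; rewrite /= ?gt0_muley// => -[]// h.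
by congr (_%:E); rewrite -[LHS]/(a + b) -[RHS]/(2 * x + y); lra.
Qed.

Section Coercivity.
Context {R : realType}.
Implicit Types (z w u : R * R) (s : R) (mu nu : probability (R * R)%type R).
Local Notation leb := (@lebesgue_measure R).
Local Notation leb2 := (sprod leb leb).

Definition hatdist mu nu s : \bar R :=
  (\int[leb2]_u ((fine (gausshat mu s u) - fine (gausshat nu s u)) ^+ 2)%:E)%E.

Lemma gausshat_fin mu s u : 0 <= s -> gausshat mu s u \is a fin_num.
Proof.
move=> s0; rewrite ge0_fin_numE ?gausshat_ge0//.
exact: le_lt_trans (gausshat_le1 _ _ s0) (ltry _).
Qed.

Lemma measurable_fine_gausshat mu s :
  measurable_fun [set: R * R] (fun u => fine (gausshat mu s u)).
Proof. by apply: measurableT_comp => //; exact: measurable_gausshat. Qed.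

Lemma measurable_hatdist_fun mu nu s : measurable_fun [set: R * R]
  (fun u => (fine (gausshat mu s u) - fine (gausshat nu s u)) ^+ 2).
Proof.
by apply: measurable_funX; apply: measurable_funB;
  exact: measurable_fine_gausshat.
Qed.

Lemma hatdist_ge0 mu nu s : (0 <= hatdist mu nu s)%E.
Proof. by apply: integral_ge0 => u _; rewrite lee_fin sqr_ge0. Qed.

(** The identity [|a|^2 + |b|^2 = 2 (a, b) + |a - b|^2] for the features of the
    two measures. *)
Lemma gaussmean_polarization mu nu s : 0 < s ->
  ((pi / (4 * s))%:E * gaussmean mu mu s +
   (pi / (4 * s))%:E * gaussmean nu nu s =
   2%:E * ((pi / (4 * s))%:E * gaussmean mu nu s) + hatdist mu nu s)%E.
Proof.
move=> s0; rewrite -!gaussmean_hat//.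
have hm (m : probability (R * R)%type R) := measurable_gausshat m s.
have h0 (m : probability (R * R)%type R) u := gausshat_ge0 m s u.
have mM (m n : probability (R * R)%type R) : measurable_fun [set: R * R]
    (fun u => gausshat m s u * gausshat n s u)%E.
  exact: emeasurable_funM.
rewrite -ge0_integralD//; try by [exact: mM|move=> u _; rewrite mule_ge0].
rewrite -ge0_integralZl//; try by [exact: mM|move=> u _; rewrite mule_ge0].
rewrite -ge0_integralD//; first last.
- by apply: measurable_EFin_comp; exact: measurable_hatdist_fun.
- by move=> u _; rewrite lee_fin sqr_ge0.
- by apply: emeasurable_funM => //; exact: mM.
- by move=> u _; rewrite !mule_ge0.
apply: eq_integral => u _.
rewrite -(fineK (gausshat_fin mu u (ltW s0))) -(fineK (gausshat_fin nu u (ltW s0))).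
by rewrite -!EFinM -!EFinD/=; congr (_%:E); ring.
Qed.

Variables (R0 : R) (D : set (R * R)).
Hypotheses (mD : measurable D) (R00 : 0 < R0).
Hypothesis DR0 : forall z w, D z -> D w -> cabs (z - w) <= R0.

Lemma gapmean_le0 mu nu s : s <= 0 -> gapmean R0 mu nu s = 0%E.
Proof.
move=> s0; apply: integral0_eq => z _; apply: integral0_eq => w _.
by rewrite /gaussgap indicE memNset ?mul0r//= in_itv/= andbT => /lt_geF; rewrite s0.
Qed.

Lemma gapmean_polarization mu nu s : mu D = 1%E -> nu D = 1%E -> 0 < s ->
  (gapmean R0 mu mu s + gapmean R0 nu nu s =
   2%:E * gapmean R0 mu nu s + (4 / pi)%:E * hatdist mu nu s)%E.
Proof.
move=> muD nuD s0; set c := (expR (- (s * R0 ^+ 2)) / s)%:E.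
have p40 : (0 <= (4 / pi)%:E :> \bar R)%E.
  by rewrite lee_fin divr_ge0 ?pi_ge0.
have sE m n : ((s^-1)%:E * gaussmean m n s =
    (4 / pi)%:E * ((pi / (4 * s))%:E * gaussmean m n s))%E.
  rewrite muleA -EFinM; congr (_%:E * _)%E.
  have p0 := pi_gt0 R; move: (pi : R) p0 => p p0.
  field; by rewrite ?(gt_eqF s0) ?(gt_eqF p0).
have : ((gapmean R0 mu mu s + c) + (gapmean R0 nu nu s + c) =
    2%:E * (gapmean R0 mu nu s + c) + (4 / pi)%:E * hatdist mu nu s)%E.
  rewrite !(gapmeanE mD R00 DR0)//.
  rewrite !sE -ge0_muleDr; last 2 first.
  - by rewrite mule_ge0 ?gaussmean_ge0// lee_fin divr_ge0 ?pi_ge0// mulr_ge0// ltW.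
  - by rewrite mule_ge0 ?gaussmean_ge0// lee_fin divr_ge0 ?pi_ge0// mulr_ge0// ltW.
  rewrite gaussmean_polarization// ge0_muleDr ?hatdist_ge0//; last first.
    rewrite !mule_ge0 ?gaussmean_ge0// lee_fin divr_ge0 ?pi_ge0// mulr_ge0//.
    exact: ltW.
  by congr (_ + _)%E; rewrite muleCA.
apply: ecancel => //; first [exact: gapmean_ge0|idtac].
by rewrite mule_ge0 ?hatdist_ge0.
Qed.

(** The polarization identity is integrated over all scales [s]; on the left only
    the distance at the scales between [a] and [2 * a] is kept. *)
Lemma mutual_coercive mu nu (a v : R) : mu D = 1%E -> nu D = 1%E ->
  (forall z, mu [set z] = 0%E) -> (forall z, nu [set z] = 0%E) ->
  0 < a -> 0 <= v ->
  (forall s, a <= s <= 2 * a -> (v%:E <= hatdist mu nu s)%E) ->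
  (2%:E * mutual R0 mu nu + (2 / pi * v * a)%:E <=
   mutual R0 mu mu + mutual R0 nu nu)%E.
Proof.
move=> muD nuD mu0 nu0 a0 v0 hv.
rewrite !(mutual_gapmean mD R00 DR0)//.
have mg m n : measurable_fun [set: R] (gapmean R0 m n).
  exact: measurable_gapmean.
have g0 m n s : (0 <= gapmean R0 m n s)%E by exact: gapmean_ge0.
have ig0 m n : (0 <= \int[leb]_s gapmean R0 m n s)%E by exact: integral_ge0.
have pv0 : (0 <= 4 / pi * v) by rewrite mulr_ge0 ?divr_ge0 ?pi_ge0.
rewrite -ge0_muleDr// -ge0_integralD//; try exact: mg.
rewrite [X in (X + _)%E]muleCA.
have -> : (2 / pi * v * a)%:E = ((2^-1)%:E *
    \int[leb]_s (4 / pi * v * \1_`[a, 2 * a] s)%:E)%E.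
  under eq_integral do rewrite EFinM.
  rewrite ge0_integralZl//; last first.
    by apply: measurable_EFin_comp; exact: measurable_indic.
  rewrite integral_indic//= setIT lebesgue_measure_itv/= lte_fin.
  rewrite ltr_pMl// ltr1n -EFinD -!EFinM; congr (_%:E).
  have := pi_gt0 R; move: (pi : R) => p p0; by field; rewrite gt_eqF.
rewrite -ge0_muleDr//; try by
  [rewrite mule_ge0|apply: integral_ge0 => s _; rewrite lee_fin mulr_ge0].
rewrite lee_wpmul2l// -ge0_integralZl//; try exact: mg.
rewrite -ge0_integralD//; first last.
- by apply: measurable_EFin_comp; apply: measurable_funM.
- by move=> s _; rewrite lee_fin mulr_ge0.
- by apply: emeasurable_funM => //; exact: mg.
- by move=> s _; rewrite mule_ge0.
apply: ge0_le_integral => //.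
- by move=> s _; rewrite adde_ge0 ?mule_ge0// lee_fin mulr_ge0.
- apply: emeasurable_funD; first by apply: emeasurable_funM => //; exact: mg.
  by apply: measurable_EFin_comp; apply: measurable_funM.
- by apply: emeasurable_funD; exact: mg.
move=> s _; have [s0|s0] := leP s 0.
  rewrite !gapmean_le0// mule0 adde0 add0e indicE memNset ?mulr0//.
  rewrite /= in_itv/= => /andP[+ _]; apply/negP; rewrite -ltNge.
  exact: le_lt_trans a0.
rewrite gapmean_polarization// leeD2l// indicE; case: (boolP (s \in _)).
  rewrite inE/= in_itv/= mulr1 => sa; rewrite EFinM lee_wpmul2l ?hv//.
  by rewrite lee_fin divr_ge0 ?pi_ge0.
by rewrite mulr0 mule_ge0 ?hatdist_ge0// lee_fin divr_ge0 ?pi_ge0.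
Qed.

End Coercivity.

(** * Test functions and the logarithmic energy *)

Section TestFunctions.
Context {R : realType}.
Implicit Types (z w u : R * R) (s : R) (mu nu : probability (R * R)%type R).
Local Notation leb := (@lebesgue_measure R).
Local Notation leb2 := (sprod leb leb).

(** Half of the Gaussian absorbs the linear factor, since [x <= exp (x ^+ 2)] at
    [x = sqrt s * cabs (u - z)]. *)
Lemma cabs_gauss_le s z u : 0 < s ->
  cabs (u - z) * gauss (2 * s) z u <= (Num.sqrt s)^-1 * gauss s z u.
Proof.
move=> s0; have q0 : 0 < Num.sqrt s by rewrite sqrtr_gt0.
rewrite [leRHS]mulrC ler_pdivlMr// cabsB /gauss.
set r := cabs (z - u); have r0 : 0 <= r by exact: cabs_ge0.
have -> : - (2 * s * r ^+ 2) = - (s * r ^+ 2) + - (s * r ^+ 2) by ring.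
rewrite expRD; set E := expR _; have E0 : 0 <= E by exact: expR_ge0.
have -> : r * (E * E) * Num.sqrt s = E * (r * Num.sqrt s * E) by ring.
rewrite ler_piMr// /E expRN ler_pdivrMr ?expR_gt0// mul1r.
apply: le_trans (expR_ge1Dx (s * r ^+ 2)).
have -> : 1 + s * r ^+ 2 = 1 + (r * Num.sqrt s) ^+ 2.
  by rewrite -{1}(sqr_sqrtr (ltW s0)); ring.
have := sqr_ge0 (r * Num.sqrt s - 1); nra.
Qed.

Variables (f : R * R -> R) (L : R).
Hypotheses (mf : measurable_fun [set: R * R] f) (f0 : forall u, 0 <= f u).
Hypotheses (L0 : 0 <= L) (fL : forall u z, f u <= f z + L * cabs (u - z)).

Let mfg s z : measurable_fun [set: R * R] (fun u => (f u * gauss s z u)%:E).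
Proof.
by apply: measurable_EFin_comp; apply: measurable_funM => //; exact: measurable_gaussr.
Qed.

Let mcg s z :
  measurable_fun [set: R * R] (fun u => (cabs (u - z) * gauss s z u)%:E).
Proof.
apply: measurable_EFin_comp; apply: measurable_funM; last exact: measurable_gaussr.
exact: (measurableT_comp measurable_cabsB (measurable_pair2 z)).
Qed.

Let mg s z : measurable_fun [set: R * R] (fun u => (gauss s z u)%:E).
Proof. by apply: measurable_EFin_comp; exact: measurable_gaussr. Qed.

Let mLcg s z : measurable_fun [set: R * R]
  (fun u => (L * (cabs (u - z) * gauss s z u))%:E).
Proof. by under eq_fun do rewrite EFinM; apply: emeasurable_funM; last exact: mcg. Qed.

Let mkg (k : R) s z :
  measurable_fun [set: R * R] (fun u => k%:E * (gauss s z u)%:E)%E.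
Proof. by apply: emeasurable_funM; last exact: mg. Qed.

Ltac side := try by [exact: mLcg | exact: mfg | exact: mkg | exact: mg |
  move=> u _; rewrite -?EFinM lee_fin !(mulr_ge0, cabs_ge0, gauss_ge0) | by rewrite ?lee_fin].

Lemma integral_cabs_gauss s z : 0 < s ->
  (\int[leb2]_u (L * (cabs (u - z) * gauss (2 * s) z u))%:E <=
   (pi / (2 * s) * (2 * L / Num.sqrt s))%:E)%E.
Proof.
move=> s0; have q0 : 0 < Num.sqrt s by rewrite sqrtr_gt0.
apply: (@le_trans _ _ (\int[leb2]_u ((L / Num.sqrt s)%:E * (gauss s z u)%:E))%E).
  apply: ge0_le_integral; side.
  move=> u _; rewrite -EFinM lee_fin -mulrA ler_wpM2l//.
  exact: cabs_gauss_le.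
rewrite ge0_integralZl; side; last first.
  by rewrite lee_fin divr_ge0// ltW.
rewrite integral_gauss// -EFinM lee_fin le_eqVlt; apply/orP; left; apply/eqP.
move: (Num.sqrt s) q0 (pi : R) => q q0 p.
by field; rewrite (gt_eqF q0) (gt_eqF s0).
Qed.

(** The Gaussian, of mass [pi / (2 * s)], is concentrated at distances of order
    [1 / sqrt s] from [z], where [f] varies by the order of [L / sqrt s]. *)
Lemma gauss_test_le s z : 0 < s ->
  (\int[leb2]_u (f u * gauss (2 * s) z u)%:E <=
   (pi / (2 * s) * (f z + 2 * L / Num.sqrt s))%:E)%E.
Proof.
move=> s0; have s20 : 0 < 2 * s by rewrite mulr_gt0.
apply: (@le_trans _ _ (\int[leb2]_u ((f z)%:E * (gauss (2 * s) z u)%:E +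
    (L * (cabs (u - z) * gauss (2 * s) z u))%:E))%E).
  apply: ge0_le_integral; side.
    by apply: emeasurable_funD; side.
  move=> u _; rewrite -EFinM -EFinD lee_fin mulrA -mulrDl.
  by rewrite ler_wpM2r ?gauss_ge0.
rewrite ge0_integralD; side.
rewrite ge0_integralZl; side.
rewrite integral_gauss// mulrDr EFinD -EFinM leeD//; first by rewrite mulrC.
exact: integral_cabs_gauss.
Qed.

Lemma gauss_test_ge s z : 0 < s ->
  ((pi / (2 * s) * f z)%:E <= \int[leb2]_u (f u * gauss (2 * s) z u)%:E +
   (pi / (2 * s) * (2 * L / Num.sqrt s))%:E)%E.
Proof.
move=> s0; have s20 : 0 < 2 * s by rewrite mulr_gt0.
apply: (@le_trans _ _ (\int[leb2]_u ((f u * gauss (2 * s) z u)%:E +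
    (L * (cabs (u - z) * gauss (2 * s) z u))%:E))%E); last first.
  rewrite ge0_integralD; side.
  by rewrite leeD2l//; exact: integral_cabs_gauss.
rewrite mulrC EFinM -(integral_gauss z s20) -ge0_integralZl; side.
apply: ge0_le_integral; side.
  by apply: emeasurable_funD; side.
move=> u _; rewrite -EFinM -EFinD lee_fin mulrA -mulrDl.
by rewrite ler_wpM2r ?gauss_ge0// cabsB.
Qed.

Let mfE : measurable_fun [set: R * R] (fun u => (f u)%:E).
Proof. exact: measurable_EFin_comp. Qed.

Let minner s : measurable_fun [set: R * R]
  (fun z => \int[leb2]_u (f u * gauss s z u)%:E)%E.
Proof.
apply: (@measurable_fun_fubini_tonelli_F _ _ _ _ _ leb2
  (fun q : (R * R) * (R * R) => (f q.2 * gauss s q.1 q.2)%:E)).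
  apply: measurable_EFin_comp; apply: measurable_funM.
    exact: (measurableT_comp mf measurable_snd).
  exact: measurable_gauss.
by move=> q; rewrite lee_fin mulr_ge0 ?gauss_ge0.
Qed.

Lemma integral_test_hat mu s : (\int[leb2]_u ((f u)%:E * gausshat mu s u) =
  \int[mu]_z \int[leb2]_u (f u * gauss (2 * s) z u)%:E)%E.
Proof.
rewrite integral_swap.
- apply: eq_integral => u _; rewrite -ge0_integralZl//; last 3 first.
  + by apply: measurable_EFin_comp; exact: measurable_gaussl.
  + by move=> z _; rewrite lee_fin gauss_ge0.
  + by rewrite lee_fin.
- by move=> z u; rewrite lee_fin mulr_ge0 ?gauss_ge0.
- apply: measurable_EFin_comp; apply: measurable_funM.
    exact: (measurableT_comp mf measurable_snd).
  exact: measurable_gauss.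
Qed.

Lemma hat_test_le mu s : 0 < s -> (\int[leb2]_u ((f u)%:E * gausshat mu s u) <=
  (pi / (2 * s))%:E * (\int[mu]_z (f z)%:E + (2 * L / Num.sqrt s)%:E))%E.
Proof.
move=> s0; rewrite integral_test_hat.
have c0 : (0 <= (2 * L / Num.sqrt s)%:E)%E.
  by rewrite lee_fin divr_ge0 ?sqrtr_ge0// mulr_ge0.
have p0 : (0 <= (pi / (2 * s))%:E)%E.
  by rewrite lee_fin divr_ge0 ?pi_ge0// mulr_ge0// ltW.
rewrite -[X in (_ * (_ + X))%E](integral_cst1 _ (probability_setT mu)).
rewrite -ge0_integralD//; last by move=> z _; rewrite lee_fin.
rewrite -ge0_integralZl//; first last.
- by move=> z _; rewrite adde_ge0// lee_fin.
- exact: emeasurable_funD.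
apply: ge0_le_integral => //.
- by move=> z _; apply: integral_ge0 => u _; rewrite lee_fin mulr_ge0 ?gauss_ge0.
- by apply: emeasurable_funM => //; exact: emeasurable_funD.
- by move=> z _; rewrite -EFinD -EFinM; exact: gauss_test_le.
Qed.

Lemma hat_test_ge mu s : 0 < s -> ((pi / (2 * s))%:E * \int[mu]_z (f z)%:E <=
  \int[leb2]_u ((f u)%:E * gausshat mu s u) +
  (pi / (2 * s))%:E * (2 * L / Num.sqrt s)%:E)%E.
Proof.
move=> s0; rewrite integral_test_hat.
have p0 : (0 <= (pi / (2 * s))%:E)%E.
  by rewrite lee_fin divr_ge0 ?pi_ge0// mulr_ge0// ltW.
have c0 : (0 <= (2 * L / Num.sqrt s)%:E)%E.
  by rewrite lee_fin divr_ge0 ?sqrtr_ge0// mulr_ge0.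
rewrite -[X in (_ + X)%E](integral_cst1 _ (probability_setT mu)).
have i0 z : (0 <= \int[leb2]_u (f u * gauss (2 * s) z u)%:E)%E.
  by apply: integral_ge0 => u _; rewrite lee_fin mulr_ge0 ?gauss_ge0.
rewrite -ge0_integralD//; last by move=> z _; rewrite mule_ge0.
rewrite -ge0_integralZl//; last by move=> z _; rewrite lee_fin.
apply: ge0_le_integral => //.
- by move=> z _; rewrite mule_ge0// lee_fin.
- exact: emeasurable_funM.
- exact: emeasurable_funD.
- by move=> z _; rewrite -!EFinM; exact: gauss_test_ge.
Qed.

(** The pointwise inequality [x y <= l x ^+ 2 + y ^+ 2 / (4 l)] is integrated, with
    [x] the value of [f] and [y] the difference of the features. *)
Lemma hat_compare mu nu s (l : R) : 0 < s -> 0 < l ->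
  (\int[leb2]_u ((f u)%:E * gausshat mu s u) <=
   \int[leb2]_u ((f u)%:E * gausshat nu s u) +
   l%:E * \int[leb2]_u (f u ^+ 2)%:E + ((4 * l)^-1)%:E * hatdist mu nu s)%E.
Proof.
move=> s0 l0; have l40 : 0 <= (4 * l)^-1 by rewrite invr_ge0 mulr_ge0// ltW.
have mf2 : measurable_fun [set: R * R] (fun u => (f u ^+ 2)%:E).
  by apply: measurable_EFin_comp; exact: measurable_funX.
have mh (m : probability (R * R)%type R) := measurable_gausshat m s.
have h0 (m : probability (R * R)%type R) u := gausshat_ge0 m s u.
have md : measurable_fun [set: R * R] (fun u =>
    ((fine (gausshat mu s u) - fine (gausshat nu s u)) ^+ 2)%:E).
  by apply: measurable_EFin_comp; exact: measurable_hatdist_fun.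
have mfh (m : probability (R * R)%type R) : measurable_fun [set: R * R]
    (fun u => (f u)%:E * gausshat m s u)%E.
  exact: emeasurable_funM.
have fh0 (m : probability (R * R)%type R) u : (0 <= (f u)%:E * gausshat m s u)%E.
  by rewrite mule_ge0// lee_fin.
rewrite -ge0_integralZl//; last 2 first.
- by move=> u _; rewrite lee_fin sqr_ge0.
- by rewrite lee_fin ltW.
have lf0 u : (0 <= l%:E * (f u ^+ 2)%:E)%E.
  by rewrite -EFinM lee_fin mulr_ge0 ?sqr_ge0// ltW.
have ld0 u : (0 <= ((4 * l)^-1)%:E *
    ((fine (gausshat mu s u) - fine (gausshat nu s u)) ^+ 2)%:E)%E.
  by rewrite -EFinM lee_fin mulr_ge0 ?sqr_ge0.
rewrite /hatdist -ge0_integralZl//; last by move=> u _; rewrite lee_fin sqr_ge0.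
have mlf : measurable_fun [set: R * R] (fun u => l%:E * (f u ^+ 2)%:E)%E.
  exact: emeasurable_funM.
have mld : measurable_fun [set: R * R] (fun u => ((4 * l)^-1)%:E *
    ((fine (gausshat mu s u) - fine (gausshat nu s u)) ^+ 2)%:E)%E.
  exact: emeasurable_funM.
rewrite -ge0_integralD//; last exact: mfh.
rewrite -ge0_integralD//; last 2 first.
- by move=> u _; rewrite adde_ge0.
- by apply: emeasurable_funD => //; exact: mfh.
apply: ge0_le_integral => //.
- exact: mfh.
- by apply: emeasurable_funD => //; apply: emeasurable_funD => //; exact: mfh.
move=> u _.
rewrite -(fineK (gausshat_fin mu u (ltW s0))) -(fineK (gausshat_fin nu u (ltW s0))).
set a := fine (gausshat mu s u); set b := fine (gausshat nu s u).
rewrite -!EFinM -!EFinD lee_fin /= -[leRHS]addrA -lerBlDl -mulrBr.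
rewrite -subr_ge0.
have -> : l * f u ^+ 2 + (4 * l)^-1 * (a - b) ^+ 2 - f u * (a - b) =
    (4 * l)^-1 * (2 * l * f u - (a - b)) ^+ 2 by field; rewrite gt_eqF.
by rewrite mulr_ge0 ?sqr_ge0.
Qed.

(** A small logarithmic distance makes the integrals of a test function close:
    the Gaussian features at one well-chosen scale [s] detect the function up to
    the error [L / sqrt s]. *)
Lemma mutual_close (A R0 : R) (D : set (R * R)) (e : R) :
  measurable D -> 0 < R0 ->
  (forall z w, D z -> D w -> cabs (z - w) <= R0) ->
  0 <= A -> (\int[leb2]_u (f u ^+ 2)%:E <= A%:E)%E -> 0 < e ->
  exists2 eta, 0 < eta & forall mu nu, mu D = 1%E -> nu D = 1%E ->
    (forall z, mu [set z] = 0%E) -> (forall z, nu [set z] = 0%E) ->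
    mutual R0 mu nu \is a fin_num ->
    (mutual R0 mu mu + mutual R0 nu nu <=
      2%:E * mutual R0 mu nu + (2 * eta)%:E)%E ->
    (\int[mu]_z (f z)%:E <= \int[nu]_z (f z)%:E + e%:E)%E.
Proof.
move=> mD R00 DR0 A0 fA e0.
(* At the scales between [s0] and [2 * s0] the smoothing error [2 * L / sqrt s] is
   at most [e / 4], and [X] is at most [e / 2] times the mass of the Gaussian.
   The choice of [l] and [v] splits [X] evenly between the two error terms of
   [hat_compare]. *)
pose s0 := (8 * L / e) ^+ 2 + 1.
have s00 : 0 < s0 by rewrite ltr_wpDl ?sqr_ge0.
pose X := pi * e / (8 * s0).
have X0 : 0 < X by rewrite divr_gt0 ?mulr_gt0// pi_gt0.
pose l := X / (2 * (A + 1)).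
have A10 : 0 < A + 1 by rewrite ltr_wpDl.
have l0 : 0 < l by rewrite divr_gt0// mulr_gt0.
pose v := 2 * l * X.
have v0 : 0 < v by apply: mulr_gt0 => //; exact: mulr_gt0.
exists (v * s0 / (2 * pi)).
  by apply: divr_gt0; apply: mulr_gt0 => //; exact: pi_gt0.
move=> mu nu muD nuD mu0 nu0 mfin hmu.
(* If the features were far apart at all these scales, coercivity would
   contradict the hypothesis on the mutual energies. *)
have [s /andP[s1 s2] hs] : exists2 s, s0 <= s <= 2 * s0 & (hatdist mu nu s < v%:E)%E.
  apply: contrapT => hn.
  have := mutual_coercive mD R00 DR0 muD nuD mu0 nu0 s00 (ltW v0).
  have hv s : s0 <= s <= 2 * s0 -> (v%:E <= hatdist mu nu s)%E.
    by move=> hs; rewrite leNgt; apply/negP => hv; apply: hn; exists s.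
  move=> /(_ hv); apply/negP; rewrite -ltNge; apply: le_lt_trans hmu _.
  rewrite -(fineK mfin) -EFinM -!EFinD lte_fin ltrD2l.
  have := pi_gt0 R; move: (pi : R) => p p0.
  have -> : 2 * (v * s0 / (2 * p)) = v * s0 / p by field; rewrite gt_eqF.
  have -> : 2 / p * v * s0 = 2 * (v * s0 / p) by field; rewrite gt_eqF.
  have : 0 < v * s0 / p by rewrite divr_gt0// mulr_gt0.
  by lra.
have s_gt0 : 0 < s by exact: lt_le_trans s1.
have p2 : 0 < pi / (2 * s) by rewrite divr_gt0 ?pi_gt0// mulr_gt0.
have key : ((pi / (2 * s))%:E * \int[mu]_z (f z)%:E <=
    (pi / (2 * s))%:E * (\int[nu]_z (f z)%:E + e%:E))%E.
  have h1 := hat_test_ge mu s_gt0.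
  have h2 := hat_compare mu nu s_gt0 l0.
  have h3 := hat_test_le nu s_gt0.
  apply: (le_trans h1).
  apply: (@le_trans _ _ ((pi / (2 * s))%:E * (\int[nu]_z (f z)%:E + (2 * L / Num.sqrt s)%:E)
    + X%:E + (pi / (2 * s))%:E * (2 * L / Num.sqrt s)%:E)%E).
    rewrite leeD2r//; apply: (le_trans h2); rewrite -addeA; apply: leeD => //.
    apply: (@le_trans _ _ (l%:E * A%:E + ((4 * l)^-1)%:E * v%:E)%E).
      apply: leeD; first by rewrite lee_wpmul2l// lee_fin ltW.
      by rewrite lee_wpmul2l ?(ltW hs)// lee_fin invr_ge0 mulr_ge0// ltW.
    rewrite -!EFinM -EFinD lee_fin.
    have -> : (4 * l)^-1 * v = X / 2 by rewrite /v; field; rewrite gt_eqF.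
    have : l * A <= X / 2.
      rewrite /l mulrAC ler_pdivrMr ?mulr_gt0//.
      by move: X0; nra.
    by lra.
  have nf0 : (0 <= \int[nu]_z (f z)%:E)%E.
    by apply: integral_ge0 => z _; rewrite lee_fin.
  have q0 : 0 < Num.sqrt s by rewrite sqrtr_gt0.
  have Lq : 2 * L / Num.sqrt s <= e / 4.
    rewrite ler_pdivrMr//.
    have : 8 * L / e <= Num.sqrt s.
      rewrite -[leLHS]ger0_norm; last by rewrite divr_ge0 ?mulr_ge0// ltW.
      by rewrite -sqrtr_sqr ler_sqrt ?(ltW s_gt0)// (le_trans _ s1)// /s0 lerDl.
    by rewrite ler_pdivrMr//; lra.
  have Xe : X <= pi / (2 * s) * (e / 2).
    rewrite /X ler_pdivrMr ?mulr_gt0//.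
    have -> : pi / (2 * s) * (e / 2) * (8 * s0) = pi * e * (2 * s0 / s).
      by field; rewrite gt_eqF.
    by rewrite ler_peMr ?mulr_ge0 ?pi_ge0 ?(ltW e0)// ler_pdivlMr// mul1r.
  case: (\int[nu]_z (f z)%:E)%E nf0 => [a| |]// _; last first.
    by rewrite /= gt0_muley ?lte_fin// leey.
  rewrite -!(EFinM, EFinD) lee_fin.
  have : pi / (2 * s) * (2 * L / Num.sqrt s) <= pi / (2 * s) * (e / 4).
    by rewrite ler_wpM2l// ltW.
  rewrite !mulrDr; lra.
by rewrite lee_pmul2l in key.
Qed.

End TestFunctions.

(** * Averages of measures and convexity of the energy *)

Section Average.
Context d (T : measurableType d) (R : realType).
Variables (n : nat) (nu : nat -> probability T R).
Local Open Scope ereal_scope.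

Let invn_ge0 : (0 <= n.+1%:R^-1 :> R)%R. Proof. by rewrite invr_ge0. Qed.

Definition pavg : set T -> \bar R := mscale (NngNum invn_ge0) (msum nu n.+1).

HB.instance Definition _ := Measure.on pavg.

Let pavg_setT : pavg setT = 1.
Proof.
rewrite /pavg /mscale/= /msum/= (eq_bigr (fun=> 1)); last first.
  by move=> i _; exact: probability_setT.
by rewrite sumEFin sumr_const card_ord -EFinM mulVf// pnatr_eq0.
Qed.

HB.instance Definition _ := Measure_isProbability.Build _ _ _ pavg pavg_setT.

Lemma pavgE A : pavg A = (n.+1%:R^-1)%:E * \sum_(i < n.+1) nu i A.
Proof. by []. Qed.

Lemma integral_pavg (f : T -> \bar R) : (forall x, 0 <= f x) ->
  measurable_fun [set: T] f ->
  \int[pavg]_x f x = (n.+1%:R^-1)%:E * \sum_(i < n.+1) \int[nu i]_x f x.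
Proof.
move=> f0 mf; rewrite /pavg ge0_integral_mscale//= ge0_integral_measure_sum//.
Qed.

End Average.

Lemma mutual_pavg (R : realType) (R0 : R) n
    (nu : nat -> probability (R * R)%type R) :
  (mutual R0 (pavg n nu) (pavg n nu) = (n.+1%:R^-1 ^+ 2)%:E *
    \sum_(i < n.+1) \sum_(j < n.+1) mutual R0 (nu i) (nu j))%E.
Proof.
have ml z : measurable_fun [set: R * R] (fun w => (logker R0 z w)%:E).
  apply: measurable_EFin_comp.
  exact: (measurableT_comp (measurable_logker R0) (measurable_pair1 z)).
have i0 (m : probability (R * R)%type R) z :
    (0 <= \int[m]_w (logker R0 z w)%:E)%E.
  by apply: integral_ge0 => w _; rewrite lee_fin logker_ge0.
have mi (m : probability (R * R)%type R) := measurable_mutual_inner R0 m.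
rewrite /mutual.
rewrite (@integral_pavg _ _ _ n nu (fun z => \int[pavg n nu]_w (logker R0 z w)%:E)%E
  (i0 _) (mi (pavg n nu))).
rewrite expr2 EFinM -muleA; congr (_ * _)%E.
rewrite ge0_sume_distrr; last by move=> i _; rewrite sume_ge0// => j _; exact: integral_ge0.
apply: eq_bigr => i _.
transitivity (\int[nu i]_z ((n.+1%:R^-1)%:E *
    \sum_(j < n.+1) \int[nu j]_w (logker R0 z w)%:E))%E.
  apply: eq_integral => z _; rewrite integral_pavg// => w.
  by rewrite lee_fin logker_ge0.
rewrite ge0_integralZl//; last 2 first.
- by apply: emeasurable_sum => j; exact: mi.
- by move=> z _; apply: sume_ge0.
by rewrite ge0_integral_sum// => j; exact: mi.
Qed.

(** As the integral of [f] may be infinite, the minimum of [f] and [c] is added to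
    the positive and negative parts of [f - c], which gives [f] and [c]. *)
Lemma integral_sub_cst d (T : measurableType d) (R : realType)
    (P : probability T R) (A : set T) (f : T -> \bar R) (c : R) :
  measurable A -> P A = 1%E -> 0 <= c -> (forall x, (0 <= f x)%E) ->
  measurable_fun [set: T] f ->
  (\int[P]_(x in A) (f x - c%:E) = \int[P]_x f x - c%:E)%E.
Proof.
move=> mA PA c0 f0 mf.
have -> : (\int[P]_(x in A) (f x - c%:E) = \int[P]_x (f x - c%:E))%E.
  rewrite [in RHS]integralE [in LHS]integralE.
  have mg : measurable_fun setT (fun x => f x - c%:E)%E.
    by apply: emeasurable_funB.
  by congr (_ - _)%E; apply/esym; apply: ge0_integral_full => //;
    [exact: prob_setC0|exact: measurable_funepos|
     exact: prob_setC0|exact: measurable_funeneg].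
pose h x := Order.min (f x) c%:E.
have h0 x : (0 <= h x)%E by rewrite le_min f0 lee_fin.
have mh : measurable_fun setT h by apply: measurable_mine.
have mg : measurable_fun setT (fun x => f x - c%:E)%E.
  by apply: emeasurable_funB.
have posE x : (f x = (fun x => f x - c%:E)^\+ x + h x)%E.
  rewrite funeposE /h; have := f0 x; case: (f x) => [r| |]// _.
  rewrite -EFinB -EFin_max -EFin_min -EFinD; congr (_%:E).
  have [rc|rc] := leP r c; first by rewrite max_r ?add0r// subr_le0.
  by rewrite max_l ?subrK// subr_ge0 ltW.
have negE x : (c%:E = (fun x => f x - c%:E)^\- x + h x)%E.
  rewrite funenegE /h; have := f0 x; case: (f x) => [r _|_|//].
    rewrite -EFinB -EFinN opprB -EFin_max -EFin_min -EFinD; congr (_%:E).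
    have [rc|rc] := leP r c; first by rewrite max_l ?subrK// subr_ge0.
    by rewrite max_r ?add0r// subr_le0 ltW.
  by rewrite /= max_r ?leNye// min_r ?leey// add0e.
rewrite [LHS]integralE.
have If : (\int[P]_x f x = \int[P]_x (fun x => f x - c%:E)^\+ x + \int[P]_x h x)%E.
  rewrite -ge0_integralD//; last exact: measurable_funepos.
  by apply: eq_integral => x _.
have Ic : (c%:E = \int[P]_x (fun x => f x - c%:E)^\- x + \int[P]_x h x)%E.
  rewrite -ge0_integralD//; last exact: measurable_funeneg.
  rewrite -[LHS](integral_cst1 _ (probability_setT P)).
  by apply: eq_integral => x _; exact: negE.
rewrite If {4}Ic.
have neg0 : (0 <= \int[P]_x (fun x => f x - c%:E)^\- x)%E by exact: integral_ge0.
have hI0 : (0 <= \int[P]_x h x)%E by exact: integral_ge0.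
have pos0 : (0 <= \int[P]_x (fun x => f x - c%:E)^\+ x)%E by exact: integral_ge0.
move: Ic neg0 hI0 pos0.
case: (\int[P]_x (fun x => f x - c%:E)^\- x)%E => [a| |]//;
case: (\int[P]_x h x)%E => [b| |]//.
case: (\int[P]_x (fun x => f x - c%:E)^\+ x)%E => [p| |]// _ _ _ _.
rewrite -[(p%:E + b%:E)%E]EFinD -[(a%:E + b%:E)%E]EFinD -!EFinB.
by congr (_%:E); ring.
Qed.

Section Energy.
Context {R : realType}.
Variables (D : set (R * R)) (W : R * R -> R) (R0 BW : R).
Hypotheses (mD : measurable D) (R01 : 1 <= R0) (BW0 : 0 <= BW).
Hypothesis DR0 : forall z w, D z -> D w -> cabs (z - w) <= R0.
Hypothesis WB : forall z, D z -> 0 <= W z + BW.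
Hypothesis mW : measurable_fun [set: R * R] W.
Implicit Types mu nu : probability (R * R)%type R.

(** The external potential, made nonnegative on the domain. *)
Definition pot z : R := Num.max 0 (W z + BW).

(** The energy, up to an additive constant, as an integral of nonnegative
    functions. *)
Definition posenergy mu : \bar R :=
  (\int[mu]_z (pot z)%:E + mutual R0 mu mu)%E.

Lemma pot_ge0 z : 0 <= pot z. Proof. by rewrite le_max lexx. Qed.

Lemma measurable_pot : measurable_fun [set: R * R] pot.
Proof. by apply: measurable_maxr => //; exact: measurable_funD. Qed.

Lemma potE z : D z -> pot z = W z + BW.
Proof. by move=> Dz; rewrite /pot max_r// WB. Qed.

Let R00 : 0 < R0. Proof. exact: lt_le_trans R01. Qed.

Lemma logker_subln z w : D z -> D w ->
  ln (cabs (z - w))^-1 = logker R0 z w - ln R0.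
Proof.
move=> Dz Dw; have lR : 0 <= ln R0 by rewrite ln_ge0.
have [zw|zw] := eqVneq (cabs (z - w)) 0.
  by rewrite /logker zw invr0 ln0// addr0 max_r// subrr.
have r0 : 0 < cabs (z - w) by rewrite lt_def zw cabs_ge0.
rewrite logkerE ?r0 ?DR0// lnM ?posrE ?invr_gt0//.
by rewrite addrAC subrr add0r.
Qed.

Lemma integral_potE mu : mu D = 1%E ->
  (\int[mu]_(z in D) (W z)%:E = \int[mu]_z (pot z)%:E - BW%:E)%E.
Proof.
move=> muD; rewrite -(integral_sub_cst mD muD)//.
- apply: eq_integral => z; rewrite inE => Dz.
  by rewrite potE// -EFinB addrK.
- by move=> z; rewrite lee_fin pot_ge0.
- by apply: measurable_EFin_comp; exact: measurable_pot.
Qed.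

Lemma energyE mu : nonatomic_on D mu ->
  (energy D W mu = \int[mu]_z (pot z)%:E - BW%:E +
    (mutual R0 mu mu - (ln R0)%:E))%E.
Proof.
move=> [muD mu0]; rewrite /energy integral_potE//; congr (_ + _)%E.
have lR : 0 <= ln R0 by rewrite ln_ge0.
have ml z : measurable_fun [set: R * R] (fun w => (logker R0 z w)%:E).
  apply: measurable_EFin_comp.
  exact: (measurableT_comp (measurable_logker R0) (measurable_pair1 z)).
rewrite /mutual -(integral_sub_cst mD muD)//; last 2 first.
- move=> z; apply: integral_ge0 => w _; by rewrite lee_fin logker_ge0.
- exact: measurable_mutual_inner.
apply: eq_integral => z; rewrite inE => Dz.
rewrite -(integral_sub_cst mD muD)//; last first.
  by move=> w; rewrite lee_fin logker_ge0.
by apply: eq_integral => w; rewrite inE => Dw; rewrite logker_subln// EFinB.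
Qed.

Lemma pot_fin mu B : (forall z, D z -> pot z <= B) -> mu D = 1%E ->
  (\int[mu]_z (pot z)%:E)%E \is a fin_num.
Proof.
move=> pB muD; rewrite ge0_fin_numE; last first.
  by apply: integral_ge0 => z _; rewrite lee_fin pot_ge0.
apply: (@le_lt_trans _ _ (\int[mu]_z (Num.max 0 B)%:E)%E); last first.
  by rewrite integral_cst1 ?ltry//; exact: probability_setT.
rewrite (ge0_integral_full mD (prob_setC0 mD muD))//; last 2 first.
- by move=> z; rewrite lee_fin pot_ge0.
- by apply: measurable_EFin_comp; exact: measurable_pot.
rewrite [leRHS](ge0_integral_full mD (prob_setC0 mD muD))//; last first.
  by move=> z; rewrite lee_fin le_max lexx.
apply: ge0_le_integral => //.
- by move=> z _; rewrite lee_fin pot_ge0.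
- by apply: measurable_funTS; apply: measurable_EFin_comp; exact: measurable_pot.
- by move=> z Dz; rewrite lee_fin le_max pB// orbT.
Qed.

Variables (B : R) (sigma : probability (R * R)%type R).
Hypothesis potB : forall z, D z -> pot z <= B.
Hypothesis hsigma : is_equilibrium_measure D W sigma.

Lemma posenergy_min mu : nonatomic_on D mu ->
  (posenergy sigma <= posenergy mu)%E.
Proof.
move=> nmu; have [ns /(_ mu nmu)] := hsigma; rewrite !energyE// /posenergy.
have := pot_fin potB nmu.1; have := pot_fin potB ns.1.
have := mutual_ge0 R0 mu mu; have := mutual_ge0 R0 sigma sigma.
case: (\int[mu]_z (pot z)%:E)%E => [a| |]//.
case: (\int[sigma]_z (pot z)%:E)%E => [b| |]//.
case: (mutual R0 mu mu) => [x| |]//; case: (mutual R0 sigma sigma) => [y| |]// _ _ _ _.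
- by rewrite -!(EFinB, EFinD) !lee_fin; lra.
- by move=> _; rewrite /= leey.
Qed.

Lemma posenergy_mutual_lty mu :
  (posenergy mu < +oo)%E -> (mutual R0 mu mu < +oo)%E.
Proof.
apply: le_lt_trans; rewrite /posenergy leeDr// integral_ge0// => z _.
by rewrite lee_fin pot_ge0.
Qed.

(** Comparing the equilibrium measure with the midpoint: the energy is convex,
    quantitatively so because the logarithmic kernel is positive on differences
    of probability measures. *)
Lemma posenergy_midpoint mu (eta : R) : nonatomic_on D mu ->
  (posenergy sigma < +oo)%E ->
  (posenergy mu <= posenergy sigma + eta%:E)%E ->
  mutual R0 mu sigma \is a fin_num /\
  (mutual R0 mu mu + mutual R0 sigma sigma <=
    2%:E * mutual R0 mu sigma + (2 * eta)%:E)%E.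
Proof.
move=> nmu soo hmu; have [ns _] := hsigma.
have muoo : (posenergy mu < +oo)%E.
  by apply: le_lt_trans hmu _; rewrite lte_add_pinfty// ltry.
have mm := posenergy_mutual_lty muoo; have ms := posenergy_mutual_lty soo.
have mms : mutual R0 mu sigma \is a fin_num.
  (* The case of coercivity with constant 0 bounds the mixed term by the two
     self-energies. *)
  rewrite ge0_fin_numE ?mutual_ge0//.
  have h (s : R) : 1 <= s <= 2 * 1 -> (0%:E <= hatdist mu sigma s)%E.
    by move=> _; exact: hatdist_ge0.
  have := @mutual_coercive _ R0 D mD R00 DR0 mu sigma 1 0 nmu.1 ns.1 nmu.2 ns.2
    ltr01 (lexx _) h.
  rewrite mulr0 mul0r adde0 => h2.
  rewrite ltey; apply/negP => /eqP moo; move: h2; rewrite moo gt0_muley//.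
  by apply/negP; rewrite -ltNge lte_add_pinfty.
split=> //.
pose nu i := if i == 0%N then mu else sigma.
have nm : nonatomic_on D (pavg 1 nu).
  split=> [|z]; rewrite [LHS]pavgE/= !big_ord_recl big_ord0/=.
    by rewrite nmu.1 ns.1 adde0 -!EFinD -EFinM mulVf.
  by rewrite nmu.2 ns.2 !adde0 mule0.
have := posenergy_min nm.
have pm : mutual R0 (pavg 1 nu) (pavg 1 nu) = ((2^-1 ^+ 2)%:E *
    (mutual R0 mu mu + mutual R0 mu sigma +
    (mutual R0 mu sigma + mutual R0 sigma sigma)))%E.
  rewrite mutual_pavg !big_ord_recl !big_ord0/= !adde0.
  by rewrite [mutual R0 sigma mu]mutualC.
rewrite /posenergy pm integral_pavg; last 2 first.
- by move=> z; rewrite lee_fin pot_ge0.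
- by apply: measurable_EFin_comp; exact: measurable_pot.
rewrite !big_ord_recl big_ord0/= adde0.
move: hmu; rewrite /posenergy.
have := pot_fin potB nmu.1; have := pot_fin potB ns.1.
have := mutual_ge0 R0 mu mu; have := mutual_ge0 R0 sigma sigma.
move: mm ms mms.
case: (\int[mu]_z (pot z)%:E)%E => [a| |]//.
case: (\int[sigma]_z (pot z)%:E)%E => [b| |]//.
case: (mutual R0 mu mu) => [x| |]//; case: (mutual R0 sigma sigma) => [y| |]//.
case: (mutual R0 mu sigma) => [t| |]// _ _ _ _ _ _ _.
rewrite -!(EFinM, EFinD) !lee_fin => h1 h2.
have -> : 2 = 1 + 1 :> R by ring.
move: h2; rewrite (_ : (1 + 1)^-1 = 2^-1 :> R)//.
rewrite (_ : 2^-1 ^+ 2 = 4^-1 :> R); last by field.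
lra.
Qed.

End Energy.

(** * Frostman estimates *)

Section LogKernelBound.
Context {R : realType}.
Variables (R0 : R) (D : set (R * R)).
Hypotheses (mD : measurable D) (R01 : 1 <= R0).
Hypothesis DR0 : forall z w, D z -> D w -> cabs (z - w) <= R0.
Implicit Types (z w : R * R) (nu : probability (R * R)%type R).

Let R00 : 0 < R0. Proof. exact: lt_le_trans R01. Qed.

Definition cball w (r : R) : set (R * R) := [set z | cabs (z - w) <= r].

(** Discs have a mass at most linear in their radius, so that the logarithm has a
    bounded integral around every point. *)
Definition spread (delta : R) z0 nu : Prop :=
  nu (D `&` cball z0 delta) = 1%E /\
  forall w r, 0 <= r -> (nu (cball w r) <= (4 * r / delta)%:E)%E.

(** The logarithm of [delta / cabs (z - w)] is at most the number of dyadic scales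
    [delta / 2 ^ j] not less than [cabs (z - w)], as halving the scale increases
    the logarithm by [ln 2 <= 1]. *)
Lemma logker_dyadic (delta : R) z w : 0 < delta -> delta <= 1 -> D z -> D w ->
  ((logker R0 z w)%:E <= (ln (R0 / delta))%:E +
    \sum_(0 <= j <oo) (\1_(cball w (delta / (2 ^ j)%:R)) z : R)%:E)%E.
Proof.
move=> d0 d1 Dz Dw; set r := cabs (z - w).
have dR : 0 <= ln (R0 / delta).
  by rewrite ln_ge0// ler_pdivlMr// mul1r (le_trans d1).
have s0 : (0 <= \sum_(0 <= j <oo) (\1_(cball w (delta / (2 ^ j)%:R)) z : R)%:E)%E.
  by apply: nneseries_ge0 => j _ _; rewrite lee_fin.
(* On the diagonal the kernel has the value [ln R0]. *)
have [rE|r_neq0] := eqVneq r 0.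
  apply: (@le_trans _ _ (ln (R0 / delta))%:E); last by rewrite leeDl.
  have -> : logker R0 z w = ln R0.
    by rewrite /logker -/r rE invr0 (@ln0 R 0)// addr0 max_r// ln_ge0.
  rewrite lee_fin.
  by rewrite ler_ln ?posrE ?divr_gt0// ler_peMr ?(ltW R00)// invf_ge1.
have r0 : 0 < r by rewrite lt_def r_neq0 cabs_ge0.
have lE : logker R0 z w = ln (R0 / r) by rewrite logkerE// r0 DR0.
have [dr|rd] := ltP delta r.
  apply: (@le_trans _ _ (ln (R0 / delta))%:E); last by rewrite leeDl.
  by rewrite lE lee_fin ler_ln ?posrE ?divr_gt0// ler_wpM2l ?(ltW R00)// lef_pV2 ?posrE// ltW.
have ex : exists n, delta / (2 ^ n.+1)%:R < r.
  exists (Num.bound (delta / r)).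
  rewrite ltr_pdivrMr ?ltr0n ?expn_gt0// mulrC -ltr_pdivrMr//.
  apply: lt_trans (archi_boundP (ltW (divr_gt0 d0 r0))) _.
  rewrite ltr_nat; apply: leq_trans (ltn_expl _ (isT : 1 < 2)%N) _.
  by rewrite leq_exp2l.
pose n := ex_minn ex.
have nP : delta / (2 ^ n.+1)%:R < r by rewrite /n; case: ex_minnP.
have nm k : (k <= n)%N -> r <= delta / (2 ^ k)%:R.
  case: k => [_|k kn]; first by rewrite expn0 divr1.
  rewrite leNgt; apply/negP => h.
  move: kn; rewrite /n; case: ex_minnP => m _ /(_ k h) mk.
  by rewrite ltnNge mk.
apply: (@le_trans _ _ ((ln (R0 / delta))%:E + (n.+1%:R)%:E)%E).
  rewrite lE -EFinD lee_fin.
  have -> : R0 / r = R0 / delta * (delta / r) by field; rewrite !gt_eqF.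
  rewrite lnM ?posrE ?divr_gt0// lerD2l.
  have : delta / r <= 2 ^+ n.+1.
    by rewrite ler_pdivrMr// mulrC -ler_pdivrMr ?exprn_gt0// -natrX ltW.
  rewrite -ler_ln ?posrE ?divr_gt0 ?exprn_gt0// lnXn// => h.
  apply: le_trans h _; apply: ler_wMn2r.
  by apply: (@le_ln1Dx R 1); lra.
rewrite leeD2l//.
apply: (@le_trans _ _ (\sum_(0 <= j < n.+1)
    (\1_(cball w (delta / (2 ^ j)%:R)) z : R)%:E)%E).
  rewrite big_mkord (eq_bigr (fun=> 1%E)); last first.
    by move=> [j jn] _; rewrite indicE mem_set//= /cball/= nm.
  by rewrite sumEFin sumr_const card_ord.
by apply: nneseries_lim_ge => j _ _; rewrite lee_fin.
Qed.

(** The dyadic discs around [w] have masses at most [4 / 2 ^ j], of sum 8. *)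
Lemma integral_logker_spread (delta : R) z0 w nu : 0 < delta -> delta <= 1 ->
  D w -> spread delta z0 nu ->
  (\int[nu]_z (logker R0 z w)%:E <= (ln (R0 / delta) + 8)%:E)%E.
Proof.
move=> d0 d1 Dw [nuB hnu].
have dR : 0 <= ln (R0 / delta).
  by rewrite ln_ge0// ler_pdivlMr// mul1r (le_trans d1).
have mC u r : measurable (cball u r) by exact: measurable_cball.
have nuD : nu D = 1%E.
  apply/eqP; rewrite eq_le probability_le1//= -nuB le_measure ?inE//.
  exact: measurableI.
have ml : measurable_fun [set: R * R] (fun z => (logker R0 z w)%:E).
  apply: measurable_EFin_comp.
  exact: (measurableT_comp (measurable_logker R0) (measurable_pair2 w)).
have m1 j : measurable_fun [set: R * R]
    (fun z => (\1_(cball w (delta / (2 ^ j)%:R)) z : R)%:E).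
  by apply: measurable_EFin_comp; exact: measurable_indic.
have ms : measurable_fun [set: R * R] (fun z =>
    \sum_(0 <= j <oo) (\1_(cball w (delta / (2 ^ j)%:R)) z : R)%:E)%E.
  by apply: ge0_emeasurable_sum => // j x _ _; rewrite lee_fin.
have s0 z : (0 <= \sum_(0 <= j <oo) (\1_(cball w (delta / (2 ^ j)%:R)) z : R)%:E)%E.
  by apply: nneseries_ge0 => j _ _; rewrite lee_fin.
apply: (@le_trans _ _ (\int[nu]_z ((ln (R0 / delta))%:E +
    \sum_(0 <= j <oo) (\1_(cball w (delta / (2 ^ j)%:R)) z : R)%:E))%E).
  rewrite (ge0_integral_full mD (prob_setC0 mD nuD))//; last first.
    by move=> z; rewrite lee_fin logker_ge0.
  rewrite [leRHS](ge0_integral_full mD (prob_setC0 mD nuD))//; last 2 first.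
  - by move=> z; rewrite adde_ge0// lee_fin.
  - exact: emeasurable_funD.
  apply: ge0_le_integral => //.
  - by move=> z _; rewrite lee_fin logker_ge0.
  - exact: measurable_funTS.
  - by apply: measurable_funTS; exact: emeasurable_funD.
  - by move=> z Dz; exact: logker_dyadic.
rewrite ge0_integralD; [|by []|by move=> z _; rewrite lee_fin|by []|by move=> z _; exact: s0|exact: ms].
rewrite integral_cst1; last exact: probability_setT.
rewrite [leRHS]EFinD leeD2l// integral_nneseries//.
apply: le_trans (epsilon_trick0 xpredT (ler0n R 8)); apply: lee_nneseries.
  by move=> j _ _; apply: integral_ge0 => z _; rewrite lee_fin.
move=> j _; rewrite integral_indic// setIT.
apply: le_trans (hnu _ _ _) _; first by rewrite divr_ge0// ltW.
rewrite lee_fin natrX expnS natrM natrX.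
have e0 : 0 < 2 ^+ j :> R by rewrite exprn_gt0.
by rewrite le_eqVlt; apply/orP; left; apply/eqP; field; rewrite !gt_eqF.
Qed.

Lemma mutual_spread_le (delta : R) z1 z2 nu1 nu2 : 0 < delta -> delta <= 1 ->
  spread delta z1 nu1 -> spread delta z2 nu2 ->
  (mutual R0 nu1 nu2 <= (ln (R0 / delta) + 8)%:E)%E.
Proof.
move=> d0 d1 s1 s2.
have mC u r : measurable (cball u r) by exact: measurable_cball.
have nuD : nu1 D = 1%E.
  apply/eqP; rewrite eq_le probability_le1//= -s1.1 le_measure ?inE//.
  exact: measurableI.
have dR : 0 <= ln (R0 / delta) + 8.
  by rewrite addr_ge0// ln_ge0// ler_pdivlMr// mul1r (le_trans d1).
rewrite -[leRHS](integral_cst1 _ (probability_setT nu1)).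
have i0 z : (0 <= \int[nu2]_w (logker R0 z w)%:E)%E.
  by apply: integral_ge0 => w _; rewrite lee_fin logker_ge0.
rewrite /mutual (ge0_integral_full mD (prob_setC0 mD nuD))//; last first.
  exact: measurable_mutual_inner.
rewrite [leRHS](ge0_integral_full mD (prob_setC0 mD nuD))//.
apply: ge0_le_integral => //.
- by apply: measurable_funTS; exact: measurable_mutual_inner.
- move=> z Dz; apply: le_trans (integral_logker_spread d0 d1 Dz s2).
  rewrite le_eqVlt; apply/orP; left; apply/eqP.
  by apply: eq_integral => w _; rewrite logkerC.
Qed.

(** Moving both points by at most [delta] shrinks their distance at most by the
    factor [1 - 2 / K]. *)
Lemma mutual_spread_far (delta K : R) z1 z2 nu1 nu2 : 0 < delta -> 4 <= K ->
  D z1 -> D z2 -> K * delta < cabs (z1 - z2) ->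
  spread delta z1 nu1 -> spread delta z2 nu2 ->
  (mutual R0 nu1 nu2 <= (logker R0 z1 z2 + 4 / K)%:E)%E.
Proof.
move=> d0 K4 D1 D2; set d := cabs _ => dK [s1 _] [s2 _].
have K0 : 0 < K by apply: lt_le_trans K4.
have d_gt0 : 0 < d by apply: lt_trans dK; rewrite mulr_gt0.
have mC u r : measurable (cball u r) by exact: measurable_cball.
have mB z : measurable (D `&` cball z delta) by exact: measurableI.
have c0 : 0 <= logker R0 z1 z2 + 4 / K.
  by rewrite addr_ge0 ?logker_ge0// divr_ge0// ltW.
have ml z : measurable_fun [set: R * R] (fun w => (logker R0 z w)%:E).
  apply: measurable_EFin_comp.
  exact: (measurableT_comp (measurable_logker R0) (measurable_pair1 z)).
have i0 z : (0 <= \int[nu2]_w (logker R0 z w)%:E)%E.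
  by apply: integral_ge0 => w _; rewrite lee_fin logker_ge0.
rewrite -[leRHS](integral_cst1 _ (probability_setT nu1)).
rewrite /mutual (ge0_integral_full (mB z1) (prob_setC0 (mB z1) s1))//; last first.
  exact: measurable_mutual_inner.
rewrite [leRHS](ge0_integral_full (mB z1) (prob_setC0 (mB z1) s1))//.
apply: ge0_le_integral => //.
  by apply: measurable_funTS; exact: measurable_mutual_inner.
move=> z [Dz zz1].
rewrite -[leRHS](integral_cst1 _ (probability_setT nu2)).
rewrite (ge0_integral_full (mB z2) (prob_setC0 (mB z2) s2))//; last first.
  by move=> w; rewrite lee_fin logker_ge0.
rewrite [leRHS](ge0_integral_full (mB z2) (prob_setC0 (mB z2) s2))//.
apply: ge0_le_integral => //.
- by move=> w _; rewrite lee_fin logker_ge0.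
- exact: measurable_funTS.
move=> w [Dw wz2]; rewrite lee_fin.
move: zz1 wz2; rewrite /cball/= => zz1 wz2.
have dzw : d <= 2 * delta + cabs (z - w).
  have := cabs_triangle z z1 z2; have := cabs_triangle w z z2.
  by rewrite (cabsB z1 z) -/d; lra.
have dd : d * (1 - 2 / K) <= cabs (z - w).
  have : delta <= d / K by rewrite ler_pdivlMr// mulrC ltW.
  have -> : d * (1 - 2 / K) = d - 2 * (d / K) by ring.
  by lra.
have iK : K^-1 <= 4^-1 by rewrite lef_pV2 ?posrE.
have iK0 : 0 < K^-1 by rewrite invr_gt0.
have h0 : 0 < 1 - 2 / K by lra.
have zw0 : 0 < cabs (z - w) by apply: lt_le_trans dd; rewrite mulr_gt0.
rewrite !logkerE ?zw0 ?d_gt0 ?DR0//.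
have -> : R0 / cabs (z - w) = R0 / d * (d / cabs (z - w)).
  by field; rewrite !gt_eqF.
rewrite lnM ?posrE ?divr_gt0// lerD2l.
have : d / cabs (z - w) <= (1 - 2 / K)^-1.
  by rewrite ler_pdivrMr// mulrC ler_pdivlMr.
have := @le_ln1Dx R (d / cabs (z - w) - 1).
rewrite (_ : 1 + (d / cabs (z - w) - 1) = d / cabs (z - w)); last by ring.
move=> h.
have {}h : ln (d / cabs (z - w)) <= d / cabs (z - w) - 1.
  by apply: h; have : 0 < d / cabs (z - w); [by rewrite divr_gt0|lra].
move=> h2; apply: (le_trans h); rewrite lerBlDr (le_trans h2)//.
rewrite -[leLHS]mul1r ler_pdivrMr//.
by move: iK iK0; set x := K^-1; nra.
Qed.

End LogKernelBound.

(** * Smearing configurations of points *)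

Section Configurations.
Context {R : realType}.
Variables (D : set (R * R)) (W : R * R -> R) (R0 BW : R).
Hypotheses (mD : measurable D) (R01 : 1 <= R0) (BW0 : 0 <= BW).
Hypothesis DR0 : forall z w, D z -> D w -> cabs (z - w) <= R0.
Hypothesis mW : measurable_fun [set: R * R] W.
Hypothesis potC : forall e, 0 < e -> exists2 dl, 0 < dl &
  forall z w, D z -> D w -> cabs (z - w) <= dl -> pot W BW z <= pot W BW w + e.

Variable rho : {measure set (R * R)%type -> \bar R}.
Implicit Types (nu mu : probability (R * R)%type R).

Definition dominated nu := exists2 M : R, 0 <= M &
  forall A, measurable A -> (nu A <= M%:E * rho A)%E.

Hypothesis spreadP : exists2 d0, 0 < d0 & forall delta z0, D z0 ->
  0 < delta -> delta <= d0 -> exists2 nu, dominated nu & spread D delta z0 nu.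

(** Minus the logarithm of the weight of a configuration of [N] distinct
    points, up to an additive constant. *)
Definition hamiltonian N (z : N.-tuple (R * R)) : R :=
  N%:R * \sum_(i < N) pot W BW (tnth z i) +
  \sum_(i < N) \sum_(j < N | j != i) logker R0 (tnth z i) (tnth z j).

Lemma hamiltonian_ge0 N (z : N.-tuple (R * R)) : 0 <= hamiltonian z.
Proof.
rewrite addr_ge0// ?mulr_ge0// ?sumr_ge0// => i _; first exact: pot_ge0.
by rewrite sumr_ge0// => j _; exact: logker_ge0.
Qed.

Let R00 : 0 < R0. Proof. exact: lt_le_trans R01. Qed.

Lemma integral_near_le nu (dl : R) z0 (f : R * R -> R) (c : R) :
  nu (D `&` cball z0 dl) = 1%E -> measurable_fun [set: R * R] f ->
  (forall z, 0 <= f z) -> 0 <= c ->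
  (forall z, D z -> cball z0 dl z -> f z <= c) ->
  (\int[nu]_z (f z)%:E <= c%:E)%E.
Proof.
move=> nu1 mf f0 c0 fc; have mfE := measurable_EFin_comp mf.
have mB : measurable (D `&` cball z0 dl).
  by apply: measurableI => //; exact: measurable_cball.
rewrite -[leRHS](integral_cst1 _ (probability_setT nu)).
rewrite (ge0_integral_full mB (prob_setC0 mB nu1))//.
rewrite [leRHS](ge0_integral_full mB (prob_setC0 mB nu1))//.
apply: ge0_le_integral => //.
- by move=> z _; rewrite lee_fin.
- exact: measurable_funTS.
- by move=> z [Dz zB]; rewrite lee_fin fc.
Qed.

Lemma integral_near_ge nu (dl : R) z0 (f : R * R -> R) (c : R) :
  nu (D `&` cball z0 dl) = 1%E -> measurable_fun [set: R * R] f ->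
  (forall z, 0 <= f z) -> 0 <= c ->
  (forall z, D z -> cball z0 dl z -> c <= f z) ->
  (c%:E <= \int[nu]_z (f z)%:E)%E.
Proof.
move=> nu1 mf f0 c0 fc; have mfE := measurable_EFin_comp mf.
have mB : measurable (D `&` cball z0 dl).
  by apply: measurableI => //; exact: measurable_cball.
rewrite -[leLHS](integral_cst1 _ (probability_setT nu)).
rewrite (ge0_integral_full mB (prob_setC0 mB nu1))//.
rewrite [leRHS](ge0_integral_full mB (prob_setC0 mB nu1))//.
apply: ge0_le_integral => //; first exact: measurable_funTS.
by move=> z [Dz zB]; rewrite lee_fin fc.
Qed.

Lemma spread_nonatomic (dl : R) z0 nu : 0 < dl -> spread D dl z0 nu ->
  nonatomic_on D nu.
Proof.
move=> dl0 [s1 s2]; split.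
  apply/eqP; rewrite eq_le probability_le1//= -s1 le_measure ?inE//.
  by apply: measurableI => //; exact: measurable_cball.
move=> z; apply/eqP; rewrite eq_le measure_ge0 andbT.
rewrite -[leRHS]/((0 : R)%:E).
have -> : (0 : R) = 4 * 0 / dl by rewrite mulr0 mul0r.
apply: le_trans (s2 z 0 (lexx _)); rewrite le_measure ?inE//.
- exact: measurable_point.
- exact: measurable_cball.
- by move=> w /= ->; rewrite /cball/= subrr cabs0.
Qed.

Definition nearby (r : R) (z w : R * R) : R := (cabs (z - w) <= r)%R%:R.

(** Each pair at distance at most [r] contributes at least [ln (R0 / r)] to the
    hamiltonian. *)
Lemma near_pairs N (z : N.-tuple (R * R)) (r C : R) :
  (forall i, D (tnth z i)) -> injective (tnth z) -> 0 < r -> r < R0 ->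
  hamiltonian z <= N%:R ^+ 2 * C ->
  \sum_(i < N) \sum_(j < N | j != i) nearby r (tnth z i) (tnth z j) <=
  N%:R ^+ 2 * C / ln (R0 / r).
Proof.
move=> Dz zI r0 rR hC.
have l0 : 0 < ln (R0 / r) by rewrite ln_gt0// ltr_pdivlMr// mul1r.
rewrite ler_pdivlMr// (le_trans _ hC)// mulr_suml.
apply: (@le_trans _ _ (\sum_(i < N) \sum_(j < N | j != i)
    logker R0 (tnth z i) (tnth z j))); last first.
  rewrite lerDr mulr_ge0// sumr_ge0// => i _; exact: pot_ge0.
apply: ler_sum => i _; rewrite mulr_suml; apply: ler_sum => j ji.
rewrite /nearby; case: (leP (cabs _) r) => h; last by rewrite mul0r logker_ge0.
have c0 : 0 < cabs (tnth z i - tnth z j).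
  rewrite lt_def cabs_ge0 cabs_eq0 subr_eq0 andbT.
  by apply: contra ji => /eqP /zI ->.
rewrite mul1r logkerE// ?c0 ?DR0// ler_ln ?posrE ?divr_gt0//.
by rewrite ler_wpM2l ?(ltW R00)// lef_pV2 ?posrE.
Qed.

(** Every point is replaced by a measure satisfying a Frostman estimate at a small
    scale [dl]. For distant pairs this barely changes the logarithm, for close
    pairs it changes it by a bounded amount, and the close pairs are few by
    [near_pairs]. *)
Lemma spread_configuration (C e : R) : 0 <= C -> 0 < e ->
  exists N0, forall n (z : n.+1.-tuple (R * R)), (N0 <= n)%N ->
    (forall i, D (tnth z i)) -> injective (tnth z) ->
    hamiltonian z <= n.+1%:R ^+ 2 * C ->
  exists mu, [/\ dominated mu, nonatomic_on D mu,
    (posenergy W R0 BW mu <= (hamiltonian z / n.+1%:R ^+ 2 + e)%:E)%E &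
    forall (f : R * R -> R) L, measurable_fun [set: R * R] f ->
      (forall u, 0 <= f u) -> 0 <= L ->
      (forall u v, f u <= f v + L * cabs (u - v)) ->
      (\int[mu]_z (f z)%:E <=
        (n.+1%:R^-1 * \sum_(i < n.+1) f (tnth z i) + L * e)%:E)%E /\
      ((n.+1%:R^-1 * \sum_(i < n.+1) f (tnth z i))%:E <=
        \int[mu]_z (f z)%:E + (L * e)%:E)%E].
Proof.
move=> C0 e0; have [d0 d00 sP] := spreadP.
have e40 : 0 < e / 4 by rewrite divr_gt0.
have [d1 d10 pP] := potC e40.
(* Four errors of [e / 4]: the oscillation of the potential at distance [dl]; the
   error [4 / K] of the pairs at distance more than [K * dl]; the other pairs,
   whose proportion is at most [C / T] as [ln (R0 / (K * dl)) >= T]; and the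
   self-energies on the diagonal, of order [1 / N]. *)
pose K := 16 / e + 4.
have K4 : 4 <= K by rewrite lerDr divr_ge0// ltW.
have K0 : 0 < K by apply: lt_le_trans K4.
have Ke : 4 / K <= e / 4.
  rewrite ler_pdivrMr// /K mulrDr (_ : e / 4 * (16 / e) = 4); last by field; rewrite gt_eqF.
  by rewrite lerDl; lra.
have lK : 0 <= ln K by rewrite ln_ge0// (le_trans _ K4)// ler1n.
pose T := 4 * (8 + ln K) * C / e + 1.
have T0 : 0 < T by rewrite ltr_wpDl// divr_ge0 ?(ltW e0)// !mulr_ge0// addr_ge0.
pose dl := Num.min (Num.min d0 d1) (Num.min (Num.min 1 e) (R0 / (K * expR T))).
have KT0 : 0 < K * expR T by rewrite mulr_gt0 ?expR_gt0.
have dl0 : 0 < dl by rewrite !lt_min d00 d10 ltr01 e0 divr_gt0.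
have [dld0 dld1 dl1 dle dlR] : [/\ dl <= d0, dl <= d1, dl <= 1, dl <= e &
    dl <= R0 / (K * expR T)].
  by split; rewrite /dl !ge_min lexx ?orbT.
have Kdl : 0 < K * dl by rewrite mulr_gt0.
have lKdl : T <= ln (R0 / (K * dl)).
  rewrite -[leLHS]expRK ler_ln ?posrE ?expR_gt0 ?divr_gt0//.
  move: dlR; rewrite ler_pdivlMr// => h; rewrite ler_pdivlMr//.
  by rewrite (_ : expR T * (K * dl) = dl * (K * expR T)) //; ring.
have KdlR : K * dl < R0.
  rewrite ltNge; apply/negP => h.
  have : ln (R0 / (K * dl)) <= 0 by apply: ln_le0; rewrite ler_pdivrMr// mul1r.
  by rewrite leNgt (lt_le_trans T0 lKdl).
pose N0 := Num.bound (4 * (ln (R0 / dl) + 8) / e).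
have ldl : 0 <= ln (R0 / dl) + 8.
  by rewrite addr_ge0// ln_ge0// ler_pdivlMr// mul1r (le_trans dl1).
exists N0 => n z Nn Dz zI hz.
set N := n.+1%:R : R.
have N_gt0 : 0 < N by rewrite ltr0n.
have sumC (c : R) : \sum_(i < n.+1) c = N * c.
  by rewrite sumr_const card_ord mulr_natl.
have hN : (ln (R0 / dl) + 8) / N <= e / 4.
  rewrite ler_pdivrMr//.
  have : 4 * (ln (R0 / dl) + 8) / e <= N.
    apply: ltW; apply: lt_le_trans (archi_boundP _) _.
      by rewrite divr_ge0 ?mulr_ge0// ltW.
    by rewrite ler_nat (leq_trans Nn).
  by rewrite ler_pdivrMr//; lra.
have [nu0 nu0P] := choice (fun i : 'I_n.+1 =>
  let: ex_intro2 nu a b := sP dl (tnth z i) (Dz i) dl0 dld0 in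
  ex_intro (fun nu => dominated nu /\ spread D dl (tnth z i) nu) nu (conj a b)).
pose nu (i : nat) := nu0 (inord i).
have nuE (i : 'I_n.+1) : nu i = nu0 i by rewrite /nu inord_val.
exists (pavg n nu); split.
- have [M MP] := choice (fun i : 'I_n.+1 =>
    let: ex_intro2 M a b := (nu0P i).1 in
    ex_intro (fun M => 0 <= M /\ forall A, measurable A ->
      (nu0 i A <= M%:E * rho A)%E) M (conj a b)).
  exists (\sum_i M i); first by apply: sumr_ge0 => i _; have [] := MP i.
  move=> A mA; rewrite [leLHS]pavgE.
  have SM0 : 0 <= \sum_i M i by apply: sumr_ge0 => i _; have [] := MP i.
  apply: (@le_trans _ _ ((N^-1)%:E *
      \sum_(i < n.+1) ((\sum_i M i)%:E * rho A))%E).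
    rewrite lee_wpmul2l ?lee_fin ?invr_ge0 ?(ltW N_gt0)//.
    apply: lee_sum => i _; rewrite nuE.
    apply: (le_trans ((MP i).2 A mA)); rewrite lee_wpmul2r// lee_fin.
    rewrite (bigD1 i)//= lerDl; apply: sumr_ge0 => j _; by have [] := MP j.
  rewrite (eq_bigr (fun=> 1%:E * ((\sum_i M i)%:E * rho A))%E); last first.
    by move=> i _; rewrite mul1e.
  rewrite -ge0_sume_distrl// sumEFin sumr_const card_ord muleA -EFinM.
  by rewrite mulVf ?mul1e// gt_eqF.
- split=> [|x]; rewrite [LHS]pavgE.
    rewrite (eq_bigr (fun=> 1%E)); last first.
      move=> i _; rewrite nuE; have [_ s] := nu0P i.
      by have [] := spread_nonatomic dl0 s.
    by rewrite sumEFin sumr_const card_ord -EFinM mulVf// gt_eqF.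
  rewrite big1 ?mule0// => i _; rewrite nuE; have [_ s] := nu0P i.
  by have [] := spread_nonatomic dl0 s.
- rewrite /posenergy integral_pavg; last 2 first.
  + by move=> u; rewrite lee_fin pot_ge0.
  + by apply: measurable_EFin_comp; exact: measurable_pot.
  rewrite mutual_pavg.
  pose near (i j : 'I_n.+1) := nearby (K * dl) (tnth z i) (tnth z j).
  apply: (@le_trans _ _ ((N^-1)%:E *
      (\sum_(i < n.+1) (pot W BW (tnth z i) + e / 4))%:E + (N^-1 ^+ 2)%:E *
      (\sum_(i < n.+1) ((ln (R0 / dl) + 8) + \sum_(j < n.+1 | j != i)
        (logker R0 (tnth z i) (tnth z j) + 4 / K +
          near i j * (8 + ln K))))%:E)%E).
    apply: leeD.
      rewrite lee_wpmul2l ?lee_fin ?invr_ge0 ?(ltW N_gt0)// -sumEFin.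
      apply: lee_sum => i _; rewrite nuE; have [_ [s1 _]] := nu0P i.
      apply: (integral_near_le s1).
      + exact: measurable_pot.
      + exact: pot_ge0.
      + by rewrite addr_ge0 ?pot_ge0// ltW.
      + by move=> u Du /= uz; apply: pP => //; exact: le_trans dld1.
    rewrite lee_wpmul2l ?lee_fin ?sqr_ge0// -sumEFin.
    apply: lee_sum => i _; rewrite nuE (bigD1 i)//= nuE EFinD; apply: leeD.
      by apply: (mutual_spread_le mD R01 DR0 dl0 dl1) (nu0P i).2 (nu0P i).2.
    rewrite -sumEFin; apply: lee_sum => j ji; rewrite nuE.
    rewrite /near /nearby; case: (leP (cabs _) (K * dl)) => hd; last first.
      rewrite mul0r addr0.
      exact: (mutual_spread_far mD R01 DR0 dl0 K4 (Dz i) (Dz j) hd (nu0P i).2 (nu0P j).2).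
    apply: le_trans (mutual_spread_le mD R01 DR0 dl0 dl1 (nu0P i).2 (nu0P j).2) _.
    have c0 : 0 < cabs (tnth z i - tnth z j).
      rewrite lt_def cabs_ge0 cabs_eq0 subr_eq0 andbT.
      by apply: contra ji => /eqP /zI ->.
    rewrite lee_fin logkerE ?c0 ?DR0// mul1r.
    have : ln (R0 / dl) <= ln (R0 / cabs (tnth z i - tnth z j)) + ln K.
      rewrite -lnM ?posrE ?divr_gt0// ler_ln ?posrE ?mulr_gt0 ?divr_gt0 ?invr_gt0//.
      rewrite -mulrA ler_wpM2l ?(ltW R00)// ler_pdivlMl//.
      by rewrite ler_pdivrMr.
    have : 0 <= 4 / K by rewrite divr_ge0// ltW.
    lra.
  rewrite -!EFinM -EFinD lee_fin.
  have nearP := near_pairs Dz zI Kdl KdlR hz.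
  set S1 := \sum_(i < n.+1) pot W BW (tnth z i).
  set S2 := \sum_(i < n.+1) \sum_(j < n.+1 | j != i)
    logker R0 (tnth z i) (tnth z j).
  set S3 := \sum_(i < n.+1) \sum_(j < n.+1 | j != i) near i j.
  have hS3 : S3 <= N ^+ 2 * C / ln (R0 / (K * dl)) by [].
  have -> : hamiltonian z = N * S1 + S2 by [].
  have -> : \sum_(i < n.+1) (pot W BW (tnth z i) + e / 4) = S1 + N * (e / 4).
    by rewrite big_split/= sumC.
  have cnt : \sum_(i < n.+1) \sum_(j < n.+1 | j != i) (4 / K) <= N ^+ 2 * (4 / K).
    apply: (@le_trans _ _ (\sum_(i < n.+1) \sum_(j < n.+1) (4 / K))).
      apply: ler_sum => i _; rewrite [leRHS](bigD1 i)//= lerDr divr_ge0//.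
      exact: ltW.
    by rewrite !sumC mulrA -expr2.
  have -> : \sum_(i < n.+1) ((ln (R0 / dl) + 8) + \sum_(j < n.+1 | j != i)
      (logker R0 (tnth z i) (tnth z j) + 4 / K + near i j * (8 + ln K))) =
      N * (ln (R0 / dl) + 8) + (S2 +
      \sum_(i < n.+1) \sum_(j < n.+1 | j != i) (4 / K) + S3 * (8 + ln K)).
    rewrite big_split/= sumC; congr (_ + _).
    rewrite mulr_suml -!big_split/=; apply: eq_bigr => i _.
    by rewrite mulr_suml -!big_split.
  have h3 : S3 * (8 + ln K) <= N ^+ 2 * (e / 4).
    apply: (@le_trans _ _ (N ^+ 2 * C / ln (R0 / (K * dl)) * (8 + ln K))).
      by rewrite ler_wpM2r// addr_ge0.
    have l0 : 0 < ln (R0 / (K * dl)) by apply: lt_le_trans lKdl.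
    rewrite [leLHS](_ : _ = N ^+ 2 * (C * (8 + ln K) / ln (R0 / (K * dl)))); last first.
      by rewrite mulrAC -!mulrA.
    rewrite ler_wpM2l ?sqr_ge0// ler_pdivrMr//.
    apply: (@le_trans _ _ (e / 4 * T)); last by rewrite ler_wpM2l// ltW.
    have -> : e / 4 * T = C * (8 + ln K) + e / 4.
      by rewrite /T; field; rewrite gt_eqF.
    by rewrite lerDl ltW.
  have iN2 : 0 < N^-1 ^+ 2 by rewrite exprn_gt0// invr_gt0.
  have -> : (N * S1 + S2) / N ^+ 2 + e = N^-1 * (S1 + N * (e / 4)) + N^-1 ^+ 2 *
      (S2 + N ^+ 2 * (3 / 4 * e)).
    by field; rewrite gt_eqF.
  rewrite lerD2l ler_pM2l//.
  have h4 : N * (ln (R0 / dl) + 8) <= N ^+ 2 * (e / 4).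
    move: hN; rewrite ler_pdivrMr// => h.
    rewrite [leRHS](_ : _ = N * (e / 4 * N)); last by rewrite expr2; ring.
    by rewrite ler_wpM2l// ltW.
  have h5 : N ^+ 2 * (4 / K) <= N ^+ 2 * (e / 4) by rewrite ler_wpM2l ?sqr_ge0.
  have -> : N ^+ 2 * (3 / 4 * e) = N ^+ 2 * (e / 4) + N ^+ 2 * (e / 4) + N ^+ 2 * (e / 4).
    by field.
  lra.
move=> f L mf f0 L0 fL; rewrite integral_pavg; last 2 first.
- by move=> u; rewrite lee_fin.
- exact: measurable_EFin_comp.
have Ldl : L * dl <= L * e by rewrite ler_wpM2l.
split.
  apply: (@le_trans _ _ ((N^-1)%:E * (\sum_(i < n.+1) (f (tnth z i) + L * e))%:E)%E).
    rewrite lee_wpmul2l ?lee_fin ?invr_ge0 ?(ltW N_gt0)// -sumEFin.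
    apply: lee_sum => i _; rewrite nuE; have [_ [s1 _]] := nu0P i.
    apply: (integral_near_le s1) => //.
      by rewrite addr_ge0// mulr_ge0// ltW.
    move=> u Du /= uz; apply: (le_trans (fL u (tnth z i))); rewrite lerD2l.
    by rewrite ler_wpM2l// (le_trans uz).
  rewrite -EFinM lee_fin big_split/= sumC mulrDr.
  by rewrite [X in _ + X]mulrA mulVf ?mul1r// gt_eqF.
have i0 : (0 <= \sum_(i < n.+1) \int[nu i]_x (f x)%:E)%E.
  by apply: sume_ge0 => i _; apply: integral_ge0 => x _; rewrite lee_fin.
have -> : ((L * e)%:E = (N^-1)%:E * \sum_(i < n.+1) (L * e)%:E)%E.
  rewrite sumEFin sumC -EFinM mulrA mulVf ?mul1r//.
  by rewrite gt_eqF.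
rewrite -ge0_muleDr//; last first.
  by apply: sume_ge0 => i _; rewrite lee_fin mulr_ge0// ltW.
rewrite EFinM lee_wpmul2l ?lee_fin ?invr_ge0 ?(ltW N_gt0)//.
rewrite -big_split/= -sumEFin; apply: lee_sum => i _; rewrite nuE.
have [_ [s1 _]] := nu0P i.
have mfe : measurable_fun [set: R * R] (fun u => f u + L * e).
  exact: measurable_funD.
have -> : (\int[nu0 i]_x (f x)%:E + (L * e)%:E = \int[nu0 i]_x (f x + L * e)%:E)%E.
  rewrite -[X in (_ + X)%E](integral_cst1 _ (probability_setT (nu0 i))).
  rewrite -ge0_integralD//.
  - by move=> x _; rewrite lee_fin.
  - exact: measurable_EFin_comp.
  - by move=> x _; rewrite lee_fin mulr_ge0// ltW.
apply: (integral_near_ge s1) => //.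
  by move=> u; rewrite addr_ge0// mulr_ge0// ltW.
move=> u Du /= uz; apply: (le_trans (fL (tnth z i) u)); rewrite lerD2l.
by rewrite ler_wpM2l// (le_trans _ dle)// cabsB.
Qed.

End Configurations.

(** * Gibbs measures and the law of large numbers *)

Section PowProbability.
Context d (T : measurableType d) (R : realType) (P : probability T R) (n : nat).

Definition powprob : set (n.-tuple T) -> \bar R := measure_pow P n.

HB.instance Definition _ := Measure.on powprob.

HB.instance Definition _ :=
  Measure_isProbability.Build _ _ _ powprob (measure_pow_prob1 P n).

End PowProbability.
Arguments powprob {d T R} P n.

Section GibbsGas.
Context {R : realType}.
Variables (D : set (R * R)) (W : R * R -> R) (R0 BW : R).
Hypotheses (mD : measurable D) (R01 : 1 <= R0) (BW0 : 0 <= BW).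
Hypothesis DR0 : forall z w, D z -> D w -> cabs (z - w) <= R0.
Hypothesis WB : forall z, D z -> 0 <= W z + BW.
Hypothesis mW : measurable_fun [set: R * R] W.
Variables (B : R) (sigma : probability (R * R)%type R).
Hypothesis potB : forall z, D z -> pot W BW z <= B.
Hypothesis hsigma : is_equilibrium_measure D W sigma.
Hypothesis potC : forall e, 0 < e -> exists2 dl, 0 < dl &
  forall z w, D z -> D w -> cabs (z - w) <= dl -> pot W BW z <= pot W BW w + e.
Variable rho : {finite_measure set (R * R)%type -> \bar R}.
Hypothesis spreadP : exists2 d0, 0 < d0 & forall delta z0, D z0 ->
  0 < delta -> delta <= d0 ->
  exists2 nu, dominated rho nu & spread D delta z0 nu.
Implicit Types (nu mu P : probability (R * R)%type R).

Local Notation pos := (posenergy W R0 BW).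
Local Notation ham := (hamiltonian W R0 BW).

Let R00 : 0 < R0. Proof. exact: lt_le_trans R01. Qed.
Let mpot : measurable_fun [set: R * R] (pot W BW).
Proof. exact: measurable_pot. Qed.

Lemma posenergy_ge0 mu : (0 <= pos mu)%E.
Proof.
rewrite adde_ge0 ?mutual_ge0// integral_ge0// => z _.
by rewrite lee_fin pot_ge0.
Qed.

(** A measure satisfying a Frostman estimate has finite energy. *)
Lemma posenergy_sigma_lty : (pos sigma < +oo)%E.
Proof.
have [[s1 s2] _] := hsigma.
have [z0 Dz0] : D !=set0.
  apply/set0P/eqP => D0; move: s1; rewrite D0 measure0 => /eqP.
  by rewrite eq_sym onee_eq0.
have [d0 d00 /(_ (Num.min 1 d0) z0 Dz0)] := spreadP.
have d1 : 0 < Num.min 1 d0 by rewrite lt_min d00 ltr01.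
rewrite ge_min lexx orbT => /(_ d1 isT) [nu _ snu].
have nnu := spread_nonatomic mD d1 snu.
apply: le_lt_trans (posenergy_min mD R01 BW0 DR0 WB mW potB hsigma nnu) _.
rewrite /posenergy lte_add_pinfty//.
  rewrite -ge0_fin_numE; first exact: (pot_fin mD mW potB nnu.1).
  by apply: integral_ge0 => z _; rewrite lee_fin pot_ge0.
apply: le_lt_trans (mutual_spread_le mD R01 DR0 d1 _ snu snu) _.
  by rewrite ge_min lexx.
by rewrite ltry.
Qed.

Definition eqenergy : R := fine (pos sigma).

Lemma eqenergyE : pos sigma = eqenergy%:E.
Proof. by rewrite fineK// ge0_fin_numE ?posenergy_ge0// posenergy_sigma_lty. Qed.

Lemma eqenergy_ge0 : 0 <= eqenergy.
Proof. by rewrite fine_ge0// posenergy_ge0. Qed.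

(** Functions to which [mutual_close] applies: Lipschitz and square integrable. *)
Definition testfun (f : R * R -> R) : Prop :=
  [/\ measurable_fun [set: R * R] f, (forall u, 0 <= f u <= 1),
      exists2 L, 0 <= L & forall u v, f u <= f v + L * cabs (u - v) &
      exists2 A, 0 <= A &
        (\int[sprod lebesgue_measure lebesgue_measure]_u (f u ^+ 2)%:E <= A%:E)%E].

(** By convexity the excess of the energy over its minimum controls the
    logarithmic distance to the minimizer. *)
Lemma energy_stability f e : testfun f -> 0 < e ->
  exists2 eta, 0 < eta & forall mu, nonatomic_on D mu ->
    (pos mu <= (eqenergy + eta)%:E)%E ->
    (\int[mu]_z (f z)%:E <= \int[sigma]_z (f z)%:E + e%:E)%E /\
    (\int[sigma]_z (f z)%:E <= \int[mu]_z (f z)%:E + e%:E)%E.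
Proof.
move=> [mf f01 [L L0 fL] [A A0 fA]] e0.
have f0 u : 0 <= f u by case/andP: (f01 u).
have [eta eta0 H] := mutual_close mf f0 L0 fL mD R00 DR0 A0 fA e0.
exists eta => // mu nmu hmu; have [ns _] := hsigma.
have [h1 h2] := posenergy_midpoint mD R01 BW0 DR0 WB mW potB hsigma nmu
  posenergy_sigma_lty (eta := eta) ltac:(by rewrite eqenergyE -EFinD).
split; first exact: H nmu.1 ns.1 nmu.2 ns.2 h1 h2.
apply: H ns.1 nmu.1 ns.2 nmu.2 _ _; first by rewrite mutualC.
by rewrite addeC [mutual R0 sigma mu]mutualC.
Qed.

Definition admissible N : set (N.-tuple (R * R)) :=
  cube D N `&` [set z | injective (tnth z)].
Arguments admissible N : clear implicits.

Lemma measurable_cubeD N : measurable (cube D N).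
Proof. exact: (measurable_cube_gen (fun=> mD)). Qed.

Lemma measurable_distinct N :
  measurable [set z : N.-tuple (R * R) | injective (tnth z)].
Proof.
rewrite (_ : mkset _ = \bigcap_(p in [set: 'I_N * 'I_N])
   [set z | p.1 = p.2 \/ cabs (tnth z p.1 - tnth z p.2) != 0]).
  apply: fin_bigcap_measurable => //= -[i j] _ /=.
  have [->|ij] := eqVneq i j.
    by rewrite (_ : mkset _ = setT)//; apply/seteqP; split => // z _; left.
  rewrite (_ : mkset _ = (fun z : N.-tuple (R * R) =>
      cabs (tnth z i - tnth z j)) @^-1` (~` [set 0])); last first.
    apply/seteqP; split => z /=; first by case=> [/eqP|/eqP//]; rewrite (negbTE ij).
    by move/eqP; right.
  rewrite -[X in measurable X]setTI.
  suff mc : measurable_fun setT (fun z : N.-tuple (R * R) =>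
    cabs (tnth z i - tnth z j)) by apply: mc => //; exact: measurableC.
  have mt : measurable_fun [set: N.-tuple (R * R)] (fun t => (tnth t i, tnth t j)).
    by apply/measurable_fun_pairP; split; exact: measurable_tnth.
  exact: (measurableT_comp measurable_cabsB mt).
apply/seteqP; split => z /=.
  move=> zI [i j] _ /=; have [->|ij] := eqVneq i j; [by left|right].
  by rewrite cabs_eq0 subr_eq0; apply: contra ij => /eqP /zI ->.
move=> zI i j zij; have [//|/=] := zI (i, j) I.
by rewrite zij subrr cabs0 eqxx.
Qed.

Lemma measurable_admissible N : measurable (admissible N).
Proof.
by apply: measurableI; [exact: measurable_cubeD|exact: measurable_distinct].
Qed.

Let mlog N (i j : 'I_N) : measurable_fun [set: N.-tuple (R * R)]
  (fun z => logker R0 (tnth z i) (tnth z j)).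
Proof.
have mt : measurable_fun [set: N.-tuple (R * R)] (fun t => (tnth t i, tnth t j)).
  by apply/measurable_fun_pairP; split; exact: measurable_tnth.
exact: (measurableT_comp (measurable_logker R0) mt).
Qed.

Let mpoti N (i : 'I_N) : measurable_fun [set: N.-tuple (R * R)]
  (fun z => pot W BW (tnth z i)).
Proof. by apply: measurableT_comp => //; exact: measurable_tnth. Qed.

Lemma measurable_hamiltonian N : measurable_fun [set: N.-tuple (R * R)] (@ham N).
Proof.
apply: measurable_funD.
  by apply: measurable_funM => //; apply: measurable_sum => i; exact: mpoti.
apply: measurable_sum => i; under eq_fun do rewrite big_mkcond/=.
by apply: measurable_sum => j /=; case: (j != i) => //; exact: mlog.
Qed.

(** By the theorem of Fubini, the diagonal in two coordinates has as measure the
    mean mass of a point, which is 0. *)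
Lemma pow_admissible N mu : nonatomic_on D mu ->
  (measure_pow mu N (admissible N) = 1)%E.
Proof.
move=> [m1 m0]; have mc := @measurable_cubeD N; have md := @measurable_distinct N.
pose P : probability _ R := powprob mu N.
have -> : measure_pow mu N (admissible N) = P (admissible N) by [].
have c1 : P (cube D N) = 1%E.
  rewrite [LHS](@measure_powE _ _ _ mu N (fun=> D))//.
  exact: big1.
pose g (x y : R * R) : R := \1_[set 0] (cabs (x - y)).
have g0 x y : (0 <= (g x y)%:E)%E by rewrite lee_fin.
have mg : measurable_fun [set: (R * R) * (R * R)] (fun p => (g p.1 p.2)%:E).
  apply: measurable_EFin_comp; apply: measurableT_comp; last exact: measurable_cabsB.
  exact: measurable_indic.
have mgij (i j : 'I_N) : measurable_fun [set: N.-tuple (R * R)]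
    (fun z => (g (tnth z i) (tnth z j))%:E).
  have mt : measurable_fun [set: N.-tuple (R * R)] (fun t => (tnth t i, tnth t j)).
    by apply/measurable_fun_pairP; split; exact: measurable_tnth.
  exact: (measurableT_comp mg mt).
have gij (i j : 'I_N) : i != j ->
    (\int[measure_pow mu N]_z (g (tnth z i) (tnth z j))%:E = 0)%E.
  move=> ij; rewrite (integral_pow_tnth2 mu (f := fun x y => (g x y)%:E) ij g0 mg).
  apply: integral0_eq => x _.
  rewrite (_ : (fun y => (g x y)%:E) = (fun y => (\1_[set x] y)%:E)).
    by rewrite integral_indic//; [rewrite setIT; exact: m0|exact: measurable_point].
  apply/funext => y; rewrite /g !indicE; congr (_%:R%:E).
  congr nat_of_bool; apply/idP/idP; rewrite !inE/=.
    by move/eqP; rewrite cabs_eq0 subr_eq0 => /eqP.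
  by move=> ->; rewrite subrr cabs0.
have d0 : P (~` [set z | injective (tnth z)]) = 0%E.
  apply/eqP; rewrite eq_le measure_ge0 andbT.
  rewrite -[X in P X]setIT -integral_indic//; last exact: measurableC.
  apply: (@le_trans _ _ (\int[P]_z
    (\sum_(i < N) \sum_(j < N | i != j) (g (tnth z i) (tnth z j))%:E))%E).
    apply: ge0_le_integral => //.
    - by apply: measurable_EFin_comp; apply: measurable_indic; exact: measurableC.
    - apply: emeasurable_sum => i; under eq_fun do rewrite big_mkcond/=.
      by apply: emeasurable_sum => j /=; case: (i != j) => //; exact: mgij.
    - move=> z _; rewrite indicE; case: (boolP (z \in _)); last first.
        by move=> _; apply: sume_ge0 => i _; apply: sume_ge0.
      rewrite inE/= => /existsNP[i /existsNP[j /not_implyP[zij /eqP ij]]].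
      rewrite (bigD1 i)//= (bigD1 j)//= zij {1}/g subrr cabs0 indicE mem_set//.
      rewrite -addeA; apply: leeDl; apply: adde_ge0.
        by apply: sume_ge0 => l _.
      by apply: sume_ge0 => l _; apply: sume_ge0.
  rewrite ge0_integral_sum//; last 2 first.
  - move=> i; under eq_fun do rewrite big_mkcond/=.
    by apply: emeasurable_sum => j /=; case: (i != j) => //; exact: mgij.
  - by move=> i z _; apply: sume_ge0.
  rewrite big1// => i _; under eq_integral do rewrite big_mkcond/=.
  rewrite ge0_integral_sum//.
  - rewrite big1// => j _; case: (boolP (i != j)) => ij; first exact: gij.
    exact: integral0.
  - by move=> j; case: (i != j) => //; exact: mgij.
  - by move=> j z _; case: ifP.
apply/eqP; rewrite eq_le probability_le1 ?andTb; last exact: measurable_admissible.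
rewrite -c1 -[leRHS]adde0 -d0.
apply: (@le_trans _ _ (P (admissible N `|` ~` [set z | injective (tnth z)]))).
  rewrite le_measure ?inE//.
    apply: measurableU; [exact: measurable_admissible|exact: measurableC].
  move=> z cz; have [zI|zI] := pselect (injective (tnth z)); first by left; split.
  by right.
apply: measureU2; [exact: measurable_admissible|exact: measurableC].
Qed.

(** The indicator is there because [logker] is finite on the diagonal, whereas
    coinciding points must have weight 0. *)
Definition boltzmann N (z : N.-tuple (R * R)) : R :=
  \1_(admissible N) z * expR (- ham z).

Lemma boltzmann_ge0 N (z : N.-tuple (R * R)) : 0 <= boltzmann z.
Proof. by rewrite mulr_ge0 ?expR_ge0. Qed.

Lemma boltzmannE N (z : N.-tuple (R * R)) : admissible N z ->
  boltzmann z = expR (- ham z).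
Proof. by move=> az; rewrite /boltzmann indicE mem_set// mul1r. Qed.

Lemma measurable_boltzmann N : measurable_fun [set: N.-tuple (R * R)] (@boltzmann N).
Proof.
apply: measurable_funM.
  by apply: measurable_indic; exact: measurable_admissible.
apply: measurableT_comp => //; apply: measurableT_comp => //.
exact: measurable_hamiltonian.
Qed.

(** An inequality only, because the hamiltonian omits the [N] diagonal terms. *)
Lemma mean_hamiltonian N mu :
  (\int[measure_pow mu N]_z (ham z)%:E <= (N%:R ^+ 2)%:E * pos mu)%E.
Proof.
have p0 z : (0 <= (pot W BW z)%:E)%E by rewrite lee_fin pot_ge0.
have l0 z w : (0 <= (logker R0 z w)%:E)%E by rewrite lee_fin logker_ge0.
have mpE : measurable_fun [set: R * R] (fun z => (pot W BW z)%:E).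
  exact: measurable_EFin_comp.
have mlE N' (i j : 'I_N') := measurable_EFin_comp (@mlog N' i j).
have mpiE N' (i : 'I_N') := measurable_EFin_comp (@mpoti N' i).
have mml : measurable_fun [set: (R * R) * (R * R)]
    (fun p => (logker R0 p.1 p.2)%:E).
  by apply: measurable_EFin_comp; exact: measurable_logker.
have -> : (\int[measure_pow mu N]_z (ham z)%:E =
  \int[measure_pow mu N]_z (N%:R%:E * \sum_(i < N) (pot W BW (tnth z i))%:E) +
  \int[measure_pow mu N]_z \sum_(i < N) \sum_(j < N)
     if j != i then (logker R0 (tnth z i) (tnth z j))%:E else 0)%E.
  rewrite -ge0_integralD//.
  - apply: eq_integral => z _; rewrite /hamiltonian EFinD EFinM !sumEFin.
    congr (_ + _)%E; rewrite -sumEFin; apply: eq_bigr => i _.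
    by rewrite -sumEFin big_mkcond.
  - by move=> z _; rewrite mule_ge0 ?lee_fin// sume_ge0.
  - apply: emeasurable_funM => //; apply: emeasurable_sum => i; exact: mpiE.
  - move=> z _; apply: sume_ge0 => i _; apply: sume_ge0 => j _.
    by case: ifP.
  - apply: emeasurable_sum => i; apply: emeasurable_sum => j.
    by case: (j != i) => //; exact: mlE.
rewrite /posenergy ge0_muleDr ?mutual_ge0//; last exact: integral_ge0.
apply: leeD.
  rewrite ge0_integralZl//; last 2 first.
  - apply: emeasurable_sum => i; exact: mpiE.
  - by move=> z _; apply: sume_ge0.
  rewrite expr2 EFinM -muleA lee_wpmul2l ?lee_fin//.
  rewrite ge0_integral_sum; [|by []|by move=> i; exact: mpiE|by move=> i z _; exact: p0].
  rewrite (eq_bigr (fun=> 1%:E * \int[mu]_z (pot W BW z)%:E)%E); last first.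
    by move=> i _; rewrite mul1e (integral_pow_tnth mu i p0 mpE).
  rewrite -ge0_sume_distrl// sumEFin sumr_const card_ord.
  by [].
rewrite ge0_integral_sum//; last 2 first.
- move=> i; apply: emeasurable_sum => j.
  by case: (j != i) => //; exact: mlE.
- by move=> i z _; apply: sume_ge0 => j _; case: ifP.
apply: (@le_trans _ _ (\sum_(i < N) \sum_(j < N) 1%:E * mutual R0 mu mu)%E).
  apply: lee_sum => i _; rewrite ge0_integral_sum//; last 2 first.
  - by move=> j; case: (j != i) => //; exact: mlE.
  - by move=> j z _; case: ifP.
  apply: lee_sum => j _; rewrite mul1e; case: (eqVneq j i) => ij.
    by rewrite integral0 mutual_ge0.
  by rewrite (integral_pow_tnth2 mu (f := fun x y => (logker R0 x y)%:E)) 1?eq_sym.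
rewrite le_eqVlt; apply/orP; left; apply/eqP.
rewrite (eq_bigr (fun=> N%:R%:E * mutual R0 mu mu)%E); last first.
  move=> i _; rewrite -ge0_sume_distrl// sumEFin sumr_const card_ord.
  by [].
rewrite -ge0_sume_distrl// sumEFin sumr_const card_ord.
by congr (_%:E * _)%E; rewrite expr2 mulr_natl.
Qed.

Lemma pow_full N mu : nonatomic_on D mu ->
  (powprob mu N (~` admissible N) = 0)%E.
Proof.
move=> nmu; apply: prob_setC0.
  exact: measurable_admissible.
exact: pow_admissible.
Qed.

(** Jensen's inequality for the exponential, by the tangent line at the mean. *)
Lemma mean_boltzmann N mu (J : R) : nonatomic_on D mu -> (pos mu <= J%:E)%E ->
  ((expR (- (N%:R ^+ 2 * J)))%:E <= \int[measure_pow mu N]_z (boltzmann z)%:E)%E.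
Proof.
move=> nmu hJ; set c := N%:R ^+ 2 * J; set P := powprob mu N.
have J0 : 0 <= J by rewrite -lee_fin (le_trans _ hJ)// posenergy_ge0.
have c0 : 0 <= c by rewrite mulr_ge0// sqr_ge0.
have mh := @measurable_hamiltonian N; have mb := @measurable_boltzmann N.
have hE : (\int[P]_z (ham z)%:E <= c%:E)%E.
  have -> : (c%:E = (N%:R ^+ 2)%:E * J%:E)%E by rewrite -EFinM.
  apply: (le_trans (@mean_hamiltonian N mu)); by rewrite lee_wpmul2l.
have h0 (z : N.-tuple (R * R)) : 0 <= ham z by exact: hamiltonian_ge0.
have key : ((expR (- c) * (1 + c))%:E <=
    \int[P]_z (boltzmann z)%:E + (expR (- c))%:E * \int[P]_z (ham z)%:E)%E.
  rewrite -ge0_integralZl//; last 2 first.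
  - exact: measurable_EFin_comp.
  - by move=> z _; rewrite lee_fin.
  rewrite -ge0_integralD//; last 4 first.
  - by move=> z _; rewrite lee_fin boltzmann_ge0.
  - exact: measurable_EFin_comp.
  - by move=> z _; rewrite -EFinM lee_fin mulr_ge0 ?expR_ge0.
  - by apply: measurable_EFin_comp; exact: measurable_funM.
  rewrite -[leLHS](integral_cst1 _ (probability_setT P)).
  have mA := @measurable_admissible N; have A0 := pow_full N nmu.
  rewrite (ge0_integral_full mA A0)//; last first.
    by move=> z; rewrite lee_fin mulr_ge0 ?expR_ge0// addr_ge0.
  rewrite [leRHS](ge0_integral_full mA A0)//; last 2 first.
  - by move=> z; rewrite -EFinM -EFinD lee_fin addr_ge0 ?mulr_ge0 ?boltzmann_ge0 ?expR_ge0.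
  - apply: measurable_EFin_comp; apply: measurable_funD => //.
    exact: measurable_funM.
  apply: ge0_le_integral => //.
  - by move=> z _; rewrite lee_fin mulr_ge0 ?expR_ge0// addr_ge0.
  - apply: measurable_funTS; apply: measurable_EFin_comp; apply: measurable_funD => //.
    exact: measurable_funM.
  - move=> z az; rewrite -EFinM -EFinD lee_fin boltzmannE//.
    have -> : expR (- ham z) = expR (- c) * expR (c - ham z).
      by rewrite -expRD; congr expR; ring.
    rewrite -mulrDr ler_wpM2l ?expR_ge0//.
    have := expR_ge1Dx (c - ham z); lra.
have fin : (\int[P]_z (ham z)%:E)%E \is a fin_num.
  rewrite ge0_fin_numE ?(le_lt_trans hE) ?ltry//.
  by apply: integral_ge0 => z _; rewrite lee_fin.
move: key hE; rewrite -[in X in (_ <= X -> _)%E](fineK fin) -[in X in (_ -> X <= _ -> _)%E](fineK fin).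
set h := fine _; rewrite lee_fin => key hc.
have : ((expR (- c) * (1 + c))%:E <=
    \int[P]_z (boltzmann z)%:E + (expR (- c))%:E * c%:E)%E.
  by apply: (le_trans key); rewrite leeD2l// -!EFinM lee_fin ler_wpM2l ?expR_ge0.
rewrite -EFinM mulrDr mulr1 EFinD leeD2rE//.
Qed.

(** Otherwise the mean energy of independent points would be larger. *)
Lemma exists_configuration N mu (J e : R) : (0 < N)%N -> 0 < e ->
  nonatomic_on D mu -> (pos mu <= J%:E)%E ->
  exists2 z, admissible N z & ham z <= N%:R ^+ 2 * (J + e).
Proof.
move=> N0 e0 nmu hJ; apply: contrapT => hn.
have N20 : (0 : R) < N%:R ^+ 2 by rewrite exprn_gt0// ltr0n.
have J0 : 0 <= J by rewrite -lee_fin (le_trans _ hJ)// posenergy_ge0.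
have mh := @measurable_hamiltonian N.
have hz z : admissible N z -> N%:R ^+ 2 * (J + e) <= ham z.
  by move=> az; rewrite leNgt; apply/negP => h; apply: hn; exists z => //; exact: ltW.
have h0 (z : N.-tuple (R * R)) : 0 <= ham z by exact: hamiltonian_ge0.
have mA := @measurable_admissible N; have A0 := pow_full N nmu.
have : ((N%:R ^+ 2 * (J + e))%:E <= \int[powprob mu N]_z (ham z)%:E)%E.
  rewrite -[leLHS](integral_cst1 _ (probability_setT (powprob mu N))).
  have c0 : 0 <= N%:R ^+ 2 * (J + e) by rewrite mulr_ge0 ?sqr_ge0// addr_ge0// ltW.
  rewrite (ge0_integral_full mA A0)//.
  rewrite [leRHS](ge0_integral_full mA A0)//; last exact: measurable_EFin_comp.
  apply: ge0_le_integral => //.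
  by apply: measurable_funTS; exact: measurable_EFin_comp.
apply/negP; rewrite -ltNge.
apply: le_lt_trans (@mean_hamiltonian N mu) _.
apply: (@le_lt_trans _ _ ((N%:R ^+ 2)%:E * J%:E)%E).
  by rewrite lee_wpmul2l ?lee_fin ?sqr_ge0.
by rewrite -EFinM lte_fin ltr_pM2l// ltrDl.
Qed.

(** The normalizing constant is the one given by the total mass; see [gibbs_cst]. *)
Definition gibbs N (P : probability (N.-tuple (R * R)) R) : Prop :=
  exists c : R, forall A, measurable A ->
    (P A = c%:E * \int[measure_pow rho N]_(z in A) (boltzmann z)%:E)%E.

(** The inequality of Jensen is applied to the powers of one smeared configuration
    of nearly minimal energy. As it is dominated by [rho], passing to the powers
    of [rho] only costs a factor [M ^ N]. *)
Lemma partition_lower e : 0 < e -> exists2 M, 0 <= M & forall N,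
  ((expR (- (N%:R ^+ 2 * (eqenergy + e))))%:E <=
   (M ^+ N)%:E * \int[measure_pow rho N]_z (boltzmann z)%:E)%E.
Proof.
move=> e0; have E0 := eqenergy_ge0; have [ns _] := hsigma.
have e20 : 0 < e / 2 by rewrite divr_gt0.
have [n H] := spread_configuration mD R01 DR0 mW potC spreadP
  (addr_ge0 E0 ler01) e20.
pose e1 := Num.min 1 (e / 2).
have e10 : 0 < e1 by rewrite lt_min ltr01.
have hs : (pos sigma <= eqenergy%:E)%E by rewrite eqenergyE.
have [z [Dz zI] hz] := exists_configuration (ltn0Sn n) e10 ns hs.
have n20 : (0 : R) < n.+1%:R ^+ 2 by rewrite exprn_gt0// ltr0n.
have [|mu [[M M0 rM] nmu hmu _]] := H n z (leqnn n) Dz zI.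
  by apply: (le_trans hz); rewrite ler_pM2l// lerD2l ge_min lexx.
have hJ : (pos mu <= (eqenergy + e)%:E)%E.
  apply: (le_trans hmu); rewrite lee_fin.
  have : ham z / n.+1%:R ^+ 2 <= eqenergy + e / 2.
    rewrite ler_pdivrMr// mulrC (le_trans hz)// ler_pM2l// lerD2l.
    by rewrite ge_min lexx orbT.
  by move: (ham z / _) => q; lra.
exists M => // N; apply: (le_trans (mean_boltzmann N nmu hJ)).
apply: le_integral_pow => //.
- by move=> t; rewrite lee_fin boltzmann_ge0.
- by apply: measurable_EFin_comp; exact: measurable_boltzmann.
Qed.

Lemma boltzmann_le1 N (z : N.-tuple (R * R)) : boltzmann z <= 1.
Proof.
rewrite /boltzmann indicE; case: (z \in _); rewrite ?mul0r ?ler01// mul1r.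
by rewrite expR_le1 oppr_le0 hamiltonian_ge0.
Qed.

Let mass : R := fine (rho setT).
Let massE N : (measure_pow rho N setT = (mass ^+ N)%:E)%E.
Proof. by rewrite measure_pow_setT EFin_expe /mass fineK// fin_num_measure. Qed.
Let mass0 : 0 <= mass. Proof. by rewrite fine_ge0. Qed.

Let mbE N : measurable_fun [set: N.-tuple (R * R)] (fun z => (boltzmann z)%:E).
Proof. by apply: measurable_EFin_comp; exact: measurable_boltzmann. Qed.

Let b0E N (z : N.-tuple (R * R)) : (0 <= (boltzmann z)%:E)%E.
Proof. by rewrite lee_fin boltzmann_ge0. Qed.

Lemma gibbs_cst N (P : probability (N.-tuple (R * R)) R) : gibbs P ->
  exists c Z : R, [/\ 0 < c,
    (\int[measure_pow rho N]_z (boltzmann z)%:E = Z%:E)%E, c * Z = 1 &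
    forall A, measurable A ->
    (P A = c%:E * \int[measure_pow rho N]_(z in A) (boltzmann z)%:E)%E].
Proof.
move=> [c cP]; set I := (\int[measure_pow rho N]_z (boltzmann z)%:E)%E.
have I0 : (0 <= I)%E by exact: integral_ge0.
have Ifin : I \is a fin_num.
  rewrite ge0_fin_numE// (@le_lt_trans _ _ (mass ^+ N)%:E) ?ltry//.
  rewrite -massE -[leRHS]mul1e -integral_cst//.
  apply: ge0_le_integral => //; first exact: mbE.
  by move=> z _; rewrite lee_fin boltzmann_le1.
have := cP setT measurableT; rewrite -/I -(fineK Ifin) => cZ.
have {}cZ : c * fine I = 1.
  apply/EFin_inj; rewrite EFinM -cZ; exact: probability_setT.
exists c, (fine I); split=> //.
rewrite ltNge; apply/negP => c0.
have : c * fine I <= 0 by rewrite mulr_le0_ge0// fine_ge0.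
by rewrite cZ ler10.
Qed.

Definition typical N (eta : R) : set (N.-tuple (R * R)) :=
  admissible N `&` [set z | ham z <= N%:R ^+ 2 * (eqenergy + eta)].
Arguments typical N eta : clear implicits.

Lemma measurable_typical N eta : measurable (typical N eta).
Proof.
apply: measurableI; first exact: measurable_admissible.
rewrite (_ : mkset _ = @ham N @^-1` `]-oo, N%:R ^+ 2 * (eqenergy + eta)]); last first.
  by apply/seteqP; split => z /=; rewrite in_itv/=.
rewrite -[X in measurable X]setTI; apply: measurable_hamiltonian => //.
Qed.

(** Configurations whose energy exceeds the minimum are exponentially rare:
    their weight is beaten by the lower bound on the partition function. *)
Lemma gibbs_concentration eta e : 0 < eta -> 0 < e -> exists N0, forall N
  (P : probability (N.-tuple (R * R)) R), (N0 <= N)%N -> gibbs P ->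
  (P (~` typical N eta) <= e%:E)%E.
Proof.
move=> eta0 e0; have eta20 : 0 < eta / 2 by rewrite divr_gt0.
have [M M0 MP] := partition_lower eta20.
(* The factor [(M * mass) ^ N <= exp (N * l)] is beaten by
   [exp (- N ^ 2 * eta / 2)], half of the excess energy. *)
pose l := ln (M * mass + 1).
have l0 : 0 <= l by rewrite ln_ge0// lerDr mulr_ge0.
exists (Num.bound ((l + `|ln e|) / (eta / 2))).+1 => N P N0N /gibbs_cst[c [Z [c0 IZ cZ cP]]].
set E := eqenergy; have mT := @measurable_typical N eta.
have hZ := MP N; rewrite IZ -EFinM lee_fin in hZ.
rewrite (cP _ (measurableC mT)).
apply: (@le_trans _ _ (c%:E * (expR (- (N%:R ^+ 2 * (E + eta))) * mass ^+ N)%:E)%E).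
  rewrite lee_wpmul2l ?lee_fin ?(ltW c0)//.
  apply: (@le_trans _ _ (\int[measure_pow rho N]_(z in ~` typical N eta)
      (expR (- (N%:R ^+ 2 * (E + eta))))%:E)%E).
    apply: ge0_le_integral => //; first exact: measurableC.
    - by apply: measurable_funTS; exact: mbE.
    - move=> z /= nt; rewrite lee_fin /boltzmann indicE.
      case: (boolP (z \in _)); rewrite ?mul0r ?expR_ge0// inE => az.
      rewrite mul1r ler_expR lerN2 leNgt; apply/negP => h; apply: nt.
      by split=> //; exact: ltW.
  rewrite integral_cst; last exact: measurableC.
  rewrite EFinM lee_wpmul2l ?lee_fin ?expR_ge0// -massE.
  by rewrite le_measure ?inE//; exact: measurableC.
rewrite -EFinM lee_fin.
have NR0 : (0 : R) <= N%:R by rewrite ler0n.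
have hc : c * expR (- (N%:R ^+ 2 * (E + eta / 2))) <= M ^+ N.
  have -> : M ^+ N = c * (M ^+ N * Z) by rewrite mulrCA cZ mulr1.
  by rewrite ler_pM2l.
have -> : expR (- (N%:R ^+ 2 * (E + eta))) =
    expR (- (N%:R ^+ 2 * (E + eta / 2))) * expR (- (N%:R ^+ 2 * (eta / 2))).
  by rewrite -expRD; congr expR; field.
apply: (@le_trans _ _ (M ^+ N * expR (- (N%:R ^+ 2 * (eta / 2))) * mass ^+ N)).
  by rewrite !mulrA ler_wpM2r ?exprn_ge0// ler_wpM2r ?expR_ge0.
rewrite mulrAC -exprMn.
apply: (@le_trans _ _ (expR (N%:R * l) * expR (- (N%:R ^+ 2 * (eta / 2))))).
  rewrite ler_wpM2r ?expR_ge0// expRM_natl /l lnK; last first.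
    by rewrite posrE ltr_wpDl// mulr_ge0.
  by rewrite lerXn2r ?nnegrE ?mulr_ge0 ?addr_ge0 ?mulr_ge0// lerDl.
rewrite -expRD -[leRHS]lnK ?posrE// ler_expR.
have hN : (l + `|ln e|) <= N%:R * (eta / 2).
  rewrite -ler_pdivrMr//; apply: ltW; apply: lt_le_trans (archi_boundP _) _.
    by rewrite divr_ge0 ?addr_ge0// ltW.
  by rewrite ler_nat (leq_trans _ N0N).
have N1 : (1 : R) <= N%:R by rewrite ler1n (leq_trans _ N0N).
have h1 : N%:R * (l + `|ln e|) <= N%:R * (N%:R * (eta / 2)) by rewrite ler_wpM2l.
have h2 : `|ln e| <= N%:R * `|ln e| by rewrite ler_peMl.
have h3 : - `|ln e| <= ln e by rewrite lerNl -normrN ler_norm.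
rewrite (_ : N%:R ^+ 2 * (eta / 2) = N%:R * (N%:R * (eta / 2))); last first.
  by rewrite expr2 -mulrA.
rewrite mulrDr in h1; lra.
Qed.

Definition empirical N (f : R * R -> R) (z : N.-tuple (R * R)) : R :=
  N%:R^-1 * \sum_(i < N) f (tnth z i).

Lemma measurable_empirical N f : measurable_fun [set: R * R] f ->
  measurable_fun [set: N.-tuple (R * R)] (@empirical N f).
Proof.
move=> mf; apply: measurable_funM => //; apply: measurable_sum => i.
by apply: measurableT_comp => //; exact: measurable_tnth.
Qed.

Lemma empirical01 N f (z : N.-tuple (R * R)) : (forall u, 0 <= f u <= 1) ->
  0 <= empirical f z <= 1.
Proof.
move=> f01; rewrite /empirical; apply/andP; split.
  by rewrite mulr_ge0 ?invr_ge0// sumr_ge0// => i _; case/andP: (f01 (tnth z i)).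
case: N z => [z|N z]; first by rewrite big_ord0 mulr0.
rewrite ler_pdivrMl ?ltr0n// mulr1.
apply: (@le_trans _ _ (\sum_(i < N.+1) 1)); last by rewrite sumr_const card_ord.
by apply: ler_sum => i _; case/andP: (f01 (tnth z i)).
Qed.

Lemma testfun_sigma f : testfun f ->
  (\int[sigma]_z (f z)%:E)%E = (fine (\int[sigma]_z (f z)%:E))%:E /\
  0 <= fine (\int[sigma]_z (f z)%:E) <= 1.
Proof.
move=> [mf f01 _ _].
have f0 u : (0 <= (f u)%:E)%E by rewrite lee_fin; case/andP: (f01 u).
have i0 : (0 <= \int[sigma]_z (f z)%:E)%E by exact: integral_ge0.
have i1 : (\int[sigma]_z (f z)%:E <= 1)%E.
  rewrite -[leRHS](integral_cst1 _ (probability_setT sigma)).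
  apply: ge0_le_integral => //; first exact: measurable_EFin_comp.
  by move=> u _; rewrite lee_fin; case/andP: (f01 u).
have fi : (\int[sigma]_z (f z)%:E)%E \is a fin_num.
  by rewrite ge0_fin_numE// (le_lt_trans i1)// ltry.
by rewrite fineK// -!lee_fin fineK// i0 i1.
Qed.

(** A typical configuration has nearly the same averages as the measure obtained
    by smearing it, which is nearly minimizing and so close to [sigma]. *)
Lemma gibbs_empirical f e : testfun f -> 0 < e -> exists N0, forall N
  (P : probability (N.-tuple (R * R)) R), (N0 <= N)%N -> gibbs P ->
  (\int[P]_z `|empirical f z - fine (\int[sigma]_u (f u)%:E)|%:E <= e%:E)%E.
Proof.
move=> tf e0; have [sE s01] := testfun_sigma tf.
have [mf f01 [L L0 fL] _] := tf; set s := fine _ in sE s01 *.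
have f0 u : 0 <= f u by case/andP: (f01 u).
have e80 : 0 < e / 8 by rewrite divr_gt0.
have [eta eta0 stab] := energy_stability tf e80.
have eta20 : 0 < eta / 2 by rewrite divr_gt0.
have E0 := eqenergy_ge0.
pose e1 := Num.min (eta / 2) (e / (8 * (L + 1))).
have L10 : 0 < 8 * (L + 1) by rewrite mulr_gt0// ltr_wpDl.
have e10 : 0 < e1 by rewrite lt_min eta20 divr_gt0.
have Le1 : L * e1 <= e / 8.
  apply: (@le_trans _ _ (L * (e / (8 * (L + 1))))).
    by rewrite ler_wpM2l// ge_min lexx orbT.
  rewrite mulrA ler_pdivrMr// (_ : e / 8 * (8 * (L + 1)) = L * e + e); last by field.
  by rewrite lerDl ltW.
have [N1 H] := spread_configuration mD R01 DR0 mW potC spreadP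
  (addr_ge0 E0 ler01) e10.
pose et := Num.min 1 (eta / 2).
have et0 : 0 < et by rewrite lt_min ltr01.
have e20 : 0 < e / 2 by rewrite divr_gt0.
have [N2 H2] := gibbs_concentration et0 e20.
exists (maxn N1.+1 N2) => N P; rewrite geq_max => /andP[N1N N2N] gP.
have mT := @measurable_typical N et.
have avg (z : N.-tuple (R * R)) : typical N et z -> `|empirical f z - s| <= e / 2.
  case: N N1N {N2N P gP mT} z => [//|n] nN1 z [[Dz zI] hz].
  have n20 : (0 : R) < n.+1%:R ^+ 2 by rewrite exprn_gt0// ltr0n.
  have [|mu [_ nmu hmu fmu]] := H n z nN1 Dz zI.
    by apply: (le_trans hz); rewrite ler_pM2l// lerD2l ge_min lexx.
  have [|s1 s2] := stab mu nmu.
    apply: (le_trans hmu); rewrite lee_fin.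
    have : ham z / n.+1%:R ^+ 2 <= eqenergy + eta / 2.
      rewrite ler_pdivrMr// mulrC (le_trans hz)// ler_pM2l// lerD2l.
      by rewrite ge_min lexx orbT.
    have : e1 <= eta / 2 by rewrite ge_min lexx.
    by move: (ham z / _) => q; lra.
  have [h1 h2] := fmu f L mf f0 L0 fL; rewrite -/(empirical f z) in h1 h2.
  move: h1 h2 s1 s2; rewrite sE.
  have : (0 <= \int[mu]_z (f z)%:E)%E by apply: integral_ge0 => u _; rewrite lee_fin.
  case: (\int[mu]_z (f z)%:E)%E => [t| |]// _; rewrite -!EFinD !lee_fin => h1 h2 s1 s2.
  by rewrite ler_norml; apply/andP; split; lra.
have me := @measurable_empirical N f mf.
apply: (@le_trans _ _ (\int[P]_z ((e / 2)%:E + (\1_(~` typical N et) z)%:E))%E).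
  apply: ge0_le_integral => //.
  - apply: measurable_EFin_comp; apply: measurableT_comp => //.
    exact: measurable_funB.
  - apply: measurable_EFin_comp; apply: measurable_funD => //.
    by apply: measurable_indic; exact: measurableC.
  - move=> z _; rewrite -EFinD lee_fin indicE.
    have [tz|tz] := pselect (typical N et z).
      by rewrite memNset ?addr0 ?avg//; exact.
    rewrite mem_set//.
    have := empirical01 z f01; move/andP: s01 => [] ? ? /andP[? ?].
    apply: (@le_trans _ _ 1); last by rewrite lerDr ltW.
    by rewrite ler_norml; apply/andP; split; lra.
rewrite ge0_integralD//; last 2 first.
- by move=> z _; rewrite lee_fin ltW.
- by apply: measurable_EFin_comp; apply: measurable_indic; exact: measurableC.
rewrite (integral_cst1 _ (probability_setT P)) integral_indic//; last exact: measurableC.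
rewrite setIT [X in (_ <= X%:E)%E](_ : e = e / 2 + e / 2); last by field.
by rewrite EFinD leeD2l// H2.
Qed.

(** The hamiltonian and the powers of [rho] are both invariant under permutations
    of the points. *)
Lemma gibbs_invol N (P : probability (N.-tuple (R * R)) R) (s : 'I_N -> 'I_N)
    (F : N.-tuple (R * R) -> \bar R) : gibbs P -> involutive s ->
  (forall z, 0 <= F z)%E -> measurable_fun [set: N.-tuple (R * R)] F ->
  (\int[P]_z F [tuple tnth z (s i) | i < N] = \int[P]_z F z)%E.
Proof.
move=> /gibbs_cst[c [Z [c0 _ _ cP]]] sK F0 mF.
have sI : injective s := inv_inj sK.
have bs (z : N.-tuple (R * R)) :
    boltzmann [tuple tnth z (s i) | i < N] = boltzmann z.
  rewrite /boltzmann; congr (_ * expR (- _)).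
    rewrite !indicE; congr (nat_of_bool _)%:R; apply/idP/idP; rewrite !inE.
      move=> [Dz zI]; split.
        by move=> i; have := Dz (s i); rewrite tnth_mktuple sK.
      move=> i j zij; apply: sI; apply: zI.
      by rewrite !tnth_mktuple !sK.
    move=> [Dz zI]; split; first by move=> i; rewrite tnth_mktuple.
    by move=> i j; rewrite !tnth_mktuple => /zI /sI.
  rewrite /hamiltonian; congr (_ * _ + _).
    rewrite [RHS](reindex_inj sI)/=; apply: eq_bigr => i _.
    by rewrite tnth_mktuple.
  rewrite [RHS](reindex_inj sI)/=; apply: eq_bigr => i _.
  rewrite [RHS](reindex_inj sI)/=; apply: eq_big => [j|j _].
    by rewrite (inj_eq sI).
  by rewrite !tnth_mktuple.
have PI G : (forall z, 0 <= G z)%E -> measurable_fun setT G ->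
    (\int[P]_z G z = c%:E * \int[measure_pow rho N]_z (G z * (boltzmann z)%:E))%E.
  move=> G0 mG.
  rewrite (eq_measure_integral (mscale (NngNum (ltW c0))
    (with_density (measure_pow rho N) (@measurable_boltzmann N)
      (@boltzmann_ge0 N)))).
    by rewrite ge0_integral_mscale// integral_with_density.
  by move=> A mA _; rewrite [LHS]cP.
have ms : measurable_fun [set: N.-tuple (R * R)]
    (fun z => [tuple tnth z (s i) | i < N]).
  apply/measurable_fun_tnthP => i.
  rewrite (_ : _ \o _ = @tnth _ (R * R) ^~ (s i)); first exact: measurable_tnth.
  by apply/funext => t /=; rewrite tnth_mktuple.
rewrite !PI//; last exact: measurableT_comp ms.
congr (_ * _)%E.
have mFb : measurable_fun setT (fun z => F z * (boltzmann z)%:E)%E.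
  by apply: emeasurable_funM => //; exact: mbE.
have Fb0 z : (0 <= F z * (boltzmann z)%:E)%E by exact: mule_ge0.
have H := integral_pow_invol rho sK Fb0 mFb.
rewrite -[RHS]H; apply: eq_integral => z _; congr (_ * _%:E)%E; exact/esym/bs.
Qed.

End GibbsGas.

(** * Bounded means and exchangeable laws *)

Section BoundedMean.
Context d (T : measurableType d) (R : realType).
Implicit Types (P : probability T R) (f g : T -> R).

Definition bounded_meas f : Prop :=
  measurable_fun [set: T] f /\ exists B, forall x, `|f x| <= B.

Definition mean P f : R := \int[P]_x f x.

Lemma bounded_integrable P f : bounded_meas f ->
  P.-integrable [set: T] (EFin \o f).
Proof.
move=> [mf [B fB]]; apply: measurable_bounded_integrable => //.
  by rewrite (le_lt_trans (probability_le1 P _))// ltry.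
exists B; split; first exact: num_real.
by move=> x Bx y _; apply: (le_trans (fB y)); exact: ltW.
Qed.

Lemma meanE P f : bounded_meas f -> ((mean P f)%:E = \int[P]_x (f x)%:E)%E.
Proof.
by move=> bf; rewrite /mean fineK//; apply: integrable_fin_num => //;
  exact: bounded_integrable.
Qed.

Lemma bounded_cst (c : R) : bounded_meas (fun=> c).
Proof. by split => //; exists `|c|. Qed.

Lemma boundedM f g : bounded_meas f -> bounded_meas g ->
  bounded_meas (fun x => f x * g x).
Proof.
move=> [mf [B fB]] [mg [C gC]]; split; first exact: measurable_funM.
by exists (B * C) => x; rewrite normrM ler_pM.
Qed.

Lemma boundedB f g : bounded_meas f -> bounded_meas g ->
  bounded_meas (fun x => f x - g x).
Proof.
move=> [mf [B fB]] [mg [C gC]]; split; first exact: measurable_funB.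
by exists (B + C) => x; rewrite (le_trans (ler_normB _ _))// lerD.
Qed.

Lemma bounded_norm f : bounded_meas f -> bounded_meas (fun x => `|f x|).
Proof.
move=> [mf [B fB]]; split; first exact: measurableT_comp.
by exists B => x; rewrite normr_id.
Qed.

Lemma bounded_sum (I : finType) (f : I -> T -> R) :
  (forall i, bounded_meas (f i)) -> bounded_meas (fun x => \sum_i f i x).
Proof.
move=> bf; split; first by apply: measurable_sum => i; have [] := bf i.
have [B BP] := choice (fun i => (bf i).2).
exists (\sum_i B i) => x; apply: (le_trans (ler_norm_sum _ _ _)).
by apply: ler_sum => i _.
Qed.

Lemma bounded_prod (I : finType) (p : pred I) (f : I -> T -> R) :
  (forall i, measurable_fun [set: T] (f i)) -> (forall i x, 0 <= f i x <= 1) ->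
  bounded_meas (fun x => \prod_(i | p i) f i x) /\
  forall x, 0 <= \prod_(i | p i) f i x <= 1.
Proof.
move=> mf f01.
have h x : 0 <= \prod_(i | p i) f i x <= 1.
  apply/andP; split; last by apply: prodr_ile1 => i _; exact: f01.
  by apply: prodr_ge0 => i _; have /andP[] := f01 i x.
split=> //; split.
  under eq_fun do rewrite big_mkcond/=.
  by apply: measurable_prod => i _; case: (p i).
by exists 1 => x; have /andP[a b] := h x; rewrite ger0_norm.
Qed.

Lemma meanD P f g : bounded_meas f -> bounded_meas g ->
  mean P (fun x => f x + g x) = mean P f + mean P g.
Proof. by move=> bf bg; apply: RintegralD => //; exact: bounded_integrable. Qed.

Lemma meanB P f g : bounded_meas f -> bounded_meas g ->
  mean P (fun x => f x - g x) = mean P f - mean P g.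
Proof. by move=> bf bg; apply: RintegralB => //; exact: bounded_integrable. Qed.

Lemma meanZ P f (c : R) : bounded_meas f ->
  mean P (fun x => c * f x) = c * mean P f.
Proof. by move=> bf; apply: RintegralZl => //; exact: bounded_integrable. Qed.

Lemma mean_cst P (c : R) : mean P (fun=> c) = c.
Proof.
rewrite /mean Rintegral_cst// -[RHS]mulr1; congr (_ * _).
by rewrite -[RHS]/(fine 1%E); congr fine; exact: probability_setT.
Qed.

Lemma le_mean P f g : bounded_meas f -> bounded_meas g ->
  (forall x, f x <= g x) -> mean P f <= mean P g.
Proof.
by move=> bf bg fg; apply: le_Rintegral => //; exact: bounded_integrable.
Qed.

Lemma mean_norm P f : bounded_meas f -> `|mean P f| <= mean P (fun x => `|f x|).
Proof. by move=> bf; apply: le_normr_Rintegral => //; exact: bounded_integrable. Qed.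

Lemma mean_sum P (I : finType) (f : I -> T -> R) :
  (forall i, bounded_meas (f i)) ->
  mean P (fun x => \sum_i f i x) = \sum_i mean P (f i).
Proof.
move=> bf; elim: (index_enum I) => [|i s IH].
  by rewrite big_nil -[RHS](mean_cst P 0); congr mean; apply/funext => x; rewrite big_nil.
rewrite big_cons -IH -meanD//; last first.
  split; first by apply: measurable_sum => j; have [] := bf j.
  have [B BP] := choice (fun i => (bf i).2).
  exists (\sum_(i <- s) B i) => x; apply: (le_trans (ler_norm_sum _ _ _)).
  by apply: ler_sum => j _.
by congr mean; apply/funext => x; rewrite big_cons.
Qed.

Lemma mean01 P f : bounded_meas f -> (forall x, 0 <= f x <= 1) -> 0 <= mean P f <= 1.
Proof.
move=> bf f01; apply/andP; split.
  rewrite -[leLHS](mean_cst P 0); apply: le_mean => // [|x]; first exact: bounded_cst.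
  by have /andP[] := f01 x.
rewrite -[leRHS](mean_cst P 1); apply: le_mean => // [|x]; first exact: bounded_cst.
by have /andP[] := f01 x.
Qed.

End BoundedMean.

Lemma sum_ord_lt N h : (\sum_(i < N) (i < h) <= h)%N.
Proof.
suff : (\sum_(i < N) (i < h) <= minn N h)%N by rewrite leq_min => /andP[].
elim: N => [|N IH]; first by rewrite big_ord0.
rewrite big_ord_recr/=; case: (ltnP N h) IH => Nh IH.
  by rewrite addn1 (minn_idPl Nh) ltnS (leq_trans IH)// geq_minl.
by rewrite addn0 (minn_idPr (leqW Nh)) (leq_trans IH)// geq_minr.
Qed.

Section Exchangeable.
Context d (T : measurableType d) (R : realType).
Variables (mu : forall N, probability (N.-tuple T) R) (sigma : probability T R).
Hypothesis sym : forall N (s : 'I_N -> 'I_N) (F : N.-tuple T -> \bar R),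
  (0 < N)%N -> involutive s -> (forall z, 0 <= F z)%E ->
  measurable_fun [set: N.-tuple T] F ->
  (\int[mu N]_z F [tuple tnth z (s i) | i < N] = \int[mu N]_z F z)%E.

Definition averaging (f : T -> R) : Prop :=
  [/\ measurable_fun [set: T] f, (forall x, 0 <= f x <= 1) &
   forall e, 0 < e -> exists N0, forall N, (N0 <= N)%N ->
   mean (mu N) (fun z => `|N%:R^-1 * \sum_(i < N) f (tnth z i) - mean sigma f|) <= e].

(** For an exchangeable law, a further coordinate can be replaced by the average
    over the remaining ones, which is nearly constant. *)
Lemma exchangeable_product (f : nat -> T -> R) : (forall l, averaging (f l)) ->
  forall h e, 0 < e -> exists N0, forall N, (N0 <= N)%N ->
  `|mean (mu N) (fun z => \prod_(l < N | (l < h)%N) f l (tnth z l)) -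
    \prod_(l < h) mean sigma (f l)| <= e.
Proof.
move=> af; have mf l : measurable_fun [set: T] (f l) by have [] := af l.
have f01 l x : 0 <= f l x <= 1 by have [] := af l.
have mfi N l (i : 'I_N) : measurable_fun [set: N.-tuple T] (fun z => f l (tnth z i)).
  by apply: measurableT_comp => //; exact: measurable_tnth.
pose G h N (z : N.-tuple T) := \prod_(l < N | (l < h)%N) f l (tnth z l).
have [bG G01] : (forall h N, bounded_meas (@G h N)) /\
    (forall h N z, 0 <= @G h N z <= 1).
  have H h N := @bounded_prod _ (N.-tuple T) R 'I_N (fun l => (l < h)%N)
    (fun l z => f l (tnth z l)) (fun l => mfi N l l) (fun l z => f01 l (tnth z l)).
  by split=> h N; have [] := H h N.
have bf N l (i : 'I_N) : bounded_meas (fun z : N.-tuple T => f l (tnth z i)).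
  split; first exact: mfi.
  by exists 1 => z; have /andP[a b] := f01 l (tnth z i); rewrite ger0_norm.
have s01 l : 0 <= mean sigma (f l) <= 1.
  apply: mean01 => //; split => //; exists 1 => x.
  by have /andP[a b] := f01 l x; rewrite ger0_norm.
elim=> [|h IH] e e0.
  exists 0%N => N _; rewrite big_ord0 (_ : (fun=> _) = (fun=> 1)).
    by rewrite mean_cst subrr normr0 ltW.
  by apply/funext => z; rewrite big_pred0.
have e30 : 0 < e / 3 by rewrite divr_gt0.
have [N1 H1] := IH _ e30.
have [_ _ /(_ _ e30)[N2 H2]] := af h.
exists (maxn (maxn N1 N2) (maxn h.+1 (Num.bound (h%:R / (e / 3))).+1)) => N.
rewrite !geq_max => /andP[/andP[N1N N2N] /andP[hN NN]].
have N0 : (0 < N)%N by exact: leq_ltn_trans hN.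
have NR : (0 : R) < N%:R by rewrite ltr0n.
have hNe : h%:R / N%:R <= e / 3.
  rewrite ler_pdivrMr// mulrC -ler_pdivrMr//; apply: ltW.
  apply: lt_le_trans (archi_boundP _) _; first by rewrite divr_ge0// ltW.
  by rewrite ler_nat ltnW.
pose oh := Ordinal hN.
have GS z : @G h.+1 N z = G h N z * f h (tnth z oh).
  rewrite /G (bigD1 oh)//= mulrC; congr (_ * _); apply: eq_bigl => l.
  by rewrite ltnS [in RHS]ltn_neqAle andbC -val_eqE.
have swap (j : 'I_N) : (h <= j)%N ->
    mean (mu N) (fun z => G h N z * f h (tnth z j)) = mean (mu N) (@G h.+1 N).
  move=> hj; apply: EFin_inj.
  rewrite (meanE _ (boundedM (bG h N) (bf N h j))) (meanE _ (bG h.+1 N)).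
  rewrite -[RHS](sym N0 (s := tperm oh j)); last 3 first.
  - exact: tpermK.
  - by move=> z; rewrite lee_fin; have /andP[] := G01 h.+1 N z.
  - by apply: measurable_EFin_comp; have [] := bG h.+1 N.
  apply: eq_integral => z _; congr EFin; rewrite GS tnth_mktuple tpermL.
  congr (_ * _); apply: eq_bigr => l lh; rewrite tnth_mktuple tpermD//.
    by rewrite -val_eqE/= gtn_eqF.
  by rewrite -val_eqE/= gtn_eqF// (leq_trans lh).
have bE : bounded_meas (fun z : N.-tuple T => N%:R^-1 * \sum_(i < N) f h (tnth z i)).
  by apply: boundedM; [exact: bounded_cst|exact: bounded_sum].
pose s := mean sigma (f h).
have h1 : `|mean (mu N) (fun z => G h N z * (N%:R^-1 * \sum_(i < N) f h (tnth z i))) -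
    s * mean (mu N) (@G h N)| <= e / 3.
  have bs : bounded_meas (fun z => s * G h N z).
    by apply: boundedM => //; exact: bounded_cst.
  have bGE := boundedM (bG h N) bE.
  rewrite -(meanZ (mu N) s (bG h N)) -(meanB (mu N) bGE bs).
  apply: le_trans (H2 N N2N).
  have bD : bounded_meas (fun z : N.-tuple T =>
      N%:R^-1 * \sum_(i < N) f h (tnth z i) - s).
    by apply: boundedB => //; exact: bounded_cst.
  apply: (le_trans (mean_norm _ _)).
    exact: boundedB.
  apply: le_mean.
  - exact/bounded_norm/boundedB.
  - exact: bounded_norm.
  - move=> z; rewrite [s * _]mulrC -mulrBr normrM; have /andP[g0 g1] := G01 h N z.
    by rewrite ger0_norm// ler_piMl.
(* Only the coordinates below [h] are not interchangeable with the coordinate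
   [h], and they make up [h] of the [N] terms. *)
have h2 : `|mean (mu N) (fun z => G h N z * (N%:R^-1 * \sum_(i < N) f h (tnth z i))) -
    mean (mu N) (@G h.+1 N)| <= h%:R / N%:R.
  have -> : (fun z => G h N z * (N%:R^-1 * \sum_(i < N) f h (tnth z i))) =
      (fun z => N%:R^-1 * \sum_(i < N) (G h N z * f h (tnth z i))).
    by apply/funext => z; rewrite mulrCA mulr_sumr.
  rewrite meanZ; last by apply: bounded_sum => i; exact: (boundedM (bG h N) (bf N h i)).
  rewrite mean_sum; last by move=> i; exact: (boundedM (bG h N) (bf N h i)).
  have -> : mean (mu N) (@G h.+1 N) = N%:R^-1 * \sum_(i < N) mean (mu N) (@G h.+1 N).
    by rewrite sumr_const card_ord -[X in _ * X]mulr_natl mulKf// gt_eqF.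
  rewrite -mulrBr -sumrB normrM ger0_norm ?invr_ge0// [leRHS]mulrC.
  rewrite ler_wpM2l ?invr_ge0//; apply: (le_trans (ler_norm_sum _ _ _)).
  apply: (@le_trans _ _ (\sum_(i < N) (i < h)%N%:R)); last first.
    by rewrite -natr_sum ler_nat sum_ord_lt.
  apply: ler_sum => i _; have [hi|hi] := leqP h i; first by rewrite swap// subrr normr0.
  have /andP[a0 a1] : 0 <= mean (mu N) (fun z => G h N z * f h (tnth z i)) <= 1.
    apply: mean01 => [|z]; first exact: (boundedM (bG h N) (bf N h i)).
    have /andP[? ?] := G01 h N z; have /andP[? ?] := f01 h (tnth z i).
    by rewrite mulr_ge0// mulr_ile1.
  have /andP[b0 b1] := mean01 (mu N) (bG h.+1 N) (G01 h.+1 N).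
  rewrite [leRHS](_ : _ = 1)//; move: a0 a1 b0 b1; move: (mean _ _) (mean _ _) => a b.
  by move=> ? ? ? ?; rewrite ler_norml; apply/andP; split; lra.
have h3 := H1 N N1N; rewrite -/(G h N) in h3.
rewrite big_ord_recr/= -/s.
set p := \prod_(_ < h) _ in h3 *; have /andP[s0 s1] := s01 h; rewrite -/s in s0 s1.
have h4 : `|s * mean (mu N) (@G h N) - s * p| <= e / 3.
  by rewrite -mulrBr normrM ger0_norm// (le_trans _ h3)// ler_piMl.
rewrite [p * s]mulrC.
move: h1 h2 h4; rewrite !ler_norml => /andP[? ?] /andP[? ?] /andP[? ?].
by apply/andP; split; lra.
Qed.

End Exchangeable.

(** * Tiles and uniform continuity *)

Section Tiles.
Context {R : realType}.
Implicit Types (t x y : R) (z w : R * R).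

Definition ramp t : R := Num.min 1 (Num.max 0 t).

(** A tent supported between 0 and 2, written as a difference so that the sum of
    its integer translates telescopes. *)
Definition hat t : R := ramp t - ramp (t - 1).

Lemma rampP t : [\/ t <= 0 /\ ramp t = 0, 0 <= t <= 1 /\ ramp t = t |
  1 <= t /\ ramp t = 1].
Proof.
rewrite /ramp; have [t0|t0] := leP t 0.
  by apply: Or31; split=> //; rewrite min_r// ler01.
have [t1|t1] := leP 1 t; first by apply: Or33.
by apply: Or32; rewrite !ltW.
Qed.

Lemma hat01 t : 0 <= hat t <= 1.
Proof.
rewrite /hat; have [[? ->]|[/andP[? ?] ->]|[? ->]] := rampP t;
  have [[? ->]|[/andP[? ?] ->]|[? ->]] := rampP (t - 1); apply/andP; split; lra.
Qed.

Lemma hat_eq0 t : ~~ (0 <= t <= 2) -> hat t = 0.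
Proof.
rewrite negb_and -!ltNge => /orP h; rewrite /hat.
by have [[? ->]|[/andP[? ?] ->]|[? ->]] := rampP t;
  have [[? ->]|[/andP[? ?] ->]|[? ->]] := rampP (t - 1); case: h => ?; lra.
Qed.

Lemma ramp_lip t x : ramp t <= ramp x + `|t - x|.
Proof.
have h1 := ler_norm (t - x); have h2 := normr_ge0 (t - x).
by have [[? ->]|[/andP[? ?] ->]|[? ->]] := rampP t;
  have [[? ->]|[/andP[? ?] ->]|[? ->]] := rampP x; lra.
Qed.

Lemma hat_lip t x : hat t <= hat x + 2 * `|t - x|.
Proof.
have h1 := ramp_lip t x; have h2 := ramp_lip (x - 1) (t - 1).
rewrite (_ : x - 1 - (t - 1) = x - t) in h2; last by ring.
rewrite distrC in h2; rewrite /hat; lra.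
Qed.

Lemma sum_hat n t : 1 <= t <= n%:R -> \sum_(i < n) hat (t - i%:R) = 1.
Proof.
move=> /andP[t1 tn].
have -> : \sum_(i < n) hat (t - i%:R) = ramp t - ramp (t - n%:R).
  elim: n {tn} => [|n IH]; first by rewrite big_ord0 subr0 subrr.
  rewrite big_ord_recr/= IH /hat (_ : t - n.+1%:R = t - n%:R - 1); last first.
    by rewrite -natr1; ring.
  by ring.
have [[? ->]|[/andP[? ?] ->]|[? ->]] := rampP t;
  have [[? ->]|[/andP[? ?] ->]|[? ->]] := rampP (t - n%:R); lra.
Qed.

Lemma measurable_hat : measurable_fun [set: R] hat.
Proof.
have mr : measurable_fun [set: R] ramp.
  by apply: measurable_minr => //; exact: measurable_maxr.
apply: measurable_funB => //; apply: measurableT_comp => //.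
exact: measurable_funB.
Qed.

Definition tile (dl x0 : R) (a b : nat) z : R :=
  hat ((z.1 - x0) / dl - a%:R) * hat ((z.2 - x0) / dl - b%:R).

Lemma tile_neq0 dl x0 a b z : 0 < dl -> tile dl x0 a b z != 0 ->
  x0 + a%:R * dl <= z.1 <= x0 + a%:R * dl + 2 * dl /\
  x0 + b%:R * dl <= z.2 <= x0 + b%:R * dl + 2 * dl.
Proof.
move=> dl0; rewrite mulf_eq0 negb_or => /andP[h1 h2].
have H c (u : R) : hat ((u - x0) / dl - c) != 0 ->
    x0 + c * dl <= u <= x0 + c * dl + 2 * dl.
  move=> h; have : 0 <= (u - x0) / dl - c <= 2.
    by apply: contraT => /hat_eq0 E; rewrite E eqxx in h.
  rewrite subr_ge0 lerBlDr ler_pdivlMr// ler_pdivrMr// => /andP[? ?].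
  by apply/andP; split; lra.
by split; exact: H.
Qed.

Lemma testfun_tile dl x0 a b : 0 < dl -> testfun (tile dl x0 a b).
Proof.
move=> dl0; have mt : measurable_fun [set: R * R] (tile dl x0 a b).
  by apply: measurable_funM; apply: measurableT_comp => //;
    try exact: measurable_hat; apply: measurable_funB => //;
    apply: measurable_funM => //; apply: measurable_funB.
have h0 z : 0 <= tile dl x0 a b z <= 1.
  have /andP[? ?] := hat01 ((z.1 - x0) / dl - a%:R).
  have /andP[? ?] := hat01 ((z.2 - x0) / dl - b%:R).
  by rewrite mulr_ge0// mulr_ile1.
split=> //.
- exists (4 / dl); first by rewrite divr_ge0// ltW.
  move=> u v; rewrite /tile.
  set p := hat _; set q := hat _; set p' := hat ((v.1 - _) / _ - _).
  set q' := hat ((v.2 - _) / _ - _).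
  have p1 : p <= p' + 2 / dl * cabs (u - v).
    apply: (le_trans (hat_lip _ ((v.1 - x0) / dl - a%:R))); rewrite lerD2l.
    rewrite -mulrA ler_wpM2l// (_ : _ - _ = (u - v).1 / dl); last by rewrite /=; ring.
    rewrite normrM (ger0_norm (x := dl^-1)) ?invr_ge0 ?(ltW dl0)// mulrC.
    by rewrite ler_wpM2l ?invr_ge0 ?(ltW dl0)// le_cabs_fst.
  have q1 : q <= q' + 2 / dl * cabs (u - v).
    apply: (le_trans (hat_lip _ ((v.2 - x0) / dl - b%:R))); rewrite lerD2l.
    rewrite -mulrA ler_wpM2l// (_ : _ - _ = (u - v).2 / dl); last by rewrite /=; ring.
    rewrite normrM (ger0_norm (x := dl^-1)) ?invr_ge0 ?(ltW dl0)// mulrC.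
    by rewrite ler_wpM2l ?invr_ge0 ?(ltW dl0)// le_cabs_snd.
  have /andP[? ?] : 0 <= p <= 1 := hat01 _.
  have /andP[? ?] : 0 <= q <= 1 := hat01 _.
  have /andP[? ?] : 0 <= p' <= 1 := hat01 _.
  have /andP[? ?] : 0 <= q' <= 1 := hat01 _.
  rewrite (_ : 4 / dl * _ = 2 / dl * cabs (u - v) + 2 / dl * cabs (u - v)); last by ring.
  have : 0 <= 2 / dl * cabs (u - v) by rewrite mulr_ge0 ?cabs_ge0// divr_ge0// ltW.
  move: (2 / dl * _) p1 q1 => c p1 q1 c0.
  rewrite addrA; apply: (@le_trans _ _ (p' * q + c)).
    rewrite -lerBlDl -mulrBl.
    have [pp|pp] := leP 0 (p - p'); first by rewrite (@le_trans _ _ (p - p'))// ?ler_piMr//; lra.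
    by rewrite (le_trans _ c0)// mulr_le0_ge0// ltW.
  rewrite lerD2r -lerBlDl -mulrBr.
  have [pp|pp] := leP 0 (q - q'); first by rewrite (@le_trans _ _ (q - q'))// ?ler_piMl//; lra.
  by rewrite (le_trans _ c0)// mulr_ge0_le0// ltW.
- pose A c : set R := `[x0 + c%:R * dl, x0 + c%:R * dl + 2 * dl]%classic.
  have mA : measurable (A a `*` A b).
    by apply: measurableX; exact: measurable_itv.
  exists (2 * dl * (2 * dl)); first by rewrite !mulr_ge0// ltW.
  apply: (@le_trans _ _ (\int[sprod lebesgue_measure lebesgue_measure]_u
      (\1_(A a `*` A b) u)%:E)%E).
    apply: ge0_le_integral => //.
    - by move=> u _; rewrite lee_fin sqr_ge0.
    - by apply: measurable_EFin_comp; exact: measurable_funX.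
    - by apply: measurable_EFin_comp; exact: measurable_indic.
    - move=> u _; rewrite lee_fin indicE; have [E|N0] := eqVneq (tile dl x0 a b u) 0.
        by rewrite E expr0n/=.
      have [h1 h2] := tile_neq0 dl0 N0.
      rewrite mem_set; last by split; rewrite /A /= in_itv.
      by have /andP[? ?] := h0 u; rewrite exprn_ile1.
  rewrite integral_indic//.
  rewrite setIT [leLHS](@product_measure1E _ _ _ _ R lebesgue_measure
    lebesgue_measure); [|exact: measurable_itv|exact: measurable_itv].
  have lA c : (lebesgue_measure (A c) = (2 * dl)%:E)%E.
    rewrite [LHS]lebesgue_measure_itv/= lte_fin ltrDl mulr_gt0// -EFinD.
    by congr EFin; ring.
  by rewrite [X in (_ <= X)%E]EFinM -{1}(lA a) -(lA b).
Qed.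

End Tiles.

Section UniformContinuity.
Context {R : realType} (X : topologicalType) (dist : X -> X -> R).
Hypothesis near_dist : forall x e, 0 < e -> nbhs x [set y | dist x y < e].
Hypothesis dist_near : forall x (A : set X), nbhs x A ->
  exists2 e, 0 < e & forall y, dist x y < e -> A y.
Hypothesis triangle : forall x y z, dist x z <= dist x y + dist y z.

(** The theorem of Heine, for a topology described by an explicit distance. *)
Lemma compact_uniform_continuity (K : set X) (f : X -> R) e :
  compact K -> {within K, continuous f} -> 0 < e ->
  exists2 dl, 0 < dl & forall z w, K z -> K w -> dist z w <= dl ->
    `|f z - f w| <= e.
Proof.
move=> cK /subspace_continuousP cf e0.
pose P (dl : R) z := K z -> forall w, K w -> dist z w <= dl -> `|f z - f w| <= e.
have /compact_near_coveringP nK := cK.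
have : \forall dl \near (0 : R)^'+, K `<=` P dl.
  apply: nK => x Kx.
  have e20 : 0 < e / 2 by rewrite divr_gt0.
  have /cvgrPdist_lt/(_ _ e20) := cf x Kx.
  rewrite near_withinE => /dist_near[r r0 rP].
  have r20 : 0 < r / 2 by rewrite divr_gt0.
  exists ([set y | dist x y < r / 2], [set dl | dl < r / 2]).
    split; first exact: near_dist.
    exact: nbhs_right_lt.
  move=> [y dl] /= [xy dlr] Ky w Kw yw.
  have h1 : `|f x - f y| < e / 2 by apply: rP => //; lra.
  have h2 : `|f x - f w| < e / 2.
    by apply: rP => //; apply: le_lt_trans (triangle x y w) _; lra.
  have -> : f y - f w = (f x - f w) - (f x - f y) by ring.
  by apply: (le_trans (ler_normB _ _)); lra.
move=> H; have HI : \forall dl \near (0 : R)^'+, (K `<=` P dl) /\ 0 < dl.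
  by apply: filterS2 H (nbhs_right_gt (0 : R)) => dl.
have [dl [KP dl0]] : exists dl, (K `<=` P dl) /\ 0 < dl.
  exact: (@filter_ex _ (0 : R)^'+ _ _ HI).
by exists dl => // z w Kz Kw; exact: KP.
Qed.

End UniformContinuity.

Section CompactPlane.
Context {R : realType}.
Implicit Types D : set (R * R).

Lemma compact_plane D (r : R) : closed D ->
  (forall z, D z -> `|z.1| <= r /\ `|z.2| <= r) -> compact D.
Proof.
move=> cD Dr; have cr := @segment_compact R (- r) r.
apply: (subclosed_compact cD (compact_setX cr cr)) => z /Dr[h1 h2].
by split; rewrite /= in_itv/= -ler_norml.
Qed.

Lemma compact_plane_modulus D (f : R * R -> R) e : compact D -> continuous f ->
  0 < e -> exists2 dl, 0 < dl & forall z w, D z -> D w -> cabs (z - w) <= dl ->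
    `|f z - f w| <= e.
Proof.
move=> cD cf e0.
have h1 (x : (R * R)%type) (d : R) : 0 < d -> nbhs x [set y | cabs (x - y) < d].
  by move=> d0; apply/nbhs_cabsP; exists d.
have h2 (x : (R * R)%type) (A : set (R * R)) : nbhs x A ->
    exists2 d, 0 < d & forall y, cabs (x - y) < d -> A y.
  by move=> /nbhs_cabsP[d d0 dA]; exists d.
have h3 (x y z : (R * R)%type) : cabs (x - z) <= cabs (x - y) + cabs (y - z).
  exact: cabs_triangle.
by apply: (compact_uniform_continuity h1 h2 h3 cD _ e0); exact: continuous_subspaceT.
Qed.

(** The sum of the moduli of the coordinates is a distance for the topology of
    pointwise convergence, in which the cube is compact by the theorem of
    Tychonoff. *)
Lemma compact_cube_modulus D k (f : {ptws 'I_k -> (R * R)%type} -> R) e :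
  compact D ->
  {within [set z : {ptws 'I_k -> (R * R)%type} | forall i, D (z i)], continuous f} ->
  0 < e -> exists2 dl, 0 < dl & forall z w : 'I_k -> R * R,
    (forall i, D (z i)) -> (forall i, D (w i)) ->
    (forall i, cabs (z i - w i) <= dl) -> `|f z - f w| <= e.
Proof.
move=> cD cf e0; set K := mkset _ in cf.
pose dist (z w : {ptws 'I_k -> (R * R)%type}) := \sum_i cabs (z i - w i).
have distS z w i : cabs (z i - w i) <= dist z w.
  by rewrite /dist (bigD1 i)//= lerDl sumr_ge0// => j _; exact: cabs_ge0.
have [dl dl0 H] : exists2 dl, 0 < dl & forall z w, K z -> K w -> dist z w <= dl ->
    `|f z - f w| <= e.
  apply: compact_uniform_continuity => //.
  - move=> x d d0; have dk : 0 < d / k.+1%:R by rewrite divr_gt0.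
    have : \forall y \near x, forall i, cabs (x i - y i) < d / k.+1%:R.
      apply: (@filter_forall _ _
        (fun i (y : {ptws 'I_k -> (R * R)%type}) => cabs (x i - y i) < d / k.+1%:R)
        (nbhs x) _) => i.
      have pc : nbhs (x i) [set w | cabs (x i - w) < d / k.+1%:R].
        by apply/nbhs_cabsP; exists (d / k.+1%:R).
      exact: (@proj_continuous 'I_k (fun=> (R * R)%type) i x _ pc).
    apply: filterS => y yP; apply: (@le_lt_trans _ _ (\sum_(i < k) d / k.+1%:R)).
      by apply: ler_sum => i _; exact: ltW.
    rewrite sumr_const card_ord -[ltLHS]mulr_natl mulrCA gtr_pMr//.
    by rewrite ltr_pdivrMr// mul1r ltr_nat.
  - move=> x A.
    pose F := filter_from [set d : R | 0 < d] (fun d => [set y | dist x y < d]).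
    have FF : Filter F.
      apply: filter_from_filter; first by exists 1 => /=.
      move=> a b /= a0 b0; exists (Num.min a b); first by rewrite /= lt_min a0.
      by move=> y /=; rewrite lt_min => /andP[].
    suff Fx : F --> x by move=> /Fx[d d0 dA]; exists d.
    apply/cvg_sup => i U [/= _ [[V oV <-] Vx]] /filterS; apply.
    have /nbhs_cabsP[d d0 dV] : nbhs (x i) V by exact: open_nbhs_nbhs.
    exists d => //= y yd; apply: dV.
    exact: le_lt_trans (distS _ _ _) yd.
  - move=> x y z; rewrite /dist -big_split/=; apply: ler_sum => i _.
    exact: cabs_triangle.
  - exact: (@tychonoff 'I_k (fun=> (R * R)%type) (fun=> D) (fun=> cD)).
exists (dl / k.+1%:R); first by rewrite divr_gt0.
move=> z w Kz Kw zw; apply: H => //.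
apply: (@le_trans _ _ (\sum_(i < k) dl / k.+1%:R)); first exact: ler_sum.
rewrite sumr_const card_ord -[leLHS]mulr_natl mulrCA ger_pMr//.
by rewrite ler_pdivrMr// mul1r ler_nat.
Qed.

End CompactPlane.

(** * Weak limits of correlation measures *)

Lemma mean_le_on d (T : measurableType d) (R : realType) (P : probability T R)
    (A : set T) (f : T -> R) (e : R) : measurable A -> P A = 1%E ->
  bounded_meas f -> (forall x, A x -> `|f x| <= e) -> 0 <= e -> `|mean P f| <= e.
Proof.
move=> mA PA bf fe e0; have bn := bounded_norm bf.
apply: (le_trans (mean_norm P bf)); rewrite -lee_fin meanE//.
rewrite (ge0_integral_full mA (prob_setC0 mA PA))//; last first.
  by apply: measurable_EFin_comp; have [] := bn.
rewrite -[leRHS](integral_cst1 _ (probability_setT P)).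
rewrite [leRHS](ge0_integral_full mA (prob_setC0 mA PA))//.
apply: ge0_le_integral => //.
by apply: measurable_funTS; apply: measurable_EFin_comp; have [] := bn.
Qed.

Lemma mean_pow_prod d (T : measurableType d) (R : realType) (P : probability T R)
    n (f : 'I_n -> T -> R) : (forall i, measurable_fun [set: T] (f i)) ->
  (forall i x, 0 <= f i x <= 1) ->
  mean (powprob P n) (fun z => \prod_(i < n) f i (tnth z i)) =
  \prod_(i < n) mean P (f i).
Proof.
move=> mf f01; have bf k (g : 'I_k -> T -> R) : (forall i, measurable_fun setT (g i)) ->
    (forall i x, 0 <= g i x <= 1) ->
    bounded_meas (fun z : k.-tuple T => \prod_(i < k) g i (tnth z i)) /\
    forall z : k.-tuple T, 0 <= \prod_(i < k) g i (tnth z i) <= 1.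
  move=> mg g01; apply: (@bounded_prod _ (k.-tuple T) R 'I_k xpredT
    (fun i z => g i (tnth z i))) => // i.
  by apply: measurableT_comp => //; exact: measurable_tnth.
have b1 (g : T -> R) : measurable_fun setT g -> (forall x, 0 <= g x <= 1) ->
    bounded_meas g.
  by move=> mg g01; split => //; exists 1 => x; have /andP[? ?] := g01 x; rewrite ger0_norm.
apply: EFin_inj; elim: n f mf f01 => [|n IH] f mf f01; have [bp p01] := bf _ f mf f01.
  rewrite meanE// /powprob (integral_pow0 P) ?big_ord0//.
  - by move=> t; rewrite lee_fin; have /andP[] := p01 t.
  - by apply: measurable_EFin_comp; have [] := bp.
rewrite meanE// /powprob (integral_powS P); last 2 first.
- by move=> t; rewrite lee_fin; have /andP[] := p01 t.
- by apply: measurable_EFin_comp; have [] := bp.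
have [bp' p01'] := bf _ (fun i => f (lift ord0 i)) (fun i => mf _) (fun i => f01 _).
have {}IH := IH (fun i => f (lift ord0 i)) (fun i => mf _) (fun i => f01 _).
rewrite big_ord_recl [mean P (f ord0) * _]mulrC EFinM -IH meanE// meanE//; last exact: b1.
rewrite -ge0_integralZl//; last 3 first.
- by apply: measurable_EFin_comp; exact: mf.
- by move=> x _; rewrite lee_fin; have /andP[] := f01 ord0 x.
- by apply: integral_ge0 => t _; rewrite lee_fin; have /andP[] := p01' t.
apply: eq_integral => a _; rewrite muleC -ge0_integralZl//; last 3 first.
- by apply: measurable_EFin_comp; have [] := bp'.
- by move=> t _; rewrite lee_fin; have /andP[] := p01' t.
- by rewrite lee_fin; have /andP[] := f01 ord0 a.
apply: eq_integral => t _; rewrite big_ord_recl -EFinM; congr (_ * _)%:E.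
by apply: eq_bigr => i _; rewrite tnthS.
Qed.

Section WeakLimit.
Context {R : realType}.
Variables (D : set (R * R)) (r : R) (k : nat).
Variables (mu : forall N, probability (N.-tuple (R * R)) R).
Variable sigma : probability (R * R)%type R.
Hypotheses (cD : closed D) (Dr : forall z, D z -> `|z.1| <= r /\ `|z.2| <= r).
Hypothesis sym : forall N (s : 'I_N -> 'I_N) (F : N.-tuple (R * R) -> \bar R),
  (0 < N)%N -> involutive s -> (forall z, 0 <= F z)%E ->
  measurable_fun [set: N.-tuple (R * R)] F ->
  (\int[mu N]_z F [tuple tnth z (s i) | i < N] = \int[mu N]_z F z)%E.
Hypothesis muD : forall N, (0 < N)%N -> mu N (cube D N) = 1%E.
Hypothesis sD : sigma D = 1%E.
Hypothesis avg : forall f, testfun f -> averaging mu sigma f.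
Hypothesis k0 : (0 < k)%N.

Local Notation corr n := (correlation (mu (k + n)%N)).
Local Notation pows := (powprob sigma k).

Let compD : compact D. Proof. exact: compact_plane cD Dr. Qed.
Let mD : measurable D. Proof. exact: closed_measurable2. Qed.

Lemma sum_tile (dl : R) : 0 < dl -> exists n x0, forall z, D z ->
  \sum_(c : 'I_n * 'I_n) tile dl x0 c.1 c.2 z = 1.
Proof.
move=> dl0; pose n := Num.bound (2 * `|r| / dl + 1).
exists n, (- r - dl) => z /Dr[h1 h2].
have r0 : `|r| = r by rewrite ger0_norm// (le_trans _ h1).
have H u : `|u| <= r -> \sum_(a < n) hat ((u - (- r - dl)) / dl - a%:R) = 1.
  rewrite ler_norml => /andP[u1 u2]; apply: sum_hat.
  have -> : (u - (- r - dl)) / dl = (u + r) / dl + 1 by field; rewrite gt_eqF.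
  apply/andP; split; first by rewrite lerDr divr_ge0// ?(ltW dl0)//; lra.
  apply: ltW; apply: le_lt_trans (archi_boundP _).
    by rewrite r0 lerD2r ler_wpM2r ?invr_ge0 ?(ltW dl0)//; lra.
  by rewrite addr_ge0// divr_ge0 ?mulr_ge0// ltW.
rewrite -(pair_bigA _ (fun a b : 'I_n => tile dl (- r - dl) a b z))/= /tile.
by rewrite -big_distrlr/= !H// mulr1.
Qed.

Lemma testfun_bounded f : testfun f ->
  measurable_fun [set: R * R] f /\ forall u, 0 <= f u <= 1.
Proof. by case. Qed.

(** Products of tiles form a partition of unity on the cube, on whose supports [f]
    is nearly constant. *)
Lemma product_approximation (f : {ptws 'I_k -> (R * R)%type} -> R) (e : R) :
  {within [set z : {ptws 'I_k -> (R * R)%type} | forall i, D (z i)], continuous f} ->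
  0 < e -> exists (J : finType) (a : J -> R) (chi : J -> 'I_k -> R * R -> R),
    (forall j l, testfun (chi j l)) /\ forall z : k.-tuple (R * R), cube D k z ->
    `|f (tnth z) - \sum_j a j * \prod_l chi j l (tnth z l)| <= e.
Proof.
move=> cf e0; have [dl dl0 H] := compact_cube_modulus compD cf e0.
have dl4 : 0 < dl / 4 by rewrite divr_gt0.
have [n [x0 sumt]] := sum_tile dl4.
pose t (c : 'I_n * 'I_n) := tile (dl / 4) x0 c.1 c.2.
have tP z w c : t c z != 0 -> t c w != 0 -> cabs (z - w) <= dl.
  move=> /(tile_neq0 dl4)[/andP[? ?] /andP[? ?]] /(tile_neq0 dl4)[/andP[? ?] /andP[? ?]].
  apply: (le_trans (cabs_le_sum _)); rewrite (_ : dl = dl / 2 + dl / 2); last by field.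
  by apply: lerD; rewrite ler_norml /=; apply/andP; split; lra.
(* [p c] is a point of the domain in the support of the tile [c], if any. *)
have [p pP] := choice (fun c : 'I_n * 'I_n => match pselect (exists z, D z /\ t c z != 0) with
  | left h => ex_intro (fun p => forall z, D z -> t c z != 0 -> D p /\ t c p != 0)
      (projT1 (cid h)) (fun z _ _ => projT2 (cid h))
  | right h => ex_intro _ (0 : R * R) (fun z Dz tz =>
      False_ind _ (h (ex_intro _ z (conj Dz tz)))) end).
exists {ffun 'I_k -> 'I_n * 'I_n},
  (fun j : {ffun 'I_k -> 'I_n * 'I_n} => f (fun l => p (j l))),
  (fun (j : {ffun 'I_k -> 'I_n * 'I_n}) l => t (j l)).
split=> [j l|z Dz]; first exact: testfun_tile.
pose w (j : {ffun 'I_k -> 'I_n * 'I_n}) := \prod_l t (j l) (tnth z l).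
have w0 j : 0 <= w j.
  by apply: prodr_ge0 => l _; have [_ h _ _] := testfun_tile x0 (j l).1 (j l).2 dl4;
    have /andP[] := h (tnth z l).
have w1 : \sum_j w j = 1.
  rewrite /w -(bigA_distr_bigA (fun l c => t c (tnth z l))) big1// => l _.
  exact: sumt.
have wE (c : R) : c = \sum_j c * w j by rewrite -mulr_sumr w1 mulr1.
rewrite [X in X - _]wE -sumrB [leRHS]wE.
apply: (le_trans (ler_norm_sum _ _ _)).
apply: ler_sum => j _.
rewrite [X in `|X|](_ : _ = (f (tnth z) - f (fun l => p (j l))) * w j); last first.
  by rewrite mulrBl.
rewrite normrM (ger0_norm (w0 j)).
have [->|wj] := eqVneq (w j) 0; first by rewrite !mulr0.
have tj l : t (j l) (tnth z l) != 0.
  by apply: contra wj => /eqP tl; rewrite /w (bigD1 l)//= tl mul0r.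
rewrite ler_wpM2r//; apply: H => // l; have [Dp tp] := pP _ _ (Dz l) (tj l) => //.
exact: tP (tj l) tp.
Qed.

(** A product over the first [k] points is integrated alike by the law of all
    points and by its marginal. *)
Lemma correlation_product (f : 'I_k -> R * R -> R) (e : R) :
  (forall l, testfun (f l)) -> 0 < e -> exists n0, forall n, (n0 <= n)%N ->
  `|mean (corr n) (fun z => \prod_l f l (tnth z l)) -
    mean pows (fun z => \prod_l f l (tnth z l))| <= e.
Proof.
move=> tf e0; pose f' (l : nat) := if insub l is Some i then f i else f (Ordinal k0).
have f'E (i : 'I_k) : f' i = f i by rewrite /f' valK.
have tf' l : testfun (f' l) by rewrite /f'; case: insub.
have [N0 H] := exchangeable_product sym (fun l => avg (tf' l)) k e0.
exists N0 => n N0n; have := H (k + n)%N (leq_trans N0n (leq_addl _ _)).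
have mf l := (testfun_bounded (tf l)).1; have f01 l := (testfun_bounded (tf l)).2.
rewrite mean_pow_prod//.
have -> : \prod_(l < k) mean sigma (f' l) = \prod_(i < k) mean sigma (f i).
  by apply: eq_bigr => i _; rewrite f'E.
suff -> : mean (mu (k + n)%N)
    (fun z => \prod_(l < k + n | (l < k)%N) f' l (tnth z l)) =
    mean (corr n) (fun z => \prod_l f l (tnth z l)) by [].
have [bp p01] := @bounded_prod _ (k.-tuple (R * R)) R 'I_k xpredT
  (fun l z => f l (tnth z l)) (fun l => measurableT_comp (mf l) (measurable_tnth l))
  (fun l z => f01 l (tnth z l)).
have pE z : \prod_(l < k + n | (l < k)%N) f' l (tnth z l) =
    \prod_l f l (tnth (initial z) l).
  rewrite big_split_ord/= [X in _ * X]big_pred0 ?mulr1; last first.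
    by move=> i; rewrite ltnNge leq_addr.
  rewrite (eq_bigl xpredT); last by move=> i /=; rewrite ltn_ord.
  by apply: eq_bigr => i _; rewrite tnth_mktuple f'E.
have bq : bounded_meas (fun z : (k + n).-tuple (R * R) =>
    \prod_l f l (tnth (initial z) l)).
  split; last by have [_ [B BP]] := bp; exists B => z.
  by apply: (measurableT_comp bp.1); exact: measurable_initial.
apply: EFin_inj; rewrite (_ : (fun z => _) = (fun z => \prod_l f l (tnth (initial z) l)));
  last by apply/funext => z; rewrite pE.
rewrite (meanE _ bq) (meanE _ bp) /correlation /distribution.
rewrite ge0_integral_pushforward//.
- by apply: measurable_EFin_comp; have [] := bp.
- by move=> z _; rewrite lee_fin; have /andP[] := p01 z.
Qed.

Let mK : measurable (cube D k).
Proof. exact: (measurable_cube_gen (fun=> mD)). Qed.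

Lemma pow_cube : (pows (cube D k) = 1)%E.
Proof.
rewrite [LHS](@measure_powE _ _ _ sigma k (fun=> D))//; apply: big1 => i _.
exact: sD.
Qed.

Lemma correlation_cube n : (corr n (cube D k) = 1)%E.
Proof.
apply/eqP; rewrite eq_le probability_le1//=.
rewrite -(muD (N := (k + n)%N)) ?addn_gt0 ?k0// /distribution /pushforward.
apply: le_measure; rewrite ?inE.
- exact: (measurable_cube_gen (fun=> mD)).
- by rewrite -[X in measurable X]setTI; exact: measurable_initial.
- by move=> z Dz i; rewrite tnth_mktuple.
Qed.

Lemma weak_limit : weakly_cvg_on D (fun n => corr n) (measure_pow sigma k).
Proof.
move=> f cf; pose g (z : k.-tuple (R * R)) : R := f (tnth z).
have app e : 0 < e -> exists F : k.-tuple (R * R) -> R, [/\ bounded_meas F,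
    (forall z, cube D k z -> `|g z - F z| <= e) &
    exists n0, forall n, (n0 <= n)%N -> `|mean (corr n) F - mean pows F| <= e].
  move=> e0; have [J [a [chi [tchi H]]]] := product_approximation cf e0.
  pose w j (z : k.-tuple (R * R)) := \prod_l chi j l (tnth z l).
  have bw j : bounded_meas (w j).
    have mf l := (testfun_bounded (tchi j l)).1.
    have f01 l := (testfun_bounded (tchi j l)).2.
    exact: (@bounded_prod _ (k.-tuple (R * R)) R 'I_k xpredT
      (fun l z => chi j l (tnth z l))
      (fun l => measurableT_comp (mf l) (measurable_tnth l))
      (fun l z => f01 l (tnth z l))).1.
  have baw j : bounded_meas (fun z => a j * w j z).
    by apply: boundedM => //; exact: bounded_cst.
  exists (fun z => \sum_j a j * w j z); split; [exact: bounded_sum|exact: H|].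
  pose A := \sum_j `|a j| + 1.
  have A0 : 0 < A by rewrite ltr_wpDl// sumr_ge0.
  have eA0 : 0 < e / A by rewrite divr_gt0.
  have [n0 n0P] := choice (fun j => correlation_product (tchi j) eA0).
  exists (\max_j n0 j)%N => n nn.
  rewrite !mean_sum// -sumrB (le_trans (ler_norm_sum _ _ _))//.
  apply: (@le_trans _ _ (\sum_j `|a j| * (e / A))).
    apply: ler_sum => j _; rewrite !meanZ// -mulrBr normrM ler_wpM2l//.
    by apply: n0P; apply: leq_trans nn; exact: leq_bigmax.
  rewrite -mulr_suml mulrCA ger_pMr// ler_pdivrMr// mul1r.
  by rewrite /A lerDl.
(* As a function of tuples, [f] is measurable on the cube because it is there a
   limit of sums of products of test functions. *)
pose G := g \_ (cube D k).
have bG : bounded_meas G.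
  split; last first.
    have [F [[_ [B BP]] FP _]] := app 1 ltr01.
    exists (B + 1) => z; rewrite /G patchE; case: ifPn; last first.
      by rewrite normr0 addr_ge0// (le_trans _ (BP z)).
    rewrite inE => Dz; rewrite -[g z](subrK (F z)) (le_trans (ler_normD _ _))//.
    by rewrite addrC lerD// FP.
  have [F FP] := choice (fun n : nat => app n.+1%:R^-1 ltac:(by rewrite invr_gt0)).
  apply/(measurable_restrictT _ mK).
  apply: (@measurable_fun_cvg _ _ _ _ F) => [n|z Dz].
    by apply: measurable_funTS; have [[]] := FP n.
  apply/cvgrPdist_le => e e0; near=> n; have [_ h _] := FP n.
  apply: (le_trans (h z Dz)); apply: ltW; near: n; exact: (near_infty_natSinv_lt (PosNum e0)).
have IG (P : probability (k.-tuple (R * R)) R) :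
    (\int[P]_(z in cube D k) (f (tnth z))%:E = (mean P G)%:E)%E.
  by rewrite meanE// integral_mkcond; apply: eq_integral => z _; rewrite /G !patchE; case: ifP.
under eq_fun do rewrite IG.
rewrite (IG pows); apply/cvg_EFin; first by near=> n.
apply/cvgrPdist_le => e e0; have e30 : 0 < e / 3 by rewrite divr_gt0.
have [F [bF FP [n0 n0P]]] := app _ e30.
have close (P : probability (k.-tuple (R * R)) R) : (P (cube D k) = 1)%E ->
    `|mean P G - mean P F| <= e / 3.
  move=> P1; rewrite -meanB//.
  apply: (mean_le_on mK P1); [exact: boundedB| |exact: ltW].
  by move=> z Dz; rewrite /G patchE mem_set// FP.
near=> n; have h1 := close _ (correlation_cube n); have h2 := close _ pow_cube.
have h3 : `|mean (corr n) F - mean pows F| <= e / 3.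
  by apply: n0P; near: n; exact: nbhs_infty_ge.
move: h1 h2 h3 => /=; rewrite !ler_norml.
move: (mean _ _) (mean _ _) (mean _ _) (mean _ _) => x1 x2 x3 x4.
by move=> /andP[? ?] /andP[? ?] /andP[? ?]; apply/andP; split; lra.
Unshelve. all: by end_near. Qed.

End WeakLimit.

(** * Circles, rays and null sets *)

(** Intervals of total length [e] that cover [S] are mapped into intervals of total
    length [2 * L * e]. *)
Lemma lipschitz_null (R : realType) (f : R -> R) (a b L : R) (S B : set R) :
  0 <= L -> (forall x y, a <= x <= b -> a <= y <= b -> `|f x - f y| <= L * `|x - y|) ->
  measurable S -> lebesgue_measure S = 0%E -> measurable B ->
  (forall s, B s -> exists x, [/\ S x, a <= x <= b & f x = s]) ->
  lebesgue_measure B = 0%E.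
Proof.
move=> L0 fL mS S0 mB BS; apply/eqP; rewrite eq_le measure_ge0 andbT.
have : (ereal_inf [set \sum_(k <oo) (@wlength R idfun) (F k) | F in open_itv_cover S] = 0)%E.
  by rewrite -outer_measure_open_itv_cover -[RHS]S0.
move=> inf0; apply/lee_addgt0Pr => e e0; rewrite add0e.
have e1 : 0 < e / (2 * L + 1) by rewrite divr_gt0// ltr_wpDl// mulr_ge0.
have inffin : (ereal_inf [set \sum_(k <oo) (@wlength R idfun) (F k) |
  F in open_itv_cover S] \is a fin_num)%E by rewrite inf0.
have := lb_ereal_inf_adherent e1 inffin; rewrite inf0 add0e.
move=> [_ [F [Fitv SF] <-] Fe].
have [c cP] := choice Fitv.
pose len k := Num.max 0 ((c k).2 - (c k).1).
have len0 k : 0 <= len k by rewrite le_max lexx.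
have lE k : (@wlength R idfun (F k) = (len k)%:E)%E.
  rewrite (cP k) wlength_itv/= lte_fin /len; case: ltP => h.
    by rewrite -EFinB max_r// subr_ge0 ltW.
  by rewrite max_l// subr_le0.
(* [t k] is a point of [F k] between [a] and [b], if any. *)
have [t tP] := choice (fun k => match pselect (exists x, F k x /\ a <= x <= b) with
  | left h => ex_intro (fun t => forall x, F k x -> a <= x <= b -> F k t /\ a <= t <= b)
      (projT1 (cid h)) (fun _ _ _ => projT2 (cid h))
  | right h => ex_intro _ 0 (fun x Fx xab => False_ind _ (h (ex_intro _ x (conj Fx xab)))) end).
pose G k := `[f (t k) - L * len k, f (t k) + L * len k]%classic.
have BG : B `<=` \bigcup_k G k.
  move=> s /BS[x [Sx xab <-]]; have [k _ Fkx] := SF x Sx; exists k => //.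
  have [Fkt tab] := tP k x Fkx xab.
  have h : `|f x - f (t k)| <= L * len k.
    apply: (le_trans (fL _ _ xab tab)); rewrite ler_wpM2l//.
    move: Fkx Fkt; rewrite (cP k)/= !in_itv/= => /andP[? ?] /andP[? ?].
    rewrite /len le_max; apply/orP; right.
    by rewrite ler_norml; apply/andP; split; lra.
  by move: h; rewrite ler_norml /G/= in_itv/= => /andP[? ?]; apply/andP; split; lra.
have mG k : measurable (G k) by exact: measurable_itv.
apply: (le_trans (measure_sigma_subadditive lebesgue_measure mG mB BG)).
have GE k : (lebesgue_measure (G k) = (2 * L)%:E * (@wlength R idfun (F k)))%E.
  rewrite /G [LHS]lebesgue_measure_itv/= lte_fin lE -EFinM.
  have Ll : 0 <= L * len k by rewrite mulr_ge0.
  case: ltP => h; first by rewrite -EFinB; congr EFin; ring.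
  by congr EFin; lra.
rewrite (eq_eseriesr (fun k _ => GE k)) nneseriesZl; last first.
  by move=> k _; rewrite lE lee_fin.
apply: (@le_trans _ _ ((2 * L)%:E * (e / (2 * L + 1))%:E)%E).
  by rewrite lee_wpmul2l ?lee_fin ?mulr_ge0// ltW.
have L1 : 0 < 2 * L + 1 by rewrite ltr_wpDl// mulr_ge0.
rewrite -EFinM lee_fin mulrA ler_pdivrMr// mulrC ler_wpM2l ?(ltW e0)//.
by rewrite lerDl.
Qed.

Lemma lipschitz_within (R : realType) (f : R -> R) (a b L : R) : 0 <= L ->
  (forall x y, a <= x <= b -> a <= y <= b -> `|f x - f y| <= L * `|x - y|) ->
  {within `[a, b], continuous f}.
Proof.
move=> L0 fL; apply/subspace_continuousP => x xab.
apply/cvgrPdist_le => e e0; have L1 : 0 < L + 1 by rewrite ltr_wpDl.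
rewrite near_withinE; apply/nbhs_ballP; exists (e / (L + 1)); first by rewrite /= divr_gt0.
move=> y; rewrite /ball/= => xy yab; move: xab yab; rewrite /= !in_itv/= => xab yab.
apply: (le_trans (fL _ _ xab yab)); apply: (@le_trans _ _ (L * (e / (L + 1)))).
  by rewrite ler_wpM2l// ltW.
by rewrite mulrA ler_pdivrMr// mulrC ler_wpM2l ?(ltW e0)// lerDl.
Qed.

Section Circles.
Context {R : realType}.
Implicit Types (z w p : R * R) (U : set (R * R)).

Lemma cabs_polar (r t : R) : cabs (polar r t) = `|r|.
Proof.
rewrite /cabs /polar/= !exprMn -mulrDr cos2Dsin2 mulr1.
by rewrite sqrtr_sqr.
Qed.

Lemma polarB (r s t : R) : polar r t - polar s t = polar (r - s) t.
Proof. by rewrite /polar !mulrBl. Qed.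

Lemma cabsZ (r x y : R) : cabs (r * x, r * y) = `|r| * cabs (x, y).
Proof. by rewrite /cabs/= !exprMn -mulrDr sqrtrM ?sqr_ge0// sqrtr_sqr. Qed.

Lemma polarE w : exists2 t, 0 <= t < 2 * pi & w = polar (cabs w) t.
Proof.
have p0 := @pi_gt0 R.
have [w0|w0] := eqVneq (cabs w) 0.
  exists 0; first by rewrite lexx mulr_gt0.
  move/eqP: w0; rewrite cabs_eq0 => /eqP ->.
  by rewrite cabs0 /polar !mul0r.
have r0 : 0 < cabs w by rewrite lt_def w0 cabs_ge0.
set r := cabs w in w0 r0 *; pose x := w.1 / r; pose y := w.2 / r.
have xy : x ^+ 2 + y ^+ 2 = 1.
  rewrite /x /y !expr_div_n -mulrDl -cabs_sqr -/r divff// expf_neq0//.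
have wE : w = (r * x, r * y).
  rewrite [LHS]surjective_pairing /x /y.
  by congr pair; rewrite mulrC divfK.
have x1 : -1 <= x <= 1.
  rewrite -ler_norml -(@ler_pXn2r _ 2)// ?nnegrE// expr1n real_normK ?num_real//.
  by rewrite -xy lerDl sqr_ge0.
have [ac1 ac2] := acos_def x1.
have /andP[ac0 acpi] := ac1.
have sy : sin (acos x) = `|y|.
  by rewrite sin_acos// -xy addrAC subrr add0r sqrtr_sqr.
have [y0|y0] := leP 0 y.
  exists (acos x); first by rewrite ac0/=; lra.
  by rewrite {1}wE /polar ac2 sy ger0_norm.
exists (2 * pi - acos x).
  rewrite subr_ge0 (le_trans acpi)/=; last by lra.
  rewrite ltrBlDr ltrDl lt_def ac0 andbT; apply: contraTneq y0 => ac00.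
  by move: sy; rewrite ac00 sin0 => /esym/eqP; rewrite normr_eq0 => /eqP ->; rewrite ltxx.
have c2 : cos (2 * pi - acos x) = x.
  by rewrite cosB mulr_natl cos2pi sin2pi mul1r mul0r addr0.
have s2 : sin (2 * pi - acos x) = y.
  rewrite sinB mulr_natl cos2pi sin2pi mul0r mul1r add0r sy ltr0_norm// opprK//.
by rewrite {1}wE /polar c2 s2.
Qed.

Lemma continuous_polar1 (t0 e : R) : 0 < e -> exists2 d, 0 < d &
  forall t, `|t - t0| < d -> cabs (polar 1 t - polar 1 t0) < e.
Proof.
move=> e0; have e20 : 0 < e / 2 by rewrite divr_gt0.
have /cvgrPdist_lt/(_ _ e20)/nbhs_ballP[d1 /= d10 h1] := @continuous_cos R t0.
have /cvgrPdist_lt/(_ _ e20)/nbhs_ballP[d2 /= d20 h2] := @continuous_sin R t0.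
exists (Num.min d1 d2); first by rewrite lt_min d10.
move=> t; rewrite lt_min => /andP[t1 t2].
apply: le_lt_trans (cabs_le_sum _) _; rewrite /polar/= !mul1r.
have := h1 t; rewrite /ball/= distrC => /(_ t1); rewrite distrC => ?.
have := h2 t; rewrite /ball/= distrC => /(_ t2); rewrite distrC => ?.
by rewrite (_ : e = e / 2 + e / 2) ?ltrD//; field.
Qed.

Definition dot z w : R := z.1 * w.1 + z.2 * w.2.

(** The condition says that [p] is not the origin and that the ray through [p] is
    not tangent to the circle around [z0]. If it failed at the angles [t0], [t0 + h] and
    [t0 - h] on the circle, a linear combination of the three equations would
    give [cos h = 1]. *)
Lemma generic_circle_point U z0 p0 : open U -> U p0 -> 0 < cabs (p0 - z0) ->
  exists p, [/\ U p, cabs (p - z0) = cabs (p0 - z0) & dot p (p - z0) != 0].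
Proof.
move=> oU Up0 s00; set s := cabs _ in s00 *.
have [t0 _ pE] := polarE (p0 - z0); rewrite -/s in pE.
have /nbhs_cabsP[d d0 dU] : nbhs p0 U by exact: open_nbhs_nbhs.
have [d' d'0 h'] := continuous_polar1 t0 (divr_gt0 d0 s00).
pose h := Num.min 1 (d' / 2).
have h0 : 0 < h by rewrite lt_min ltr01 divr_gt0.
have hd' : h < d' by rewrite gt_min ltr_pdivrMr// ltr_pMr// ltr1n orbT.
have cosh : cos h != 1.
  have hpi : h \in `[0, pi].
    rewrite in_itv/= (ltW h0) (le_trans _ (pi_ge2 R))// (@le_trans _ _ 1)//.
      by rewrite ge_min lexx.
    by rewrite ler1n.
  apply/eqP => c1; have := cosK hpi; rewrite c1 acos1 => hh.
  by rewrite -hh ltxx in h0.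
pose P t := z0 + polar s t.
have UP t : `|t - t0| < d' -> U (P t).
  move=> tt; apply: dU; rewrite cabsB.
  have -> : P t - p0 = polar s t - polar s t0.
    by rewrite -pE opprB /P -addrA addrCA.
  have -> : polar s t - polar s t0 = (s * (polar 1 t - polar 1 t0).1,
      s * (polar 1 t - polar 1 t0).2).
    by rewrite /polar; congr pair => /=; ring.
  rewrite cabsZ ger0_norm ?(ltW s00)// -surjective_pairing.
  by rewrite -ltr_pdivlMl// mulrC; exact: h'.
have cP t : cabs (P t - z0) = s by rewrite /P addrAC subrr add0r cabs_polar gtr0_norm.
apply: contrapT => hn.
have bad t : `|t - t0| < d' -> s + z0.1 * cos t + z0.2 * sin t = 0.
  move=> tt; have : dot (P t) (P t - z0) = 0.
    by apply/eqP/negPn/negP => nz; apply: hn; exists (P t); split; [exact: UP|exact: cP|].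
  rewrite {2}/P addrAC subrr add0r /dot /P /polar/=.
  have -> : (z0.1 + s * cos t) * (s * cos t) + (z0.2 + s * sin t) * (s * sin t) =
    s * (z0.1 * cos t + z0.2 * sin t + s * (cos t ^+ 2 + sin t ^+ 2)) by ring.
  rewrite cos2Dsin2 mulr1 => /eqP; rewrite mulf_eq0 gt_eqF//= => /eqP E.
  by rewrite -E; ring.
have b0 := bad t0; have b1 := bad (t0 + h); have b2 := bad (t0 - h).
rewrite subrr normr0 d'0 in b0.
rewrite addrAC subrr add0r gtr0_norm// hd' in b1.
rewrite addrAC subrr add0r normrN gtr0_norm// hd' in b2.
have {}b0 := b0 isT; have {}b1 := b1 isT; have {}b2 := b2 isT.
rewrite cosD sinD in b1; rewrite cosB sinB in b2.
have : 2 * s * (1 - cos h) = 0.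
  transitivity ((s + z0.1 * (cos t0 * cos h - sin t0 * sin h) +
    z0.2 * (sin t0 * cos h + cos t0 * sin h)) +
    (s + z0.1 * (cos t0 * cos h + sin t0 * sin h) +
    z0.2 * (sin t0 * cos h - cos t0 * sin h)) -
    2 * cos h * (s + z0.1 * cos t0 + z0.2 * sin t0)); first by ring.
  by rewrite b0 b1 b2 mulr0 !addr0 subrr.
move/eqP; rewrite mulf_eq0 => /orP[|].
  by rewrite mulf_eq0 pnatr_eq0/= gt_eqF.
by rewrite subr_eq0 eq_sym (negbTE cosh).
Qed.

(** The distance to [z0] takes arbitrarily small values on [U], but it is not small
    at both of two fixed points of [U]; by connectedness it takes all values in
    between. *)
Lemma circles_meet U : open U -> connected U -> U !=set0 ->
  exists2 d0, 0 < d0 & forall z0 s, closure U z0 -> 0 < s -> s <= d0 ->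
    exists2 p, U p & cabs (p - z0) = s.
Proof.
move=> oU cU [a Ua].
have /nbhs_cabsP[e e0 eU] : nbhs a U by exact: open_nbhs_nbhs.
pose b : R * R := (a.1 + e / 2, a.2).
have ab : cabs (a - b) = e / 2.
  rewrite /cabs /b/= subrr expr0n/= addr0 sqrtr_sqr opprD addrA subrr add0r normrN.
  by rewrite gtr0_norm// divr_gt0.
have Ub : U b by apply: eU; rewrite ab ltr_pdivrMr// ltr_pMr// ltr1n.
exists (e / 8); first by rewrite divr_gt0.
move=> z0 s Uz0 s0 se.
have [u [Uu us]] : exists u, U u /\ cabs (u - z0) < s.
  have [|u [Uu us]] := Uz0 [set u | cabs (u - z0) < s]; last by exists u.
  by apply/nbhs_cabsP; exists s => // w; rewrite cabsB.
have [v [Uv vs]] : exists v, U v /\ s < cabs (v - z0).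
  apply: contrapT => hn.
  have ha : cabs (a - z0) <= s by rewrite leNgt; apply/negP => h; apply: hn; exists a.
  have hb : cabs (b - z0) <= s by rewrite leNgt; apply/negP => h; apply: hn; exists b.
  have : cabs (a - b) <= cabs (a - z0) + cabs (z0 - b) by exact: cabs_triangle.
  rewrite ab [cabs (z0 - b)]cabsB; lra.
have cf : {within U, continuous (fun p => cabs (p - z0))}.
  apply: continuous_subspaceT => p; apply: (@continuous_comp _ _ _ (fun p => p - z0) cabs).
    by apply: continuousB => //; exact: cst_continuous.
  exact: continuous_cabs.
have /connected_intervalP/(_ _ _ (ex_intro2 _ _ u Uu erefl) (ex_intro2 _ _ v Uv erefl) s) :=
  connected_continuous_connected cU cf.
by rewrite (ltW us) (ltW vs) => /(_ isT)[p Up ps]; exists p.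
Qed.

Section Rays.
Variables (rad : R -> R) (a : R).
Hypothesis rad_inc : forall x y, a < x -> x < y -> 0 < rad x < rad y.
Hypothesis rad_onto : forall r, 0 < r -> exists2 x, a < x & rad x = r.
Hypothesis rad_lip : forall x1 x2, a < x1 -> exists2 L, 0 <= L &
  forall x y, x1 <= x <= x2 -> x1 <= y <= x2 -> `|rad x - rad y| <= L * `|x - y|.

Lemma polar_ray_lip x1 x2 z0 t : a < x1 -> exists2 L, 0 <= L &
  forall x y, x1 <= x <= x2 -> x1 <= y <= x2 ->
  `|cabs (polar (rad x) t - z0) - cabs (polar (rad y) t - z0)| <= L * `|x - y|.
Proof.
move=> ax1; have [L L0 LP] := rad_lip x2 ax1; exists L => // x y hx hy.
apply: le_trans (LP _ _ hx hy).
rewrite -[leRHS](cabs_polar _ t) -polarB; apply: (le_trans (cabs_dist _ _)).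
by rewrite opprB addrA subrK.
Qed.

Let rad_le x y : a < x -> x <= y -> rad x <= rad y.
Proof.
move=> ax; rewrite le_eqVlt => /orP[/eqP -> //|xy].
by have /andP[_ /ltW] := rad_inc ax xy.
Qed.

(** Where the ray through [p] is not tangent to the circle, the distance to [z0] is
    strictly monotone along the ray. The end points of a short segment around
    [p] are then on different sides of the circle, with a margin that persists
    for nearby rays and circles. *)
Lemma rays_cross U z0 p : open U -> U p -> dot p (p - z0) != 0 ->
  exists x1 x2 t0 e, [/\ a < x1, x1 <= x2, 0 <= t0, 0 < e & t0 + e <= 2 * pi] /\
    forall t, t0 <= t < t0 + e ->
      (forall x, x1 <= x <= x2 -> U (polar (rad x) t)) /\
      forall s, `|s - cabs (p - z0)| < e ->
        exists2 x, x1 <= x <= x2 & cabs (polar (rad x) t - z0) = s.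
Proof.
move=> oU Up nz; have [t0 /andP[t00 t01] pE] := polarE p.
set R0 := cabs p in pE; set s0 := cabs (p - z0).
(* On the line carrying the ray, [c] is the signed radius of the point closest to
   [z0]. *)
pose c := z0.1 * cos t0 + z0.2 * sin t0.
have R00 : 0 < R0.
  rewrite lt_def cabs_ge0 andbT; apply: contra nz; rewrite cabs_eq0 => /eqP ->.
  by rewrite /dot/= !mul0r addr0.
have Rc : R0 != c.
  apply: contra nz => /eqP Rc; rewrite pE /dot /polar/=.
  have -> : R0 * cos t0 * (R0 * cos t0 - z0.1) + R0 * sin t0 * (R0 * sin t0 - z0.2) =
    R0 * (R0 * (cos t0 ^+ 2 + sin t0 ^+ 2) - c) by rewrite /c; ring.
  by rewrite cos2Dsin2 mulr1 -Rc subrr mulr0.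
have /nbhs_cabsP[eta eta0 eU] : nbhs p U by exact: open_nbhs_nbhs.
pose g r t := cabs (polar r t - z0).
have gE r : g r t0 ^+ 2 = (r - c) ^+ 2 + (cabs z0 ^+ 2 - c ^+ 2).
  rewrite /g !cabs_sqr /polar/=.
  have -> : (r * cos t0 - z0.1) ^+ 2 + (r * sin t0 - z0.2) ^+ 2 =
    r ^+ 2 * (cos t0 ^+ 2 + sin t0 ^+ 2) - 2 * r * c + (z0.1 ^+ 2 + z0.2 ^+ 2).
    by rewrite /c; ring.
  by rewrite cos2Dsin2; ring.
have g_lt r r' : `|r - c| < `|r' - c| -> g r t0 < g r' t0.
  move=> h; rewrite -ltr_sqr ?nnegrE ?cabs_ge0// !gE ltrD2r.
  by rewrite -[ltLHS]real_normK ?num_real// -[ltRHS]real_normK ?num_real// ltr_sqr ?nnegrE.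
have gR0 : g R0 t0 = s0 by rewrite /g -pE.
have Rcn : 0 < `|R0 - c| by rewrite normr_gt0 subr_eq0.
pose h := Num.min (eta / 2) (Num.min (R0 / 2) `|R0 - c|).
have h0 : 0 < h by rewrite !lt_min !divr_gt0.
have [heta hR hc] : [/\ h <= eta / 2, h <= R0 / 2 & h <= `|R0 - c|].
  by split; rewrite /h !ge_min lexx ?orbT.
have [x1 ax1 rx1] : exists2 x, a < x & rad x = R0 - h by apply: rad_onto; lra.
have [x2 ax2 rx2] : exists2 x, a < x & rad x = R0 + h by apply: rad_onto; lra.
have x12 : x1 <= x2.
  rewrite leNgt; apply/negP => x21; have /andP[_] := rad_inc ax2 x21; rewrite rx1 rx2; lra.
have [k k0 straddle] : exists2 k, 0 < k &
    (g (R0 - h) t0 <= s0 - 2 * k /\ s0 + 2 * k <= g (R0 + h) t0) \/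
    (g (R0 + h) t0 <= s0 - 2 * k /\ s0 + 2 * k <= g (R0 - h) t0).
  have [Rgc|Rlc|Req] := ltgtP c R0; last by rewrite Req eqxx in Rc.
    have h1 : g (R0 - h) t0 < s0.
      by rewrite -gR0; apply: g_lt; rewrite gtr0_norm in hc *; rewrite ?ger0_norm; lra.
    have h2 : s0 < g (R0 + h) t0.
      by rewrite -gR0; apply: g_lt; rewrite !gtr0_norm; lra.
    exists (Num.min (s0 - g (R0 - h) t0) (g (R0 + h) t0 - s0) / 2).
      by rewrite divr_gt0// lt_min !subr_gt0 h1.
    left; rewrite mulrC divfK//; split.
      by rewrite lerBrDr -lerBrDl ge_min lexx.
    by rewrite -lerBrDl ge_min lexx orbT.
  have h1 : g (R0 + h) t0 < s0.
    by rewrite -gR0; apply: g_lt; rewrite ltr0_norm in hc *; rewrite ?ler0_norm; lra.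
  have h2 : s0 < g (R0 - h) t0.
    by rewrite -gR0; apply: g_lt; rewrite !ltr0_norm; lra.
  exists (Num.min (s0 - g (R0 + h) t0) (g (R0 - h) t0 - s0) / 2).
    by rewrite divr_gt0// lt_min !subr_gt0 h1.
  right; rewrite mulrC divfK//; split.
    by rewrite lerBrDr -lerBrDl ge_min lexx.
  by rewrite -lerBrDl ge_min lexx orbT.
pose k' := Num.min k (eta / 2).
have k'0 : 0 < k' by rewrite lt_min k0 divr_gt0.
have Rh0 : 0 < R0 + h by rewrite addr_gt0.
have [d d0 dP] := continuous_polar1 t0 (divr_gt0 k'0 Rh0).
pose e := Num.min (Num.min d k) (2 * pi - t0).
have e0 : 0 < e by rewrite !lt_min d0 k0 subr_gt0.
have [ed ek e2] : [/\ e <= d, e <= k & e <= 2 * pi - t0].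
  by split; rewrite /e !ge_min lexx ?orbT.
exists x1, x2, t0, e; split; first by split=> //; lra.
move=> t /andP[t0t te].
have q r : 0 <= r <= R0 + h -> cabs (polar r t - polar r t0) < k'.
  move=> /andP[r0 rR].
  have -> : polar r t - polar r t0 = (r * (polar 1 t - polar 1 t0).1,
      r * (polar 1 t - polar 1 t0).2).
    by rewrite /polar; congr pair => /=; ring.
  rewrite cabsZ -surjective_pairing ger0_norm//.
  have h1 : cabs (polar 1 t - polar 1 t0) < k' / (R0 + h).
    by apply: dP; rewrite ger0_norm; lra.
  apply: (@le_lt_trans _ _ ((R0 + h) * cabs (polar 1 t - polar 1 t0))).
    by rewrite ler_wpM2r ?cabs_ge0.
  by rewrite mulrC -ltr_pdivlMr.
have radR x : x1 <= x <= x2 -> R0 - h <= rad x <= R0 + h.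
  move=> /andP[h1 h2]; rewrite -rx1 -rx2 !rad_le//.
  exact: lt_le_trans h1.
split=> [x hx|s hs].
  have /andP[r1 r2] := radR x hx.
  apply: eU; rewrite cabsB pE.
  have : cabs (polar (rad x) t - polar R0 t0) <= cabs (polar (rad x) t - polar (rad x) t0) +
     cabs (polar (rad x) t0 - polar R0 t0) by exact: cabs_triangle.
  move=> /le_lt_trans; apply; rewrite polarB cabs_polar.
  have : cabs (polar (rad x) t - polar (rad x) t0) < k' by apply: q; apply/andP; split; lra.
  have : k' <= eta / 2 by rewrite ge_min lexx orbT.
  have : `|rad x - R0| <= h by rewrite ler_norml; apply/andP; split; lra.
  lra.
have gq r : 0 <= r <= R0 + h -> `|g r t - g r t0| < k'.
  move=> hr; apply: le_lt_trans (q r hr); rewrite /g.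
  have -> : polar r t - polar r t0 = (polar r t - z0) - (polar r t0 - z0).
    by rewrite opprB addrA subrK.
  exact: cabs_dist.
have g1 := gq (R0 - h) ltac:(apply/andP; split; lra).
have g2 := gq (R0 + h) ltac:(apply/andP; split; lra).
have kk : k' <= k by rewrite ge_min lexx.
have [L L0 LP] := polar_ray_lip x2 z0 t ax1.
have cg : {within `[x1, x2], continuous (fun x => cabs (polar (rad x) t - z0))}.
  exact: lipschitz_within LP.
have [] := IVT x12 cg (v := s); rewrite ?rx1 ?rx2 -/(g (R0 - h) t) -/(g (R0 + h) t).
  move: g1 g2 hs straddle kk; move: (g _ _) (g _ _) (g _ _) (g _ _).
  move=> {}g1 {}g2 {}g3 {}g4; rewrite !ltr_norml -/s0 => /andP[? ?] /andP[? ?] /andP[? ?] straddle kk.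
  by rewrite ge_min le_max; case: straddle => -[? ?]; apply/andP; split; apply/orP;
    [left|right|right|left]; lra.
by move=> x; rewrite in_itv/= => hx xs; exists x.
Qed.

End Rays.

End Circles.

(** * The radius and images of densities *)

Lemma horner_lipschitz (R : realType) (p : {poly R}) (a b : R) :
  exists2 L, 0 <= L & (forall x, a <= x <= b -> `|p.[x]| <= L) /\
  forall x y, a <= x <= b -> a <= y <= b -> `|p.[x] - p.[y]| <= L * `|x - y|.
Proof.
elim/poly_ind: p => [|p c [L L0 [Lb Ll]]].
  exists 0 => //; split=> [x _|x y _ _]; rewrite !horner0 ?normr0//.
  by rewrite subrr normr0 mul0r.
pose M := `|a| + `|b|.
have M0 : 0 <= M by rewrite addr_ge0.
have xM x : a <= x <= b -> `|x| <= M.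
  move=> /andP[ax xb]; rewrite /M ler_norml.
  have := ler_norm b; have := ler_norm (- a); rewrite normrN.
  have := normr_ge0 a; have := normr_ge0 b.
  by move=> ? ? ? ?; apply/andP; split; lra.
have ML : 0 <= L * M by rewrite mulr_ge0.
have c0 := normr_ge0 c.
exists (L * M + `|c| + L); first by rewrite !addr_ge0.
split=> [x xab|x y xab yab]; rewrite !hornerE.
  apply: (le_trans (ler_normD _ _)); rewrite normrM.
  have : `|p.[x]| * `|x| <= L * M by rewrite ler_pM ?Lb ?xM.
  lra.
have -> : p.[x] * x + c - (p.[y] * y + c) = p.[x] * (x - y) + (p.[x] - p.[y]) * y.
  by ring.
apply: (le_trans (ler_normD _ _)); rewrite !normrM.
have h1 : `|p.[x]| * `|x - y| <= L * `|x - y| by rewrite ler_wpM2r ?Lb.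
have h2 : `|p.[x] - p.[y]| * `|y| <= L * `|x - y| * M by rewrite ler_pM ?Ll ?xM.
have h3 : 0 <= `|c| * `|x - y| by rewrite mulr_ge0.
have -> : (L * M + `|c| + L) * `|x - y| = L * `|x - y| * M + `|c| * `|x - y| + L * `|x - y|.
  by ring.
lra.
Qed.

Lemma measurable_horner (R : realType) (p : {poly R}) :
  measurable_fun [set: R] (fun x => p.[x]).
Proof.
elim/poly_ind: p => [|p c IH].
  by rewrite (_ : horner 0 = fun=> 0)//; apply/funext => x; rewrite horner0.
under eq_fun do rewrite !hornerE.
by apply: measurable_funD => //; exact: measurable_funM.
Qed.

Section Radius.
Context {R : realType} (m : nat) (alpha : 'I_m -> R).
Hypothesis m0 : (0 < m)%N.

Local Notation a := (- inf (range alpha)).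
Local Notation Q := (Qpoly alpha).

Definition radius x : R := Num.sqrt Q.[x].

Lemma inf_alpha : (forall i, inf (range alpha) <= alpha i) /\
  exists i, alpha i = inf (range alpha).
Proof.
have lb : has_lbound (range alpha).
  exists (- \sum_i `|alpha i|) => _ [i _ <-]; rewrite lerNl.
  apply: (@le_trans _ _ `|alpha i|); first by rewrite -normrN ler_norm.
  by rewrite (bigD1 i)//= lerDl sumr_ge0.
have h i : inf (range alpha) <= alpha i by apply: ge_inf => //; exists i.
split=> //; pose i0 := [arg min_(i < Ordinal m0) alpha i]%O.
exists i0; apply/eqP; rewrite eq_le h andbT; apply: lb_le_inf.
  by exists (alpha i0), i0.
move=> _ [j _ <-]; rewrite /i0; case: arg_minP => // i _; exact.
Qed.

Let alphaP x i : a < x -> 0 < x + alpha i.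
Proof. by move=> ax; have := inf_alpha.1 i; lra. Qed.

Lemma Qpoly_eval x : Q.[x] = \prod_(i < m) (x + alpha i).
Proof. by rewrite horner_prod; apply: eq_bigr => i _; rewrite !hornerE. Qed.

Lemma Qpoly_inc x y : a < x -> x < y -> 0 < Q.[x] < Q.[y].
Proof.
move=> ax xy; rewrite !Qpoly_eval; apply/andP; split.
  by apply: prodr_gt0 => i _; exact: alphaP.
apply: ltr_prod.
  by apply/hasP; exists (Ordinal m0) => //; exact: mem_index_enum.
by move=> i _; have := alphaP i ax; rewrite ltrD2r xy => /ltW ->.
Qed.

Lemma Qpoly_deriv_gt0 x : a < x -> 0 < (Q^`()).[x].
Proof.
move=> ax; pose P (p : {poly R}) := 0 < p.[x] /\ 0 <= (p^`()).[x].
have step i (p : {poly R}) : P p -> 0 < ((('X + (alpha i)%:P) * p)^`()).[x].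
  move=> [p0 p'0]; rewrite derivM derivD derivX derivC addr0 mul1r !hornerE.
  by rewrite ltr_pwDl// mulr_ge0// ltW// alphaP.
have Pp (s : seq 'I_m) : P (\prod_(i <- s) ('X + (alpha i)%:P)).
  elim: s => [|i s IH]; first by rewrite big_nil /P derivC !hornerE; split.
  rewrite big_cons; split; last exact/ltW/step.
  by rewrite hornerM mulr_gt0// ?IH.1// !hornerE alphaP.
rewrite /Qpoly; case: (index_enum _) (mem_index_enum (Ordinal m0)) => [//|i s _].
by rewrite big_cons step.
Qed.

Lemma Qpoly_ge x : 1 <= x - a -> x - a <= Q.[x].
Proof.
move=> xa; have [h [i iE]] := inf_alpha.
rewrite Qpoly_eval (bigD1 i)//= iE opprK in xa *.
rewrite -[leLHS]mulr1 ler_wpM2l//; first exact: le_trans xa.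
apply: (big_ind (fun y => 1 <= y)) => // [y z y1 z1|j _].
  by rewrite -[1]mulr1 ler_pM.
by apply: (le_trans xa); rewrite lerD2l.
Qed.

Lemma Qpoly_min : Q.[a] = 0.
Proof.
by have [_ [i iE]] := inf_alpha; rewrite Qpoly_eval (bigD1 i)//= iE addrC subrr mul0r.
Qed.

Lemma radius_inc x y : a < x -> x < y -> 0 < radius x < radius y.
Proof.
move=> ax xy; have /andP[h1 h2] := Qpoly_inc ax xy.
by rewrite sqrtr_gt0 h1 ltr_sqrt// (lt_trans h1).
Qed.

Lemma radius_onto r : 0 < r -> exists2 x, a < x & radius x = r.
Proof.
move=> r0; pose b := a + Num.max 1 (r ^+ 2).
have ab : a <= b by rewrite lerDl le_max ler01.
have Qb : r ^+ 2 <= Q.[b].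
  apply: le_trans (Qpoly_ge _); rewrite /b addrAC subrr add0r le_max ?lexx ?orbT//.
have [L L0 [_ LP]] := horner_lipschitz Q a b.
have [|x] := IVT ab (lipschitz_within L0 LP) (v := r ^+ 2).
  by rewrite Qpoly_min ge_min le_max sqr_ge0 Qb orbT.
rewrite in_itv/= => /andP[ax xb] Qx; exists x; last first.
  by rewrite /radius Qx sqrtr_sqr gtr0_norm.
rewrite lt_def ax andbT; apply: contraTneq r0 => xa.
by move: Qx; rewrite xa Qpoly_min => /esym/eqP; rewrite sqrf_eq0 => /eqP ->; rewrite ltxx.
Qed.

Lemma radius_lip x1 x2 : a < x1 -> exists2 L, 0 <= L &
  forall x y, x1 <= x <= x2 -> x1 <= y <= x2 ->
    `|radius x - radius y| <= L * `|x - y|.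
Proof.
move=> ax1; have [L L0 [_ LP]] := horner_lipschitz Q x1 x2.
have ge x : x1 <= x -> radius x1 <= radius x /\ 0 < Q.[x].
  rewrite le_eqVlt => /orP[/eqP <-|xx].
    by split=> //; have /andP[] := Qpoly_inc ax1 (ltr_pwDr ltr01 (lexx x1)).
  have /andP[_ /ltW h] := radius_inc ax1 xx; split=> //.
  by have /andP[h1 h2] := Qpoly_inc ax1 xx; exact: lt_trans h1 h2.
have r10 : 0 < radius x1 by have /andP[] := radius_inc ax1 (ltr_pwDr ltr01 (lexx x1)).
exists (L / radius x1); first by rewrite divr_ge0// ltW.
move=> x y hx hy; have [gx Qx] := ge x (andP hx).1; have [gy Qy] := ge y (andP hy).1.
have E : (radius x - radius y) * (radius x + radius y) = Q.[x] - Q.[y].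
  by rewrite -subr_sqr !sqr_sqrtr ?ltW.
rewrite mulrAC ler_pdivlMr//; apply: le_trans (LP x y hx hy).
rewrite -E normrM ler_wpM2l// ger0_norm; first by rewrite (le_trans gx)// lerDl; lra.
by rewrite addr_ge0// sqrtr_ge0.
Qed.

Lemma measurable_eigenvalue_of : measurable_fun [set: R * R] (eigenvalue_of alpha).
Proof.
have mr : measurable_fun [set: R * R] (fun p => radius p.1).
  apply: measurableT_comp => //; apply: measurableT_comp.
    by apply: continuous_measurable_fun; exact: sqrt_continuous.
  exact: measurable_horner.
have mc : measurable_fun [set: R * R] (fun p => cos p.2).
  apply: measurableT_comp => //; apply: continuous_measurable_fun.
  exact: continuous_cos.
have ms : measurable_fun [set: R * R] (fun p => sin p.2).
  apply: measurableT_comp => //; apply: continuous_measurable_fun.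
  exact: continuous_sin.
by apply: measurable_fun_pair; exact: measurable_funM.
Qed.

End Radius.

Section DensityImage.
Context d1 d2 (T1 : measurableType d1) (T2 : measurableType d2) (R : realType).
Variables (mu : {measure set T1 -> \bar R}) (g : T1 -> R) (h : T1 -> T2).
Hypotheses (mg : measurable_fun [set: T1] g) (g0 : forall x, 0 <= g x).
Hypotheses (mh : measurable_fun [set: T1] h).
Hypothesis gfin : (\int[mu]_x (g x)%:E < +oo)%E.
Local Open Scope ereal_scope.

Definition density_image & measurable_fun [set: T1] h &
    \int[mu]_x (g x)%:E < +oo : set T2 -> \bar R :=
  pushforward (with_density mu mg g0) h.

Local Notation nu := (density_image mh gfin).

Let nu0 : nu set0 = 0.
Proof. by rewrite /density_image /pushforward preimage_set0 measure0. Qed.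

Let nu_ge0 A : 0 <= nu A. Proof. exact: measure_ge0. Qed.

Let mpre A : measurable A -> measurable (h @^-1` A).
Proof. by move=> mA; rewrite -[X in measurable X]setTI; exact: mh. Qed.

Let nu_sigma_additive : semi_sigma_additive nu.
Proof.
move=> F mF tF mUF; rewrite /density_image /pushforward preimage_bigcup.
apply: (@measure_semi_sigma_additive _ _ _ (with_density mu mg g0)).
- by move=> i; exact: mpre.
- apply/trivIsetP => /= i j _ _ ij; rewrite -preimage_setI.
  by move/trivIsetP : tF => /(_ _ _ _ _ ij) ->//; rewrite preimage_set0.
- by rewrite -preimage_bigcup; exact: mpre.
Qed.

HB.instance Definition _ := isMeasure.Build _ _ _ nu nu0 nu_ge0 nu_sigma_additive.

Let nu_fin : fin_num_fun nu.
Proof.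
move=> A mA; rewrite ge0_fin_numE//; apply: le_lt_trans gfin.
rewrite /density_image /pushforward /with_density.
apply: ge0_subset_integral => //.
- exact: mpre.
- exact: measurable_EFin_comp.
- by move=> x _; rewrite lee_fin.
Qed.

HB.instance Definition _ := @Measure_isFinite.Build _ _ _ nu nu_fin.

Lemma integral_density_image (f : T2 -> \bar R) : (forall y, 0 <= f y) ->
  measurable_fun [set: T2] f ->
  \int[nu]_y f y = \int[mu]_x (f (h x) * (g x)%:E).
Proof.
move=> f0 mf; rewrite -integral_with_density//; last exact: measurableT_comp.
by rewrite ge0_integral_pushforward// preimage_setT.
Qed.

End DensityImage.

(** * The law of one eigenvalue *)

Lemma ge0_integral0_null d (T : measurableType d) (R : realType)
    (mu : {measure set T -> \bar R}) (f : T -> \bar R) (A : set T) :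
  measurable_fun [set: T] f -> (forall x, 0 <= f x)%E ->
  (\int[mu]_x f x = 0)%E -> measurable A -> (forall x, A x -> 0 < f x)%E ->
  mu A = 0%E.
Proof.
move=> mf f0 If mA Af.
have [N [mN N0 fN]] : ae_eq mu setT f (cst 0%E).
  apply/(ae_eq_integral_abs mu measurableT mf).
  by rewrite -[RHS]If; apply: eq_integral => x _; rewrite gee0_abs.
apply/eqP; rewrite eq_le measure_ge0 andbT -N0 le_measure ?inE//.
move=> x Ax; apply: fN => /= h; have := Af x Ax.
by rewrite h//= ltxx.
Qed.

Section Spreading.
Context {R : realType} (m : nat) (alpha : 'I_m -> R) (D : set (R * R)) (r : R).
Hypothesis m0 : (0 < m)%N.
Hypotheses (cD : closed D) (Dr : forall z, D z -> `|z.1| <= r /\ `|z.2| <= r).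

Local Notation a := (- inf (range alpha)).
Local Notation Q := (Qpoly alpha).
Local Notation leb := (@lebesgue_measure R).
Local Notation leb2 := (sprod leb leb).
Local Notation plane := (measurableTypeR R * measurableTypeR R)%type.
Local Notation eig := (eigenvalue_of alpha).

Let mD : measurable D. Proof. exact: closed_measurable2. Qed.
Let meig : measurable_fun [set: R * R] eig. Proof. exact: measurable_eigenvalue_of. Qed.

Definition param_set : set (R * R) :=
  [set p | [/\ a <= p.1, 0 <= p.2 < 2 * pi & D (eig p)]].

Lemma measurable_param_set : measurable param_set.
Proof.
rewrite (_ : param_set = (`[a, +oo[%classic `*` `[0, 2 * pi[%classic) `&` eig @^-1` D).
  apply: measurableI; first by apply: measurableX; exact: measurable_itv.
  by rewrite -[X in measurable X]setTI; exact: meig.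
apply/seteqP; split => p /=; rewrite !in_itv/= andbT; first by case=> -> ->.
by case=> -[? ?] ?; split.
Qed.

Definition param_density p : R := \1_param_set p * Num.sqrt (Q^`()).[p.1].

Lemma measurable_param_density : measurable_fun [set: R * R] param_density.
Proof.
apply: measurable_funM; first by apply: measurable_indic; exact: measurable_param_set.
have mq : measurable_fun [set: R] (fun x => Num.sqrt (Q^`()).[x]).
  apply: measurableT_comp; last exact: measurable_horner.
  by apply: continuous_measurable_fun; exact: sqrt_continuous.
exact: (measurableT_comp mq measurable_fst).
Qed.

Lemma param_density_ge0 p : 0 <= param_density p.
Proof. by rewrite mulr_ge0// sqrtr_ge0. Qed.

Lemma param_bound p : param_set p -> p.1 - a <= Num.max 1 (4 * r ^+ 2).
Proof.
move=> [ap _ /Dr[z1 z2]].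
have [|h] := leP (p.1 - a) 1; first by rewrite le_max => ->.
rewrite le_max; apply/orP; right; apply: (le_trans (Qpoly_ge m0 (ltW h))).
have Q0 : 0 <= Q.[p.1].
  by rewrite (le_trans _ (Qpoly_ge m0 (ltW h)))// subr_ge0.
have : cabs (eig p) ^+ 2 = Q.[p.1].
  by rewrite /eigenvalue_of cabs_polar real_normK ?num_real// sqr_sqrtr.
move=> <-; rewrite cabs_sqr.
have h1 : (eig p).1 ^+ 2 <= r ^+ 2.
  by rewrite -[leLHS]real_normK ?num_real// ler_sqr ?nnegrE// (le_trans _ z1).
have h2 : (eig p).2 ^+ 2 <= r ^+ 2.
  by rewrite -[leLHS]real_normK ?num_real// ler_sqr ?nnegrE// (le_trans _ z1).
have : 0 <= r ^+ 2 by exact: sqr_ge0.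
lra.
Qed.

(** As [Q] grows at least linearly and the domain is bounded, the parameters are
    bounded too. *)
Lemma param_density_finite : (\int[leb2]_p (param_density p)%:E < +oo)%E.
Proof.
pose T := Num.max 1 (4 * r ^+ 2).
have [L L0 [LP _]] := horner_lipschitz (Q^`()) a (a + T).
pose A := (`[a, a + T] `*` `[0, 2 * pi])%classic : set (R * R).
have mA : measurable A by apply: measurableX; exact: measurable_itv.
apply: (@le_lt_trans _ _ (\int[leb2]_p ((1 + L) * \1_A p)%:E)%E).
  apply: ge0_le_integral => //.
  - by move=> p _; rewrite lee_fin param_density_ge0.
  - by apply: measurable_EFin_comp; exact: measurable_param_density.
  - by apply: measurable_EFin_comp; apply: measurable_funM => //; exact: measurable_indic.
  - move=> p _; rewrite lee_fin /param_density indicE.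
    case: (boolP (p \in param_set)); rewrite ?mul0r ?mulr_ge0 ?addr_ge0//.
    rewrite inE => pp; have pT := param_bound pp; case: pp => ap /andP[t0 t1] _.
    rewrite indicE mem_set ?mul1r ?mulr1; last first.
      by split; rewrite /= in_itv/=; apply/andP; split => //; [rewrite -lerBlDl|exact: ltW].
    have qL : (Q^`()).[p.1] <= L.
      apply: le_trans (ler_norm _) _; apply: LP; rewrite ap /=.
      by rewrite -lerBlDl.
    have [q0|q0] := leP 0 (Q^`()).[p.1]; last first.
      by rewrite ler0_sqrtr ?addr_ge0// ltW.
    rewrite -(@ler_pXn2r _ 2)// ?nnegrE ?sqrtr_ge0 ?addr_ge0// sqr_sqrtr//.
    apply: (le_trans qL); rewrite (_ : (1 + L) ^+ 2 = 1 + 2 * L + L ^+ 2); last by ring.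
    by have := sqr_ge0 L; lra.
under eq_integral do rewrite EFinM.
rewrite ge0_integralZl//; last 2 first.
- by apply: measurable_EFin_comp; exact: measurable_indic.
- by rewrite lee_fin addr_ge0.
rewrite integral_indic// setIT lte_mul_pinfty ?lee_fin ?addr_ge0//.
rewrite [ltLHS](@product_measure1E _ _ _ _ R leb leb); [|exact: measurable_itv|exact: measurable_itv].
rewrite lte_mul_pinfty//.
  by rewrite ge0_fin_numE// [ltLHS]lebesgue_measure_itv/=; case: ifP => _; rewrite ltry.
by rewrite [ltLHS]lebesgue_measure_itv/=; case: ifP => _; rewrite ltry.
Qed.

Let mdensL : measurable_fun [set: plane] param_density.
Proof. exact: measurable_param_density. Qed.

Let meigL : measurable_fun [set: plane] (eig : plane -> (R * R)%type).
Proof. exact: meig. Qed.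

(** The law, before normalization, of one eigenvalue without interaction. *)
Definition eigenmeasure : {finite_measure set (R * R)%type -> \bar R} :=
  density_image mdensL param_density_ge0 meigL param_density_finite.

Lemma integral_eigenmeasure (f : R * R -> \bar R) : (forall z, 0 <= f z)%E ->
  measurable_fun [set: R * R] f ->
  (\int[eigenmeasure]_z f z =
   \int[leb2]_p (f (eig p) * (param_density p)%:E))%E.
Proof. exact: integral_density_image. Qed.

Lemma param_density_gt0 p : a < p.1 -> 0 <= p.2 < 2 * pi -> D (eig p) ->
  0 < param_density p.
Proof.
move=> ap tp Dp; rewrite /param_density indicE mem_set ?mul1r; last first.
  by split=> //; exact: ltW.
by rewrite sqrtr_gt0 Qpoly_deriv_gt0.
Qed.

Variable U : set (R * R).
Hypotheses (oU : open U) (UD : U `<=` D) (cU : connected U) (U0 : U !=set0).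
Hypothesis DU : D `<=` closure U.

Let mU : measurable U. Proof. exact: open_measurable2. Qed.

Let mdist z0 : measurable_fun [set: R * R] (fun z => cabs (z - z0)).
Proof. exact: (measurableT_comp (@measurable_cabsB R) (measurable_pair2 z0)). Qed.

(** Almost every ray meets the given null set in a null set of parameters. Near a
    generic point of the circle of radius [s] around [z0], such a ray crosses all
    circles of radius near [s] inside [U], so that near [s] the set [B] is the
    image of a null set under the distance to [z0] along the ray, a Lipschitz
    function. *)
Lemma distance_null : exists2 d0, 0 < d0 & forall z0 delta (B : set R), D z0 ->
  delta <= d0 -> measurable B -> B `<=` `]0, delta[%classic ->
  eigenmeasure (U `&` (fun z => cabs (z - z0)) @^-1` B) = 0%E -> leb B = 0%E.
Proof.
have [d0 d00 dP] := circles_meet oU cU U0; exists d0 => // z0 delta B Dz0 dd mB B0 rB.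
set A := U `&` _ in rB.
have mA : measurable A.
  by apply: measurableI => //; rewrite -[X in measurable X]setTI; exact: mdist.
pose G (p : R * R) : \bar R := ((\1_A (eig p))%:E * (param_density p)%:E)%E.
have G0 p : (0 <= G p)%E by rewrite mule_ge0 ?lee_fin ?param_density_ge0.
have mG : measurable_fun [set: R * R] G.
  apply: emeasurable_funM; apply: measurable_EFin_comp.
    by apply: measurableT_comp => //; exact: measurable_indic.
  exact: measurable_param_density.
pose F t := (\int[leb]_x G (x, t))%E.
have F0 t : (0 <= F t)%E by apply: integral_ge0.
have mF : measurable_fun [set: R] F.
  exact: (@measurable_fun_fubini_tonelli_G _ _ _ _ _ leb G mG G0).
have IF : (\int[leb]_t F t = 0)%E.
  rewrite -[RHS]rB -[in RHS](setIT A) -integral_indic//.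
  rewrite integral_eigenmeasure//; last first.
    by apply: measurable_EFin_comp; exact: measurable_indic.
  exact: (esym (@fubini_tonelli2 _ _ _ _ R leb leb G mG G0)).
have local s : 0 < s -> s < delta -> exists2 e, 0 < e &
    leb (B `&` `]s - e, s + e[%classic) = 0%E.
  move=> s0 sd; have sd0 : s <= d0 by rewrite (le_trans (ltW sd)).
  have [p0 Up0 p0s] := dP z0 s (DU Dz0) s0 sd0.
  have ps0 : 0 < cabs (p0 - z0) by rewrite p0s.
  have [p [Up ps nz]] := generic_circle_point oU Up0 ps0.
  have [x1 [x2 [t0 [e [[ax1 x12 t00 e0 te] H]]]]] :=
    rays_cross (@radius_inc R m alpha m0) (@radius_onto R m alpha m0)
      (@radius_lip R m alpha m0) oU Up nz.
  exists e => //.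
  have [t /andP[tt0 tt1] Ft] : exists2 t, t0 <= t < t0 + e & F t = 0%E.
    apply: contrapT => hn.
    have : leb `[t0, t0 + e[%classic = 0%E.
      apply: (@ge0_integral0_null _ (measurableTypeR R) R leb F _ mF F0 IF) => // t /=.
      rewrite in_itv/= => ht.
      rewrite lt_def F0 andbT; apply/eqP => Ft; apply: hn; by exists t.
    rewrite lebesgue_measure_itv/= lte_fin ltrDl e0 -EFinB => -[].
    by rewrite addrAC subrr add0r => /eqP; rewrite gt_eqF.
  have [H1 H2] := H t ltac:(by rewrite tt0).
  pose f x := cabs (polar (radius alpha x) t - z0).
  have mf : measurable_fun [set: R] f.
    by apply: (measurableT_comp (mdist z0)); exact: (measurableT_comp meig (measurable_pair2 t)).
  pose S := `[x1, x2]%classic `&` f @^-1` (B `&` `]s - e, s + e[%classic).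
  have mBe : measurable (B `&` `]s - e, s + e[%classic).
    by apply: measurableI => //; exact: measurable_itv.
  have mS : measurable S.
    apply: measurableI; first exact: measurable_itv.
    by rewrite -[X in measurable X]setTI; exact: mf.
  have S0 : leb S = 0%E.
    have mGt : measurable_fun [set: R] (fun x => G (x, t)).
      exact: (measurableT_comp mG (measurable_pair2 t)).
    apply: (@ge0_integral0_null _ (measurableTypeR R) R leb (fun x => G (x, t)) _ mGt
      (fun x => G0 _) Ft mS) => x [/=].
    rewrite in_itv/= => hx [Bx _]; have Ux := H1 x hx.
    have ax : a < x by apply: lt_le_trans ax1 _; case/andP: hx.
    rewrite /G mule_gt0// lte_fin; last first.
      apply: param_density_gt0 => //=; last exact: UD.
      by rewrite (le_trans t00)//= (lt_le_trans tt1).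
    by rewrite indicE mem_set// ltr01.
  have [L L0 LP] := polar_ray_lip (@radius_lip R m alpha m0) x2 z0 t ax1.
  apply: (lipschitz_null L0 LP mS S0 mBe) => s' [Bs' /=]; rewrite in_itv/= => /andP[hs1 hs2].
  have [|x hx xs] := H2 s'.
    by rewrite ps p0s ltr_norml; apply/andP; split; lra.
  exists x; split=> //; split; first by rewrite /= in_itv.
  by rewrite /f/= xs; split => //; rewrite /= in_itv/= hs1.
(* Intervals with rational end points reduce the claim to its local form. *)
pose good (q : rat * rat) := leb (B `&` `]ratr q.1, ratr q.2[%classic) = 0%E.
pose I (n : nat) : set R := if unpickle n is Some q then
  if pselect (good q) then B `&` `]ratr (q : rat * rat).1, ratr q.2[%classic else set0 else set0.
have IE q : I (pickle q) =
    if pselect (good q) then B `&` `]ratr q.1, ratr q.2[%classic else set0.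
  by rewrite /I pickleK.
have mI n : measurable (I n).
  rewrite /I; case: (unpickle n) => [q|//]; case: (pselect (good q)) => //= _.
  by apply: measurableI => //; exact: measurable_itv.
have I0 n : leb (I n) = 0%E.
  rewrite /I; case: (unpickle n) => [q|]; rewrite ?measure0//.
  by case: (pselect (good q)) => //= _; rewrite measure0.
apply/eqP; rewrite eq_le measure_ge0 andbT.
apply: (@le_trans _ _ (\sum_(n <oo) leb (I n))%E); last first.
  by rewrite eseries0.
apply: measure_sigma_subadditive => // s Bs.
have := B0 s Bs; rewrite /= in_itv/= => /andP[s0 sd].
have [e e0 sE] := local s s0 sd.
have [q1 q1P] : exists q : rat, ratr q \in `]s - e, s[ by apply: rat_in_itvoo; rewrite ltrBlDr ltrDl.
have [q2 q2P] : exists q : rat, ratr q \in `]s, s + e[ by apply: rat_in_itvoo; rewrite ltrDl.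
move: q1P q2P; rewrite !in_itv/= => /andP[h1 h2] /andP[h3 h4].
exists (pickle (q1, q2)); [exact: Logic.I|rewrite IE].
case: (pselect (good (q1, q2))) => /= [_|[]]; first by split=> //=; rewrite in_itv/= h2.
apply/eqP; rewrite eq_le measure_ge0 andbT -sE le_measure ?inE//.
- by apply: measurableI => //; exact: measurable_itv.
- by apply: measurableI => //; exact: measurable_itv.
- move=> x [Bx /=]; rewrite !in_itv/= => /andP[? ?]; split=> //=.
  by apply/andP; split; lra.
Qed.

(** Reweighting by the Radon-Nikodym derivative of Lebesgue measure with respect
    to the law of the distance makes the distance nearly uniform, so that balls
    have a mass proportional to their radius. *)
Lemma eigenmeasure_spread : exists2 d0, 0 < d0 & forall delta z0, D z0 ->
  0 < delta -> delta <= d0 ->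
  exists2 nu, dominated eigenmeasure nu & spread D delta z0 nu.
Proof.
have [d0 d00 dP] := distance_null; exists d0 => // delta z0 Dz0 dl0 dd.
pose f z := cabs (z - z0); have mf : measurable_fun [set: R * R] f := mdist z0.
have mfpre (C : set R) : measurable C -> measurable (f @^-1` C).
  by move=> mC; rewrite -[X in measurable X]setTI; exact: mf.
have m1U : measurable_fun [set: R * R] (\1_U : R * R -> R) by exact: measurable_indic.
have U0' (z : R * R) : 0 <= (\1_U z : R) by [].
have fin1 : (\int[eigenmeasure]_z (\1_U z)%:E < +oo)%E.
  by rewrite integral_indic// -ge0_fin_numE// fin_num_measure//; exact: measurableI.
(* [kappa] is the law of the distance to [z0] on [U], and [lam] is Lebesgue measure
   on the distances less than [delta]. *)
pose kappa := density_image m1U U0' mf fin1.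
have kE C : measurable C -> kappa C = eigenmeasure (U `&` f @^-1` C).
  move=> mC; rewrite /kappa /density_image /pushforward /with_density integral_indic//.
  exact: mfpre.
pose I0 : set R := `]0, delta[%classic.
have mI0 : measurable I0 by exact: measurable_itv.
have mJ : measurable_fun [set: measurableTypeR R] (\1_I0 : measurableTypeR R -> R).
  exact: measurable_indic.
have J0 (s : measurableTypeR R) : 0 <= (\1_I0 s : R) by [].
have mid : measurable_fun [set: measurableTypeR R] (id : measurableTypeR R -> R).
  by move=> _ Y mY; rewrite setTI.
have lebI0 : leb I0 = delta%:E.
  by rewrite /I0 [LHS]lebesgue_measure_itv/= lte_fin dl0 -EFinB subr0.
have finJ : (\int[leb]_s (\1_I0 s)%:E < +oo)%E.
  by rewrite integral_indic// setIT [ltLHS]lebI0 ltry.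
pose lam := density_image mJ J0 mid finJ.
have lamE C : measurable C -> lam C = leb (I0 `&` C).
  by move=> mC; rewrite /lam /density_image /pushforward /with_density integral_indic.
have lamk : lam `<< kappa.
  move=> N kN A mA AN; rewrite lamE//.
  apply: (dP z0 delta (I0 `&` A) Dz0 dd (measurableI _ _ mI0 mA)); first by move=> s [].
  have := kN A mA AN; rewrite kE// => h.
  apply/eqP; rewrite eq_le measure_ge0 andbT -h le_measure ?inE//.
  - by apply: measurableI => //; apply: mfpre; exact: measurableI.
  - by apply: measurableI => //; exact: mfpre.
  - by move=> z [Uz [_ ?]]; split.
have [g [g0 gfin gint gE]] := radon_nikodym_sigma_finite lamk.
have mg : measurable_fun [set: R] g by exact: measurable_int gint.
pose E (n : nat) : set R := [set s | (g s <= n%:R%:E)%E].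
have mE n : measurable (E n).
  rewrite (_ : E n = g @^-1` `]-oo, n%:R%:E]); last first.
    by apply/seteqP; split => s; rewrite /E /= in_itv.
  by rewrite -[X in measurable X]setTI; apply: mg => //; exact: emeasurable_itv.
(* Truncating the derivative at the level [n] makes the reweighted measure
   dominated and keeps half of the interval of distances. *)
have [n En] : exists n, ((delta / 2)%:E <= lam (E n))%E.
  apply: contrapT => hn.
  have ET : \bigcup_n E n = [set: R].
    apply/seteqP; split => // s _; exists (Num.bound (fine (g s))) => //=.
    rewrite /E /= -[leLHS](fineK (gfin s)) lee_fin ltW//.
    by apply: archi_boundP; rewrite fine_ge0.
  have cv : lam \o E @ \oo --> lam (\bigcup_n E n).
    apply: nondecreasing_cvg_mu => //; first by rewrite ET.
    move=> a1 a2 a12; apply/subsetPset => s; rewrite /E/= => /le_trans; apply.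
    by rewrite lee_fin ler_nat.
  have : (lam (\bigcup_n E n) <= (delta / 2)%:E)%E.
    rewrite -(cvg_lim _ cv)//; apply: lime_le.
      by apply/cvg_ex; exists (lam (\bigcup_n E n)).
    near=> k; rewrite leNgt; apply/negP => h; apply: hn; exists k; exact: ltW.
  rewrite ET lamE// setIT lebI0 lee_fin ler_pdivlMr// ger_pMr//.
  by apply/negP; rewrite -ltNge ltr1n.
have mE2 : measurable (I0 `&` E n) by exact: measurableI.
pose q (s : R) : R := \1_(I0 `&` E n) s * fine (g s).
have q0 s : 0 <= q s by rewrite mulr_ge0// fine_ge0.
have qn s : q s <= n%:R.
  rewrite /q indicE; case: (boolP (s \in _)); rewrite ?mul0r// inE => -[_ sE].
  by rewrite mul1r -lee_fin fineK.
have mq : measurable_fun [set: R] q.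
  apply: measurable_funM; last exact: measurableT_comp.
  by apply: measurable_indic; exact: measurableI.
pose G z : R := \1_U z * q (f z).
have G0 z : 0 <= G z by rewrite mulr_ge0.
have mG : measurable_fun [set: R * R] G.
  by apply: measurable_funM => //; exact: measurableT_comp.
have mGE : measurable_fun [set: R * R] (fun z => (G z)%:E) by exact: measurable_EFin_comp.
pose nu' := with_density eigenmeasure mG G0.
have nu'C C : measurable C -> nu' (f @^-1` C) = leb (I0 `&` E n `&` C).
  move=> mC; have mqC : measurable_fun [set: R] (fun s => (q s * \1_C s)%:E).
    apply: measurable_EFin_comp; apply: measurable_funM => //; exact: measurable_indic.
  transitivity (\int[kappa]_s (q s * \1_C s)%:E)%E.
    rewrite integral_density_image//; last by move=> s; rewrite lee_fin mulr_ge0.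
    rewrite /nu' /with_density integral_mkcond; apply: eq_integral => z _.
    rewrite patchE /G [\1_C _]indicE -EFinM; have [h|h] := pselect (C (f z)).
      by rewrite !mem_set// mulr1 mulrC.
    by rewrite !memNset// mulr0 mul0r.
  have mIEC : measurable (I0 `&` E n `&` C) by do 2!apply: measurableI => //.
  transitivity (\int[kappa]_(s in I0 `&` E n `&` C) g s)%E.
    rewrite [RHS]integral_mkcond; apply: eq_integral => s _.
    rewrite patchE /q in_setI [\1_C _]indicE [\1_(_ `&` _) _]indicE.
    case: (s \in I0 `&` E n); case: (s \in C); rewrite /= ?mul0r ?mulr0 ?mul1r ?mulr1//.
    by rewrite fineK.
  transitivity (lam (I0 `&` E n `&` C)); first exact/esym/gE.
  rewrite lamE//; congr (leb _).
  by apply/seteqP; split => s [] //= -[].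
have nu'T : nu' setT = leb (I0 `&` E n).
  by rewrite -(preimage_setT f) nu'C// setIT.
have nu'lo : ((delta / 2)%:E <= nu' setT)%E by rewrite nu'T -lamE.
have nu'hi : (nu' setT <= delta%:E)%E.
  rewrite nu'T -lebI0; apply: le_measure; rewrite ?inE.
  - exact: mE2.
  - exact: mI0.
  - by move=> s [].
have nu'fin : nu' setT \is a fin_num by rewrite ge0_fin_numE// (le_lt_trans nu'hi)// ltry.
pose mass := fine (nu' setT).
have mass_ge : delta / 2 <= mass by rewrite -lee_fin fineK.
have mass0 : 0 < mass by apply: lt_le_trans mass_ge; rewrite divr_gt0.
pose nu := mnormalize nu' (dirac (0 : R * R)%type).
have nuE A : nu A = (nu' A * (mass^-1)%:E)%E.
  have h0 : nu' setT != 0%E.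
    by rewrite gt_eqF// (lt_le_trans _ nu'lo)// lte_fin divr_gt0.
  have h1 : nu' setT != +oo%E by apply: contraTneq nu'fin => ->.
  rewrite /nu /mnormalize; case: ifPn => // /orP[] h; exfalso.
    exact: (negP h0 h).
  exact: (negP h1 h).
exists nu.
  exists (n%:R / mass); first by rewrite divr_ge0// ltW.
  move=> A mA; rewrite [leLHS]nuE muleC mulrC EFinM -muleA.
  rewrite lee_wpmul2l ?lee_fin ?invr_ge0 ?(ltW mass0)//.
  apply: (@le_trans _ _ (\int[eigenmeasure]_(z in A) (n%:R)%:E)%E); last by rewrite integral_cst.
  apply: ge0_le_integral => //.
  - by move=> z _; rewrite lee_fin.
  - exact: measurable_funTS.
  - move=> z _; rewrite lee_fin /G indicE; case: (z \in U); rewrite ?mul1r ?mul0r//.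
split.
  rewrite [LHS]nuE (_ : nu' _ = nu' setT); last first.
    rewrite /nu' /with_density [LHS]integral_mkcond; apply: eq_integral => z _.
    rewrite patchE; case: ifPn => //; rewrite notin_setE => nz; congr EFin.
    rewrite /G /q !indicE; case: (boolP (z \in U)); rewrite ?mul0r// inE => Uz.
    case: (boolP (f z \in _)); rewrite ?mul0r ?mulr0// inE => -[].
    rewrite /I0 /= in_itv/= => /andP[_ fz] _; exfalso; apply: nz; split; first exact: UD.
    by rewrite /cball/=; exact: ltW.
  by rewrite -(fineK nu'fin) -EFinM mulfV// gt_eqF.
move=> w s s0; rewrite [leLHS]nuE.
pose C : set R := `[f w - s, f w + s]%classic.
have mC : measurable C by exact: measurable_itv.
apply: (@le_trans _ _ (nu' (f @^-1` C) * (mass^-1)%:E)%E).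
  rewrite lee_wpmul2r ?lee_fin ?invr_ge0 ?(ltW mass0)//.
  rewrite le_measure ?inE//; [exact: measurable_cball|exact: mfpre|].
  move=> z; rewrite /cball/= => zw; rewrite /C/= in_itv/= -ler_distl /f.
  apply: le_trans zw; apply: le_trans (cabs_dist _ _) _.
  by rewrite opprB addrA subrK.
rewrite nu'C//; apply: (@le_trans _ _ ((2 * s)%:E * (mass^-1)%:E)%E).
  rewrite lee_wpmul2r ?lee_fin ?invr_ge0 ?(ltW mass0)//.
  apply: (@le_trans _ _ (leb C)).
    by rewrite le_measure ?inE//; exact: measurableI.
  rewrite /C [leLHS]lebesgue_measure_itv/= lte_fin; case: ltP => h.
    by rewrite -EFinB lee_fin; lra.
  by rewrite lee_fin mulr_ge0.
rewrite -EFinM lee_fin (_ : 4 * s / delta = 2 * s * (2 / delta)); last by field; rewrite gt_eqF.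
rewrite ler_wpM2l ?mulr_ge0// -[leRHS]invf_div lef_pV2 ?posrE//.
by rewrite divr_gt0.
Unshelve. all: by end_near. Qed.

End Spreading.

(** * The eigenvalue distribution as a Gibbs measure *)

Lemma lebesgue_shift (R : realType) (c : R) (h : measurableTypeR R -> \bar R) :
  (forall x, 0 <= h x)%E -> measurable_fun [set: measurableTypeR R] h ->
  (\int[lebesgue_measure]_x h (x + c)%R = \int[lebesgue_measure]_x h x)%E.
Proof.
move=> h0 mh; pose s (x : measurableTypeR R) : measurableTypeR R := (x + c)%R.
have ms : measurable_fun [set: measurableTypeR R] s by exact: measurable_funD.
have E A : measurable A -> (@lebesgue_measure R A = pushforward lebesgue_measure s A)%E.
  apply: (@lebesgue_measure_unique R (pushforward lebesgue_measure s)).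
  move=> _ [[u v] _ <-].
  have sE : s @^-1` `]u, v]%classic = `]u - c, v - c]%classic.
    by apply/seteqP; split => x /=; rewrite /s !in_itv/= ltrBlDr lerBrDr.
  transitivity (lebesgue_measure `]u - c, v - c]%classic); last first.
    by congr (lebesgue_measure _); exact: esym sE.
  rewrite !lebesgue_measure_itv/= !lte_fin ltrD2r; case: ifP => // _.
  by rewrite -!EFinB opprB addrA subrK.
rewrite [RHS](eq_measure_integral (pushforward lebesgue_measure s)); last by move=> A mA _; exact: E.
by rewrite ge0_integral_pushforward.
Qed.

(** The difference [alpha i - beta i] is invariant under the cyclic predecessor. *)
Lemma cyclic_difference (R : realType) m (lambda alpha beta : 'I_m -> R) :
  (forall i, lambda i = alpha i - alpha (ord_pred i)) ->
  (forall i, lambda i = beta i - beta (ord_pred i)) ->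
  exists c, forall i, alpha i = beta i + c.
Proof.
case: m lambda alpha beta => [|m] lambda alpha beta ha hb.
  by exists 0 => -[].
have step i : alpha i - beta i = alpha (ord_pred i) - beta (ord_pred i).
  by have := ha i; rewrite hb; lra.
exists (alpha ord0 - beta ord0) => -[n hn].
suff -> : alpha ord0 - beta ord0 = alpha (Ordinal hn) - beta (Ordinal hn) by rewrite addrC subrK.
elim: n hn => [|n IH] hn; first by congr (alpha _ - beta _); apply/val_inj.
have hn' : (n < m.+1)%N by exact: ltnW.
rewrite (IH hn') [RHS]step; congr (alpha _ - beta _); apply/val_inj => /=.
  by rewrite modnDr modn_small.
by rewrite modnDr modn_small.
Qed.

Section Shift.
Context {R : realType} (m : nat) (alpha beta : 'I_m -> R) (c : R).
Variables (D : set (R * R)) (r : R).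
Hypothesis m0 : (0 < m)%N.
Hypotheses (cD : closed D) (Dr : forall z, D z -> `|z.1| <= r /\ `|z.2| <= r).
Hypothesis ab : forall i, alpha i = beta i + c.

Let inf_shift : inf (range alpha) = inf (range beta) + c.
Proof.
have [ha [i iE]] := inf_alpha alpha m0; have [hb [j jE]] := inf_alpha beta m0.
apply/eqP; rewrite eq_le; apply/andP; split.
  by rewrite -jE -ab.
by rewrite -iE ab lerD2r.
Qed.

Let Q_shift : Qpoly alpha = Qpoly beta \Po ('X + c%:P).
Proof.
rewrite /Qpoly rmorph_prod/=; apply: eq_bigr => i _.
by rewrite comp_polyD comp_polyX comp_polyC ab polyCD addrAC addrA.
Qed.

Lemma eigenvalue_of_shift x t :
  eigenvalue_of alpha (x, t) = eigenvalue_of beta (x + c, t).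
Proof. by rewrite /eigenvalue_of/= Q_shift horner_comp !hornerE. Qed.

Lemma param_density_shift x t :
  param_density alpha D (x, t) = param_density beta D (x + c, t).
Proof.
rewrite /param_density/= Q_shift deriv_comp derivD derivX derivC addr0 mulr1.
rewrite horner_comp !hornerE; congr (_ * _); rewrite !indicE.
congr (nat_of_bool _)%:R; apply/idP/idP; rewrite !inE => -[/= h1 h2 h3]; split => //=.
- by move: h1; rewrite inf_shift; lra.
- by rewrite -eigenvalue_of_shift.
- by move: h1; rewrite inf_shift; lra.
- by rewrite eigenvalue_of_shift.
Qed.

(** Translating all the [alpha i] amounts to translating the coordinate [x]. *)
Lemma eigenmeasure_shift A : measurable A ->
  eigenmeasure alpha m0 cD Dr A = eigenmeasure beta m0 cD Dr A.
Proof.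
move=> mA; have mi : measurable_fun [set: R * R] (fun z => (\1_A z : R)%:E).
  by apply: measurable_EFin_comp; exact: measurable_indic.
have IA al : (eigenmeasure al m0 cD Dr A =
    \int[sprod lebesgue_measure lebesgue_measure]_p
      ((\1_A (eigenvalue_of al p))%:E * (param_density al D p)%:E))%E.
  rewrite -(integral_eigenmeasure al m0 cD Dr _ mi); last by move=> z; rewrite lee_fin.
  by rewrite integral_indic// setIT.
rewrite !IA.
pose G (al : 'I_m -> R) (p : R * R) : \bar R :=
  ((\1_A (eigenvalue_of al p))%:E * (param_density al D p)%:E)%E.
have G0 al p : (0 <= G al p)%E by rewrite mule_ge0 ?lee_fin ?param_density_ge0.
have mG al : measurable_fun [set: R * R] (G al).
  apply: emeasurable_funM; apply: measurable_EFin_comp.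
    by apply: measurableT_comp; [exact: measurable_indic|exact: measurable_eigenvalue_of].
  exact: measurable_param_density.
transitivity (\int[lebesgue_measure]_t \int[lebesgue_measure]_x G alpha (x, t))%E.
  exact: (@fubini_tonelli2 _ _ _ _ R lebesgue_measure lebesgue_measure _ (mG alpha) (G0 alpha)).
transitivity (\int[lebesgue_measure]_t \int[lebesgue_measure]_x G beta (x, t))%E; last first.
  exact: (esym (@fubini_tonelli2 _ _ _ _ R lebesgue_measure lebesgue_measure _ (mG beta) (G0 beta))).
apply: eq_integral => t _; rewrite -[RHS](lebesgue_shift c)//; last first.
  exact: (measurableT_comp (mG beta) (measurable_pair2 t)).
by apply: eq_integral => x _; rewrite /G eigenvalue_of_shift param_density_shift.
Qed.

End Shift.

Section GibbsIdentification.
Context {R : realType} (m : nat) (alpha : 'I_m -> R).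
Variables (D : set (R * R)) (W : R * R -> R) (R0 BW r : R).
Hypothesis m0 : (0 < m)%N.
Hypotheses (cD : closed D) (Dr : forall z, D z -> `|z.1| <= r /\ `|z.2| <= r).
Hypotheses (R01 : 1 <= R0) (DR0 : forall z w, D z -> D w -> cabs (z - w) <= R0).
Hypothesis WB : forall z, D z -> 0 <= W z + BW.
Hypothesis mW : measurable_fun [set: R * R] W.

Let mD : measurable D. Proof. exact: closed_measurable2. Qed.
Let R00 : 0 < R0. Proof. exact: lt_le_trans R01. Qed.

Lemma prod_pairs N (f : 'I_N -> 'I_N -> R) : (forall i j, f i j = f j i) ->
  \prod_(i < N) \prod_(j < N | (i < j)%N) f i j ^+ 2 =
  \prod_(i < N) \prod_(j < N | j != i) f i j.
Proof.
move=> fC; transitivity (\prod_(i < N) \prod_(j < N | (i < j)%N) f i j *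
    \prod_(i < N) \prod_(j < N | (j < i)%N) f i j).
  rewrite [X in _ * X](exchange_big_dep xpredT)//= -big_split/=.
  apply: eq_bigr => i _; rewrite -big_split/=; apply: eq_bigr => j _.
  by rewrite expr2 [f j i]fC.
rewrite -big_split/=; apply: eq_bigr => i _.
rewrite [RHS](bigID (fun j : 'I_N => (i < j)%N))/=; congr (_ * _); apply: eq_bigl => j.
  by rewrite -val_eqE/=; case: ltngtP.
by rewrite -val_eqE/=; case: ltngtP.
Qed.

Definition gibbs_factor (N : nat) : R :=
  expR (N%:R * \sum_(i < N) BW + \sum_(i < N) \sum_(j < N | j != i) ln R0).

(** For distinct points both sides are exponentials of sums over pairs; when two
    points coincide, both sides vanish. *)
Lemma vandermonde_boltzmann N (z : N.-tuple (R * R)) : cube D N z ->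
  expR (- (N%:R * \sum_(j < N) W (tnth z j))) *
  \prod_(i < N) \prod_(j < N | (i < j)%N) cabs (tnth z i - tnth z j) ^+ 2 =
  gibbs_factor N * boltzmann D W R0 BW z.
Proof.
move=> Dz; rewrite prod_pairs; last by move=> i j; rewrite cabsB.
have [zI|zI] := pselect (injective (tnth z)); last first.
  rewrite /boltzmann indicE memNset ?mul0r ?mulr0; last by case.
  move: zI => /existsNP[i /existsNP[j /not_implyP[zij /eqP ij]]].
  rewrite [X in _ * X](_ : _ = 0) ?mulr0//.
  apply/eqP/prodf_eq0; exists i => //; apply/prodf_eq0; exists j.
    by rewrite eq_sym.
  by rewrite zij subrr cabs0.
rewrite boltzmannE; last by split.
have c0 (i j : 'I_N) : j != i -> 0 < cabs (tnth z i - tnth z j).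
  move=> ij; rewrite lt_def cabs_ge0 cabs_eq0 subr_eq0 andbT.
  by apply: contra ij => /eqP /zI ->.
have prodE : \prod_(i < N) \prod_(j < N | j != i) cabs (tnth z i - tnth z j) =
    expR (\sum_(i < N) \sum_(j < N | j != i) ln (cabs (tnth z i - tnth z j))).
  rewrite (big_morph expR (@expRD R) (@expR0 R)); apply: eq_bigr => i _.
  rewrite (big_morph expR (@expRD R) (@expR0 R)); apply: eq_bigr => j ij.
  by rewrite lnK// posrE c0.
rewrite prodE -!expRD; congr expR; rewrite /hamiltonian.
have -> : \sum_(i < N) pot W BW (tnth z i) =
    \sum_(i < N) W (tnth z i) + \sum_(i < N) BW.
  by rewrite -big_split/=; apply: eq_bigr => i _; rewrite (potE WB).
have -> : \sum_(i < N) \sum_(j < N | j != i) logker R0 (tnth z i) (tnth z j) =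
    \sum_(i < N) \sum_(j < N | j != i) ln R0 -
    \sum_(i < N) \sum_(j < N | j != i) ln (cabs (tnth z i - tnth z j)).
  rewrite -sumrB; apply: eq_bigr => i _; rewrite -sumrB; apply: eq_bigr => j ij.
  by rewrite logkerE ?c0 ?DR0// ln_div ?posrE// c0.
ring.
Qed.

Local Notation leb2 := (sprod (@lebesgue_measure R) (@lebesgue_measure R)).
Local Notation plane := (measurableTypeR R * measurableTypeR R)%type.

(** The factors depending on a single particle are absorbed into the reference
    measure, and its image under the eigenvalue map is taken coordinatewise. *)
Lemma eigenvalue_distribution_gibbs N (P : probability (N.-tuple (R * R)) R) (c : R) :
  (forall A, measurable A -> P A = (c%:E * pushforward
     (@parameter_weight R m D W alpha N) (@eigenvalues R m alpha N) A)%E) ->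
  gibbs D W R0 BW (eigenmeasure alpha m0 cD Dr) P.
Proof.
move=> PE; exists (c * gibbs_factor N) => A mA; rewrite PE// EFinM -muleA.
congr (_ * _)%E; rewrite /pushforward /parameter_weight.
have mb := @measurable_boltzmann R D W R0 BW mD mW N.
have K0 : 0 <= gibbs_factor N by exact: expR_ge0.
pose G (z : N.-tuple (R * R)) : \bar R :=
  (\1_A z * (gibbs_factor N * boltzmann D W R0 BW z))%:E.
have G0 z : (0 <= G z)%E by rewrite lee_fin !mulr_ge0// boltzmann_ge0.
have mG : measurable_fun [set: N.-tuple (R * R)] G.
  apply: measurable_EFin_comp; apply: measurable_funM; last exact: measurable_funM.
  exact: measurable_indic.
have meig : measurable_fun [set: plane] (eigenvalue_of alpha : plane -> (R * R)%type).
  exact: measurable_eigenvalue_of.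
have mdens : measurable_fun [set: plane] (param_density alpha D : plane -> R).
  exact: measurable_param_density.
have mid : measurable_fun [set: plane] (id : plane -> plane).
  by move=> _ Y mY; rewrite setTI.
have dfin := param_density_finite alpha m0 cD Dr.
have d0 := param_density_ge0 alpha D.
pose nu := density_image mdens d0 mid dfin.
have meigs : measurable_fun [set: N.-tuple plane]
    (map_tuple (eigenvalue_of alpha) : N.-tuple plane -> N.-tuple (R * R)).
  apply/measurable_fun_tnthP => i.
  rewrite (_ : _ \o _ = eigenvalue_of alpha \o (@tnth _ plane ^~ i)).
    by apply: measurableT_comp => //; exact: measurable_tnth.
  by apply/funext => t /=; rewrite tnth_map.
pose eigm := eigenmeasure alpha m0 cD Dr.
transitivity (\int[measure_pow eigm N]_z G z)%E; last first.
  rewrite -ge0_integralZl//; last 2 first.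
  - by apply: measurable_funTS; exact: measurable_EFin_comp.
  - by move=> z _; rewrite lee_fin boltzmann_ge0.
  rewrite [RHS]integral_mkcond; apply: eq_integral => z _.
  rewrite patchE /G indicE -EFinM; case: (z \in A); by rewrite ?mul1r ?mul0r.
rewrite (integral_pow_pushforward (mu := nu) (nu := eigm) meig)//.
have nuE B : measurable B -> nu B = with_density leb2 mdens d0 B by [].
have mGe : measurable_fun [set: N.-tuple plane]
    (fun t => G (map_tuple (eigenvalue_of alpha) t)).
  exact: (measurableT_comp mG meigs).
have GE := @integral_pow_density _ plane R leb2 nu _ mdens d0 nuE N
  (fun t => G (map_tuple (eigenvalue_of alpha) t)) (fun t => G0 _) mGe.
apply: etrans (esym GE).
rewrite [LHS]integral_mkcond; apply: eq_integral => t _; rewrite patchE.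
pose z := map_tuple (eigenvalue_of alpha) t.
have zE i : tnth z i = eigenvalue_of alpha (tnth t i) by rewrite tnth_map.
have [pt|pt] := pselect (parameters D alpha t); last first.
  rewrite memNset; last by case.
  have /existsNP[j nj] : ~ forall j, param_set alpha D (tnth t j) by [].
  rewrite (bigD1 j)//= /param_density indicE memNset// !mul0r mule0//.
have dE : \prod_(i < N) param_density alpha D (tnth t i) =
    \prod_(j < N) Num.sqrt (Qpoly alpha)^`().[(tnth t j).1].
  apply: eq_bigr => i _; rewrite /param_density indicE mem_set ?mul1r//; exact: pt.
have Dz : cube D N z by move=> i; rewrite zE; have [] := pt i.
have [At|At] := pselect (A z); last first.
  rewrite memNset; last by case.
  by rewrite /G indicE memNset// mul0r mul0e.
rewrite mem_set; last by split.
rewrite /G indicE mem_set// mul1r -EFinM -(vandermonde_boltzmann Dz) dE /density.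
congr EFin; rewrite -!mulrA; congr (_ * _); rewrite mulrC; congr (_ * _).
Qed.

End GibbsIdentification.

(** * Convergence of the correlation measures *)

Section GibbsFacts.
Context {R : realType} (D : set (R * R)) (W : R * R -> R) (R0 BW : R).
Hypotheses (mD : measurable D) (mW : measurable_fun [set: R * R] W).

Lemma gibbs_ext (rho1 rho2 : {finite_measure set (R * R)%type -> \bar R}) N
    (P : probability (N.-tuple (R * R)) R) :
  (forall A, measurable A -> rho2 A = rho1 A) ->
  gibbs D W R0 BW rho1 P -> gibbs D W R0 BW rho2 P.
Proof.
move=> E [c PE]; exists c => A mA; rewrite PE//; congr (_ * _)%E.
have mb : measurable_fun [set: N.-tuple (R * R)] (fun z => (boltzmann D W R0 BW z)%:E).
  by apply: measurable_EFin_comp; exact: measurable_boltzmann.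
rewrite [LHS]integral_mkcond [RHS]integral_mkcond; apply/esym.
have mid : measurable_fun [set: (R * R)%type] (id : R * R -> R * R).
  by move=> _ Y mY; rewrite setTI.
rewrite (integral_pow_pushforward (mu := rho1) mid E); last 2 first.
- move=> t; rewrite patchE; case: ifP => // _; by rewrite lee_fin boltzmann_ge0.
- by apply/(measurable_restrictT _ mA); exact: measurable_funTS.
by apply: eq_integral => t _; congr (_ _); apply/val_inj; rewrite /= map_id.
Qed.

Lemma gibbs_cube (rho : {finite_measure set (R * R)%type -> \bar R}) N
    (P : probability (N.-tuple (R * R)) R) :
  gibbs D W R0 BW rho P -> (P (cube D N) = 1)%E.
Proof.
move=> [c PE]; have mc : measurable (cube D N) by exact: (measurable_cube_gen (fun=> mD)).
have h : (P (~` cube D N) = 0)%E.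
  rewrite PE; last exact: measurableC.
  rewrite integral0_eq ?mule0// => z nz; rewrite /boltzmann indicE memNset ?mul0r//.
  by case.
have := probability_setC P (measurableC mc); rewrite setCK => ->.
by rewrite h sube0.
Qed.

End GibbsFacts.

Section CompactDomain.
Context {R : realType} (U D : set (R * R)).
Hypotheses (bU : bounded_set U) (DE : D = closure U).

Lemma closed_domain : closed D. Proof. by rewrite DE; exact: closed_closure. Qed.

Lemma bounded_domain : exists r : R, forall z, D z -> `|z.1| <= r /\ `|z.2| <= r.
Proof.
have [M [_ HM]] := bU; exists (M + 1).
have M1 : M < M + 1 by rewrite ltrDl.
have c1 : closed [set z : R * R | `|z.1| <= M + 1].
  rewrite (_ : mkset _ = (fun z : R * R => `|z.1|) @^-1` [set x | x <= M + 1])//.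
  apply: closed_comp; last exact: closed_le.
  move=> z _; apply: (@continuous_comp _ _ _ (fst : R * R -> R)).
    exact: cvg_fst.
  exact: norm_continuous.
have c2 : closed [set z : R * R | `|z.2| <= M + 1].
  rewrite (_ : mkset _ = (fun z : R * R => `|z.2|) @^-1` [set x | x <= M + 1])//.
  apply: closed_comp; last exact: closed_le.
  move=> z _; apply: (@continuous_comp _ _ _ (snd : R * R -> R)).
    exact: cvg_snd.
  exact: norm_continuous.
have UK : U `<=` [set z : R * R | `|z.1| <= M + 1] `&` [set z : R * R | `|z.2| <= M + 1].
  move=> z Uz; have := HM _ M1 z Uz; rewrite /= prod_normE ge_max => /andP[? ?].
  by split.
move=> z; rewrite DE => /(closure_subset UK).
have /closure_id <- := closedI c1 c2.
by case.
Qed.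

End CompactDomain.

Unset Implicit Arguments.
Set Strict Implicit.

Theorem mainTheorem1 (R : realType) (D : set (R * R)) (W : R * R -> R)
    (sigma : probability (R * R)%type R)
    (hD : compact_domain D) (hW : continuous W)
    (hsigma : is_equilibrium_measure D W sigma)
    (m : nat) (hm : (1 <= m)%N)
    (lambda : 'I_m -> R) (hlambda : \sum_(i < m) lambda i = 0)
    (mu : forall N, probability (N.-tuple (R * R)) R)
    (hmu : forall N, (1 <= N)%N ->
       is_eigenvalue_distribution lambda D W (mu N))
    (k : nat) (hk : (1 <= k)%N) :
  weakly_cvg_on D (fun n => correlation (mu (k + n)%N)) (measure_pow sigma k).
Proof.
have [U [U0 bU cU oU DE]] := hD.
have cD := closed_domain DE; have [r Dr] := bounded_domain bU DE.
have compD := compact_plane cD Dr; have mD := closed_measurable2 cD.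
have UD : U `<=` D by rewrite DE; exact: subset_closure.
have DU : D `<=` closure U by rewrite DE.
have mW := continuous_measurable2 hW.
(* Adding [BW] to the potential and [ln R0] to the logarithmic kernel makes the
   energy an integral of nonnegative functions. *)
have [BW BW0 WBW] : exists2 BW, 0 <= BW & forall z, D z -> `|W z| <= BW.
  have cW : compact (W @` D).
    by apply: continuous_compact => //; exact: continuous_subspaceT.
  have [M [_ HM]] := compact_bounded cW.
  exists (`|M| + 1); first by rewrite addr_ge0.
  move=> z Dz; apply: (HM (`|M| + 1)); last by exists z.
  by rewrite (le_lt_trans (ler_norm M))// ltrDl.
have WB z : D z -> 0 <= W z + BW.
  by move=> /WBW; rewrite ler_norml => /andP[]; lra.
have potB z : D z -> pot W BW z <= 2 * BW.
  by move=> Dz; rewrite (potE WB)//; have := WBW z Dz; rewrite ler_norml => /andP[]; lra.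
have potC e : 0 < e -> exists2 dl, 0 < dl & forall z w, D z -> D w ->
    cabs (z - w) <= dl -> pot W BW z <= pot W BW w + e.
  move=> e0; have [dl dl0 H] := compact_plane_modulus compD hW e0.
  exists dl => // z w Dz Dw zw; rewrite !(potE WB)//.
  by have := H z w Dz Dw zw; rewrite ler_norml => /andP[]; lra.
pose R0 := 4 * `|r| + 1.
have R01 : 1 <= R0 by rewrite lerDr mulr_ge0.
have DR0 z w : D z -> D w -> cabs (z - w) <= R0.
  move=> /Dr[z1 z2] /Dr[w1 w2]; apply: (le_trans (cabs_le_sum _)).
  have h1 := ler_normB z.1 w.1; have h2 := ler_normB z.2 w.2; have h3 := ler_norm r.
  by rewrite /R0 /=; lra.
(* The reference measure is built from the numbers [alpha] for [N = 1]. Those for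
   other [N] differ by a constant, which does not change it. *)
have [alpha [lalpha [c0 mu1]]] := hmu 1%N isT.
pose rho := eigenmeasure alpha hm cD Dr.
have spreadP := eigenmeasure_spread alpha hm cD Dr oU UD cU U0 DU.
have gN N : (0 < N)%N -> gibbs D W R0 BW rho (mu N).
  move=> N0; have [beta [lbeta [c muE]]] := hmu N N0.
  have gb := eigenvalue_distribution_gibbs hm cD Dr R01 DR0 WB mW muE.
  have [s sE] := cyclic_difference lalpha lbeta.
  apply: (gibbs_ext mD mW (rho1 := eigenmeasure beta hm cD Dr) _ gb) => A mA.
  exact: (eigenmeasure_shift hm cD Dr sE mA).
have [[sD sat] _] := hsigma.
apply: (weak_limit cD Dr _ _ sD _ hk).
- by move=> N s F N0 sK F0 mF; exact: (gibbs_invol mD mW (gN N N0) sK F0 mF).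
- by move=> N N0; exact: (gibbs_cube mD (gN N N0)).
- move=> f tf; have [mf f01] := testfun_bounded tf; split=> // e e0.
  have [N0 H] := gibbs_empirical mD R01 BW0 DR0 WB mW potB hsigma potC spreadP tf e0.
  exists (maxn N0 1) => N; rewrite geq_max => /andP[N0N N1].
  rewrite -lee_fin meanE; first exact: H (gN N N1).
  have me := measurable_empirical (N := N) mf.
  apply: bounded_norm; apply: boundedB; last exact: bounded_cst.
  split=> //; exists 1 => z; have /andP[a0 a1] := empirical01 z f01.
  by rewrite ger0_norm.
Qed.
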